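(* Let $q\in(0,1)$ and $c\in[0,+\infty]$, and let $\mathcal{A}_c=\mathcal{O}(S^2_{qc})\rtimes\mathcal{U}_q(\mathrm{su}_2)$ be the cross product $*$-algebra described in the context. For $l_0\in\frac12\mathbb{N}_0$ consider the $*$-representations of $\mathcal{A}_c$ with the property $(\ast)$ the restriction to the $*$-subalgebra $\mathcal{U}_q(\mathrm{su}_2)$ is the direct sum representation $\bigoplus_{n=0}^\infty T_{l_0+n}$. Then: (1) For every $l_0\in\frac12\mathbb{N}=\{\frac12,1,\frac32,\dots\}$ there exist, up to unitary equivalence, exactly two $*$-representations of $\mathcal{A}_c$ with property $(\ast)$; that is, there are two such representations which are not unitarily equivalent, and every such representation is unitarily equivalent to one of them. (2) For $l_0=0$ there exists, up to unitary equivalence, exactly one $*$-representation of $\mathcal{A}_c$ with property $(\ast)$. (3) All these representations are irreducible.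
   Context: Notation: $\mathbb{N}=\{1,2,\dots\}$, $\mathbb{N}_0=\{0,1,2,\dots\}$, $\lambda:=q-q^{-1}$, $[n]:=(q^n-q^{-n})/(q-q^{-1})$. $\mathcal{U}_q(\mathrm{su}_2)$ is the unital complex $*$-algebra with generators $E,F,K,K^{-1}$, relations $KK^{-1}=K^{-1}K=1$, $KE=qEK$, $FK=qKF$, $EF-FE=\lambda^{-1}(K^2-K^{-2})$, and involution $E^*=F$, $K^*=K$. The algebra $\mathcal{O}(S^2_{qc})$ of the Podleś sphere is the unital $*$-algebra with generators $A=A^*$, $B$, $B^*$ and relations: - for $c<\infty$: $AB=q^{-2}BA$, $AB^*=q^2B^*A$, $B^*B=A-A^2+c$, $BB^*=q^2A-q^4A^2+c$; - for $c=+\infty$: $AB=q^{-2}BA$, $AB^*=q^2B^*A$, $B^*B=-A^2+1$, $BB^*=-q^4A^2+1$. The cross product $*$-algebra $\mathcal{A}_c=\mathcal{O}(S^2_{qc})\rtimes\mathcal{U}_q(\mathrm{su}_2)$ is the $*$-algebra with generators $A,B,B^*,E,F,K,K^{-1}$ (with involution $A^*=A$, $(B)^*=B^*$, $E^*=F$, $K^*=K$), the relations $KK^{-1}=K^{-1}K=1$, $KE=qEK$, $FK=qKF$, $EF-FE=\lambda^{-1}(K^2-K^{-2})$ of $\mathcal{U}_q(\mathrm{su}_2)$, the relations of $\mathcal{O}(S^2_{qc})$ (that is, $AB=q^{-2}BA$, $AB^*=q^2B^*A$ together with $B^*B=A-A^2+c$, $BB^*=q^2A-q^4A^2+c$ if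 $c<\infty$, and together with $B^*B=-A^2+1$, $BB^*=-q^4A^2+1$ if $c=+\infty$), and the following cross relations. Put $\theta=1$ if $c<\infty$ and $\theta=0$ if $c=+\infty$. Then $KA=AK$, $EA=AE+q^{-1/2}B^*K$, $FA=AF-q^{-3/2}BK$, $KB=q^{-1}BK$, $EB=qBE-q^{1/2}(1+q^2)AK+\theta q^{1/2}K$, $FB=qBF$, $KB^*=qB^*K$, $EB^*=q^{-1}B^*E$, $FB^*=q^{-1}B^*F+q^{-1/2}(1+q^2)AK-\theta q^{-1/2}K$. For $l\in\frac12\mathbb{N}_0$, $T_l$ denotes the irreducible type 1 spin $l$ $*$-representation of $\mathcal{U}_q(\mathrm{su}_2)$ on the $(2l+1)$-dimensional Hilbert space $V_l$ with orthonormal basis $\{v^l_j: j=-l,-l+1,\dots,l\}$ given by $Kv^l_j=q^jv^l_j$, $Ev^l_j=[l-j]^{1/2}[l+j+1]^{1/2}v^l_{j+1}$, $Fv^l_j=[l-j+1]^{1/2}[l+j]^{1/2}v^l_{j-1}$ (with $v^l_{l+1}=v^l_{-l-1}=0$). A $*$-representation of a unital $*$-algebra $\mathcal{A}$ is a unital algebra homomorphism $\pi$ from $\mathcal{A}$ to the linear operators of an inner product space $\mathcal{D}$ (a dense domain of a Hilbert space) into itself with $\langle\pi(a)\xi,\eta\rangle=\langle\xi,\pi(a^* )\eta\rangle$ for all $a\in\mathcal{A}$ and $\xi,\eta\in\mathcal{D}$. In property $(\ast)$ the domain is $\mathcal{D}=\bigoplus_{n=0}^\infty V_{l_0+n}$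 (algebraic orthogonal direct sum). Unitary equivalence means existence of an isometric linear bijection between the domains intertwining the representations. Irreducible means that $\mathcal{D}$ is not the orthogonal direct sum of two nonzero invariant subspaces. *)

(* Defs.v *)
From HB Require Import structures.
From mathcomp Require Import all_boot all_order all_algebra.
From mathcomp Require Import finmap complex.
From mathcomp Require Import boolp constructive_ereal reals exp.
(* monalg's notations clash with those of the analysis libraries. *)
From mathcomp Require monalg.
Import -(notations) monalg.

Set Implicit Arguments.
Unset Strict Implicit.
Unset Printing Implicit Defensive.

Import Order.TTheory GRing.Theory Num.Theory.
Local Open Scope ring_scope.
Local Open Scope quotient_scope.

(* Unital *-algebras over C.  The library's algType requires 1 != 0, which is not
   known a priori for an algebra given by generators and relations, so the
   ring structure is part of the interface. *)
HB.mixin Record isStarAlgebra (C : numClosedFieldType) (A : Type)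
    of GRing.Lmodule C A := {
  saone : A;
  samul : A -> A -> A;
  star : A -> A;
  samulA : associative samul;
  samul1l : left_id saone samul;
  samul1r : right_id saone samul;
  samulDl : left_distributive samul +%R;
  samulDr : right_distributive samul +%R;
  samulZl : forall (z : C) (x y : A), samul (z *: x) y = z *: samul x y;
  samulZr : forall (z : C) (x y : A), samul x (z *: y) = z *: samul x y;
  starK : involutive star;
  starD : {morph star : x y / x + y};
  starZ : forall (z : C) (x : A), star (z *: x) = z^* *: star x;
  starM : forall x y : A, star (samul x y) = samul (star y) (star x)
}.

#[short(type="starAlgType")]
HB.structure Definition StarAlgebra (C : numClosedFieldType) :=
  {A of isStarAlgebra C A & GRing.Lmodule C A}.

Record starHom (C : numClosedFieldType) (A B : starAlgType C) := StarHom {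
  starHom_fun :> A -> B;
  starHom1 : starHom_fun saone = saone;
  starHomD : {morph starHom_fun : x y / x + y};
  starHomZ : forall (z : C) (x : A), starHom_fun (z *: x) = z *: starHom_fun x;
  starHomM : {morph starHom_fun : x y / samul x y};
  starHomS : {morph starHom_fun : x / star x}
}.

(* *-algebras given by generators and relations: the quotient of the formal
   *-polynomial expressions in the generators by the smallest congruence that
   contains the axioms of unital complex *-algebras and the relations. *)
Inductive expr (C G : Type) : Type :=
| Gen of G
| Cst of C
| Add of expr C G & expr C G
| Mul of expr C G & expr C G.

Arguments Gen {C G} _.
Arguments Cst {C G} _.

HB.instance Definition _ (C G : Type) := gen_eqMixin (expr C G).
HB.instance Definition _ (C G : Type) := gen_choiceMixin (expr C G).

Declare Scope expr_scope.
Delimit Scope expr_scope with X.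
Bind Scope expr_scope with expr.
Infix "+" := Add : expr_scope.
Infix "*" := Mul : expr_scope.
Notation "z *' x" := (Mul (Cst z%R) x) (at level 40) : expr_scope.
Notation "x - y" := (Add x (-1 *' y)%X) : expr_scope.
Notation "1" := (Cst 1%R) : expr_scope.

Fixpoint emap (C G H : Type) (f : G -> H) (e : expr C G) : expr C H :=
  match e with
  | Gen g => Gen (f g)
  | Cst z => Cst z
  | Add a b => Add (emap f a) (emap f b)
  | Mul a b => Mul (emap f a) (emap f b)
  end.

(* The involution is prescribed by its values gstar on the generators. *)
Record presentation (C : numClosedFieldType) := Presentation {
  gen : Type;
  gstar : gen -> gen;
  gstarK : involutive gstar;
  rels : expr C gen -> expr C gen -> Prop
}.

Section Presented.
Variables (C : numClosedFieldType) (P : presentation C).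
Notation ex := (expr C (gen P)).

Fixpoint estar (e : ex) : ex :=
  match e with
  | Gen g => Gen (gstar g)
  | Cst z => Cst z^*
  | Add a b => Add (estar a) (estar b)
  | Mul a b => Mul (estar b) (estar a)
  end.

Inductive congr : ex -> ex -> Prop :=
| congr_rel a b : rels a b -> congr a b
| congr_refl a : congr a a
| congr_sym a b : congr a b -> congr b a
| congr_trans b a c : congr a b -> congr b c -> congr a c
| congr_add a a' b b' : congr a a' -> congr b b' -> congr (a + b) (a' + b')
| congr_mul a a' b b' : congr a a' -> congr b b' -> congr (a * b) (a' * b')
| congr_star a b : congr a b -> congr (estar a) (estar b)
| congr_addA a b c : congr (a + (b + c)) (a + b + c)
| congr_addC a b : congr (a + b) (b + a)
| congr_mulA a b c : congr (a * (b * c)) (a * b * c)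
| congr_mulDl a b c : congr ((a + b) * c) (a * c + b * c)
| congr_mulDr a b c : congr (a * (b + c)) (a * b + a * c)
| congr_0 a : congr (Cst 0 + a) a
| congr_N a : congr (-1 *' a + a) (Cst 0)
| congr_1l a : congr (1 * a) a
| congr_1r a : congr (a * 1) a
| congr_cstD z w : congr (Cst (z + w)) (Cst z + Cst w)
| congr_cstM z w : congr (Cst (z * w)) (Cst z * Cst w)
| congr_cstC z a : congr (Cst z * a) (a * Cst z).

Definition congrb (a b : ex) : bool := `[< congr a b >].

Fact congrb_refl : reflexive congrb.
Proof. by move=> a; apply/asboolP; exact: congr_refl. Qed.

Fact congrb_sym : symmetric congrb.
Proof.
by move=> a b; apply/asboolP/asboolP; exact: congr_sym.
Qed.

Fact congrb_trans : transitive congrb.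
Proof.
move=> b a c /asboolP ab /asboolP bc; apply/asboolP.
exact: congr_trans ab bc.
Qed.

Canonical congrb_equiv := EquivRel congrb congrb_refl congrb_sym congrb_trans.

Definition presented : Type := {eq_quot congrb}.

HB.instance Definition _ := Choice.on presented.

Definition cls (e : ex) : presented := \pi_({eq_quot congrb}) e.
Definition rpr (x : presented) : ex := repr (x : {eq_quot congrb}).

Lemma clsP a b : cls a = cls b <-> congr a b.
Proof.
split=> [/eqquotP/asboolP //|ab].
by apply/eqquotP/asboolP.
Qed.

Lemma rprK x : cls (rpr x) = x.
Proof. exact: reprK. Qed.

Lemma rpr_cls a : congr (rpr (cls a)) a.
Proof. by apply/clsP; rewrite rprK. Qed.

Lemma presentedW (Q : presented -> Prop) :
  (forall e, Q (cls e)) -> forall x, Q x.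
Proof. by move=> H x; rewrite -(rprK x). Qed.

Definition padd x y := cls (rpr x + rpr y).
Definition pmul x y := cls (rpr x * rpr y).
Definition pscale z x := cls (z *' rpr x).
Definition popp x := pscale (-1) x.
Definition pstar x := cls (estar (rpr x)).

Lemma clsD a b : padd (cls a) (cls b) = cls (a + b).
Proof. by apply/clsP/congr_add; exact: rpr_cls. Qed.

Lemma clsM a b : pmul (cls a) (cls b) = cls (a * b).
Proof. by apply/clsP/congr_mul; exact: rpr_cls. Qed.

Lemma clsZ z a : pscale z (cls a) = cls (z *' a).
Proof. by apply/clsP/congr_mul; [exact: congr_refl|exact: rpr_cls]. Qed.

Lemma clsS a : pstar (cls a) = cls (estar a).
Proof. by apply/clsP/congr_star; exact: rpr_cls. Qed.

Fact paddA : associative padd.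
Proof.
do 3![elim/presentedW=> ?]; rewrite !clsD; apply/clsP; exact: congr_addA.
Qed.

Fact paddC : commutative padd.
Proof. do 2![elim/presentedW=> ?]; rewrite !clsD; apply/clsP; exact: congr_addC. Qed.

Fact padd0 : left_id (cls (Cst 0)) padd.
Proof. elim/presentedW=> ?; rewrite !clsD; apply/clsP; exact: congr_0. Qed.

Fact paddN : left_inverse (cls (Cst 0)) popp padd.
Proof. elim/presentedW=> ?; rewrite /popp clsZ clsD; apply/clsP; exact: congr_N. Qed.

HB.instance Definition _ := GRing.isZmodule.Build presented paddA paddC padd0 paddN.

Fact pmulA : associative pmul.
Proof.
do 3![elim/presentedW=> ?]; rewrite !clsM; apply/clsP; exact: congr_mulA.
Qed.

Fact pmul1l : left_id (cls 1) pmul.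
Proof. elim/presentedW=> ?; rewrite clsM; apply/clsP; exact: congr_1l. Qed.

Fact pmul1r : right_id (cls 1) pmul.
Proof. elim/presentedW=> ?; rewrite clsM; apply/clsP; exact: congr_1r. Qed.

Fact pmulDl : left_distributive pmul padd.
Proof.
do 3![elim/presentedW=> ?]; rewrite !(clsM, clsD); apply/clsP.
exact: congr_mulDl.
Qed.

Fact pmulDr : right_distributive pmul padd.
Proof.
do 3![elim/presentedW=> ?]; rewrite !(clsM, clsD); apply/clsP.
exact: congr_mulDr.
Qed.

Fact pscaleA z w x : pscale z (pscale w x) = pscale (z * w) x.
Proof.
elim/presentedW: x => a; rewrite !clsZ; apply/clsP.
apply: congr_trans (congr_mulA _ _ _) _.
by apply: congr_mul; [exact/congr_sym/congr_cstM|exact: congr_refl].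
Qed.

Fact pscale1 : left_id 1 pscale.
Proof. elim/presentedW=> a; rewrite clsZ; apply/clsP; exact: congr_1l. Qed.

Fact pscaleDr : right_distributive pscale padd.
Proof.
move=> z; do 2![elim/presentedW=> ?]; rewrite !(clsZ, clsD); apply/clsP.
exact: congr_mulDr.
Qed.

Fact pscaleDl x : {morph pscale^~ x : z w / z + w >-> padd z w}.
Proof.
elim/presentedW: x => a z w; rewrite /= !clsZ clsD; apply/clsP.
apply: congr_trans (congr_mulDl _ _ _).
by apply: congr_mul; [exact: congr_cstD|exact: congr_refl].
Qed.

HB.instance Definition _ := GRing.Zmodule_isLmodule.Build C presented
  pscaleA pscale1 pscaleDr pscaleDl.

Lemma estarK : involutive estar.
Proof.
elim=> [g|z|a iha b ihb|a iha b ihb] /=; first by rewrite gstarK.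
- by rewrite conjCK.
- by rewrite iha ihb.
- by rewrite iha ihb.
Qed.

Fact pmulZl z (x y : presented) : pmul (z *: x) y = z *: pmul x y.
Proof.
elim/presentedW: x => a; elim/presentedW: y => b.
change (pmul (pscale z (cls a)) (cls b) = pscale z (pmul (cls a) (cls b))).
rewrite !(clsM, clsZ); apply/clsP/congr_sym; exact: congr_mulA.
Qed.

Fact pmulZr z (x y : presented) : pmul x (z *: y) = z *: pmul x y.
Proof.
elim/presentedW: x => a; elim/presentedW: y => b.
change (pmul (cls a) (pscale z (cls b)) = pscale z (pmul (cls a) (cls b))).
rewrite !(clsM, clsZ); apply/clsP/congr_sym.
apply: congr_trans (congr_mulA _ _ _) _.
apply: congr_trans (congr_sym (congr_mulA _ _ _)).
by apply: congr_mul; [exact: congr_cstC|exact: congr_refl].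
Qed.

Fact pstarK : involutive pstar.
Proof. by elim/presentedW=> a; rewrite !clsS estarK. Qed.

Fact pstarD : {morph pstar : x y / (x : presented) + y}.
Proof.
elim/presentedW=> a; elim/presentedW=> b.
change (pstar (padd (cls a) (cls b)) = padd (pstar (cls a)) (pstar (cls b))).
by rewrite !(clsD, clsS).
Qed.

Fact pstarZ z (x : presented) : pstar (z *: x) = z^* *: (pstar x : presented).
Proof.
elim/presentedW: x => a.
change (pstar (pscale z (cls a)) = pscale z^* (pstar (cls a))).
rewrite !(clsZ, clsS) /=; apply/clsP; exact/congr_sym/congr_cstC.
Qed.

Fact pstarM (x y : presented) : pstar (pmul x y) = pmul (pstar y) (pstar x).
Proof.
elim/presentedW: x => a; elim/presentedW: y => b.
by rewrite !(clsM, clsS).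
Qed.

HB.instance Definition _ := isStarAlgebra.Build C presented
  pmulA pmul1l pmul1r pmulDl pmulDr pmulZl pmulZr pstarK pstarD pstarZ pstarM.

Definition pgen (g : gen P) : presented := cls (Gen g).

End Presented.

(* A map of generators respecting involutions and relations induces a
   *-homomorphism of the presented algebras. *)
Section PresentedHom.
Variables (C : numClosedFieldType) (P Q : presentation C).
Variable f : gen P -> gen Q.
Hypothesis fstar : forall g, f (gstar g) = gstar (f g).
Hypothesis frels : forall a b, rels a b -> rels (emap f a) (emap f b).

Lemma emap_estar a : emap f (estar a) = estar (emap f a).
Proof. by elim: a => //= [g|a -> b ->|a -> b ->] //; rewrite fstar. Qed.

Lemma emap_congr (a b : expr C (gen P)) :
  congr a b -> congr (emap f a) (emap f b).
Proof.
elim=> /= *; rewrite ?emap_estar; try solve [constructor; by auto].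
by apply: congr_trans; eassumption.
Qed.

Definition phom_fun (x : presented P) : presented Q := cls (emap f (rpr x)).

Lemma phom_cls a : phom_fun (cls a) = cls (emap f a).
Proof. by apply/clsP/emap_congr/rpr_cls. Qed.

Fact phom1 : phom_fun saone = saone.
Proof. by rewrite [saone]/(cls 1) phom_cls. Qed.

Fact phomD : {morph phom_fun : x y / x + y}.
Proof.
elim/presentedW=> a; elim/presentedW=> b.
change (phom_fun (padd (cls a) (cls b)) =
        padd (phom_fun (cls a)) (phom_fun (cls b))).
by rewrite !(clsD, phom_cls).
Qed.

Fact phomM : {morph phom_fun : x y / samul x y}.
Proof.
elim/presentedW=> a; elim/presentedW=> b.
change (phom_fun (pmul (cls a) (cls b)) =
        pmul (phom_fun (cls a)) (phom_fun (cls b))).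
by rewrite !(clsM, phom_cls).
Qed.

Fact phomZ z x : phom_fun (z *: x) = z *: phom_fun x.
Proof.
elim/presentedW: x => a.
change (phom_fun (pscale z (cls a)) = pscale z (phom_fun (cls a))).
by rewrite !(clsZ, phom_cls).
Qed.

Fact phomS : {morph phom_fun : x / star x}.
Proof.
elim/presentedW=> a.
change (phom_fun (pstar (cls a)) = pstar (phom_fun (cls a))).
by rewrite !(clsS, phom_cls) emap_estar.
Qed.

Definition phom : starHom (presented P) (presented Q) :=
  StarHom phom1 phomD phomZ phomM phomS.

End PresentedHom.

(* *-representations on an inner product space (D, ip); ip is linear in its
   first argument. *)
Record starRep (C : numClosedFieldType) (A : starAlgType C) (D : lmodType C)
    (ip : {dot D for Num.conj}) := StarRep {
  rep :> A -> {linear D -> D};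
  rep1 : forall u, rep saone u = u;
  repD : forall a b u, rep (a + b) u = rep a u + rep b u;
  repZ : forall z a u, rep (z *: a) u = z *: rep a u;
  repM : forall a b u, rep (samul a b) u = rep a (rep b u);
  repS : forall a u v, ip (rep a u) v = ip u (rep (star a) v)
}.

Section Restriction.
Variables (C : numClosedFieldType) (A B : starAlgType C) (D : lmodType C).
Variables (ip : {dot D for Num.conj}) (h : starHom A B) (pi : starRep B ip).

Fact restr1 u : pi (h saone) u = u.
Proof. by rewrite starHom1 rep1. Qed.
Fact restrD a b u : pi (h (a + b)) u = pi (h a) u + pi (h b) u.
Proof. by rewrite starHomD repD. Qed.
Fact restrZ z a u : pi (h (z *: a)) u = z *: pi (h a) u.
Proof. by rewrite starHomZ repZ. Qed.
Fact restrM a b u : pi (h (samul a b)) u = pi (h a) (pi (h b) u).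
Proof. by rewrite starHomM repM. Qed.
Fact restrS a u v : ip (pi (h a) u) v = ip u (pi (h (star a)) v).
Proof. by rewrite starHomS repS. Qed.

Definition restriction : starRep A ip :=
  StarRep restr1 restrD restrZ restrM restrS.

End Restriction.

Section RepNotions.
Variables (C : numClosedFieldType) (A : starAlgType C).

Definition unitarily_equivalent (D1 D2 : lmodType C)
    (ip1 : {dot D1 for Num.conj}) (ip2 : {dot D2 for Num.conj})
    (pi1 : starRep A ip1) (pi2 : starRep A ip2) : Prop :=
  exists U : {linear D1 -> D2},
    [/\ bijective U,
        forall u v, ip2 (U u) (U v) = ip1 u v &
        forall a u, U (pi1 a u) = pi2 a (U u)].

Variables (D : lmodType C) (ip : {dot D for Num.conj}).

Definition invariant_subspace (pi : starRep A ip) (W : D -> Prop) : Prop :=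
  [/\ W 0, forall z u v, W u -> W v -> W (z *: u + v) &
      forall a u, W u -> W (pi a u)].

Definition irreducible (pi : starRep A ip) : Prop :=
  ~ exists W1 W2 : D -> Prop,
      [/\ invariant_subspace pi W1 /\ invariant_subspace pi W2,
          exists2 u, W1 u & u <> 0,
          exists2 u, W2 u & u <> 0,
          forall u v, W1 u -> W2 v -> ip u v = 0 &
          forall w, exists u v, [/\ W1 u, W2 v & w = u + v]].

End RepNotions.

(* The space of finitely supported functions on I, with its standard basis
   orthonormal. *)
Section FinSupp.
Variables (C : numClosedFieldType) (I : choiceType).
Local Notation V := (malg I C).

Definition fsip (u v : V) : C :=
  \sum_(i <- msupp u) mcoeff i u * (mcoeff i v)^*.

Lemma fsipE (d : {fset I}) (u v : V) : (msupp u `<=` d)%fset ->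
  fsip u v = \sum_(i <- d) mcoeff i u * (mcoeff i v)^*.
Proof.
move=> ud; rewrite /fsip; apply: big_fset_incl => // i _.
by rewrite -mcoeff_eq0 => /eqP->; rewrite mul0r.
Qed.

Fact fsip_bilinear :
  bilinear_for ( *%R ) (Num.conj \; *%R : C -> C -> C) fsip.
Proof.
split=> [v z u w|u z v w] /=.
  pose d := (msupp u `|` msupp w `|` msupp (z *: u + w))%fset.
  rewrite !(@fsipE d); try by apply/fsubsetP => i; rewrite !inE => ->; rewrite ?orbT.
  rewrite mulr_sumr -big_split /=; apply: eq_bigr => i _.
  by rewrite mcoeffD mcoeffZ mulrDl mulrA.
rewrite /fsip mulr_sumr -big_split /=; apply: eq_bigr => i _.
by rewrite mcoeffD mcoeffZ rmorphD rmorphM mulrDr mulrCA.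
Qed.

HB.instance Definition _ := bilinear_isBilinear.Build C V V C
  ( *%R ) (Num.conj \; *%R) fsip fsip_bilinear.

Fact fsip_herm (u v : V) : fsip u v = (-1) ^+ false * (fsip v u)^*.
Proof.
rewrite expr0 mul1r.
rewrite (@fsipE (msupp u `|` msupp v)%fset) ?fsubsetUl //.
rewrite (@fsipE (msupp u `|` msupp v)%fset v) ?fsubsetUr // rmorph_sum /=.
by apply: eq_bigr => i _; rewrite rmorphM /= conjCK mulrC.
Qed.

HB.instance Definition _ :=
  isHermitianSesquilinear.Build C V false Num.conj fsip fsip_herm.

Fact fsip_gt0 (u : V) : u != 0 -> 0 < fsip u u.
Proof.
move=> u0; rewrite lt_def sumr_ge0 ?andbT => [|i _]; last exact: mul_conjC_ge0.
apply: contra u0 => /eqP s0; apply/eqP/malgP => i; rewrite mcoeff0.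
apply/eqP; apply: contraTT isT => ui.
have iu : i \in msupp u by rewrite -mcoeff_neq0.
suff : 0 < fsip u u by rewrite s0 ltxx.
rewrite /fsip (big_fsetD1 i) //= ltr_pwDl ?mul_conjC_gt0 //.
by apply: sumr_ge0 => j _; exact: mul_conjC_ge0.
Qed.

HB.instance Definition _ := isDotProduct.Build C V fsip fsip_gt0.

End FinSupp.

Section CrossProduct.
Variables (R : realType) (q : R) (c : \bar R).
Local Notation C := R[i].
Local Open Scope complex_scope.
Local Open Scope expr_scope.

Definition qpow (x : R) : C := (q `^ x)%:C.

(* gKi stands for K^-1, gBs for B^*. *)
Inductive uq_gen := gE | gF | gK | gKi.

Definition uq_star (g : uq_gen) : uq_gen :=
  match g with gE => gF | gF => gE | gK => gK | gKi => gKi end.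

Fact uq_starK : involutive uq_star. Proof. by case. Qed.

Inductive uq_rel : expr C uq_gen -> expr C uq_gen -> Prop :=
| rel_KKi : uq_rel (Gen gK * Gen gKi) 1
| rel_KiK : uq_rel (Gen gKi * Gen gK) 1
| rel_KE : uq_rel (Gen gK * Gen gE) (q%:C *' (Gen gE * Gen gK))
| rel_FK : uq_rel (Gen gF * Gen gK) (q%:C *' (Gen gK * Gen gF))
| rel_EF : uq_rel (Gen gE * Gen gF - Gen gF * Gen gE)
             ((q - q^-1)^-1%R%:C *' (Gen gK * Gen gK - Gen gKi * Gen gKi)).

Inductive sphere_gen := gA | gB | gBs.

Definition sphere_star (g : sphere_gen) : sphere_gen :=
  match g with gA => gA | gB => gBs | gBs => gB end.

Fact sphere_starK : involutive sphere_star. Proof. by case. Qed.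

Inductive sphere_rel : expr C sphere_gen -> expr C sphere_gen -> Prop :=
| rel_AB : sphere_rel (Gen gA * Gen gB) (qpow (-2) *' (Gen gB * Gen gA))
| rel_ABs : sphere_rel (Gen gA * Gen gBs) (qpow 2 *' (Gen gBs * Gen gA))
| rel_BsB (r : R) : c = r%:E ->
    sphere_rel (Gen gBs * Gen gB) (Gen gA - Gen gA * Gen gA + Cst r%:C)
| rel_BBs (r : R) : c = r%:E ->
    sphere_rel (Gen gB * Gen gBs)
      (qpow 2 *' Gen gA - qpow 4 *' (Gen gA * Gen gA) + Cst r%:C)
| rel_BsB_oo : c = +oo%E ->
    sphere_rel (Gen gBs * Gen gB) (1 - Gen gA * Gen gA)
| rel_BBs_oo : c = +oo%E ->
    sphere_rel (Gen gB * Gen gBs) (1 - qpow 4 *' (Gen gA * Gen gA)).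

(* If c = -oo, sphere_rel lacks the last relations; only c >= 0 is of
   interest. *)
Definition cross_gen : Type := sphere_gen + uq_gen.

Definition cross_star (g : cross_gen) : cross_gen :=
  match g with inl a => inl (sphere_star a) | inr x => inr (uq_star x) end.

Fact cross_starK : involutive cross_star.
Proof. by case=> g /=; rewrite ?sphere_starK ?uq_starK. Qed.

Definition theta : C := if c == +oo%E then 0%R else 1%R.

Let A : expr C cross_gen := Gen (inl gA).
Let B : expr C cross_gen := Gen (inl gB).
Let Bs : expr C cross_gen := Gen (inl gBs).
Let E : expr C cross_gen := Gen (inr gE).
Let F : expr C cross_gen := Gen (inr gF).
Let K : expr C cross_gen := Gen (inr gK).

Inductive cross_rel : expr C cross_gen -> expr C cross_gen -> Prop :=
| cross_uq a b : uq_rel a b -> cross_rel (emap inr a) (emap inr b)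
| cross_sphere a b : sphere_rel a b -> cross_rel (emap inl a) (emap inl b)
| cross_KA : cross_rel (K * A) (A * K)
| cross_EA : cross_rel (E * A) (A * E + qpow (- (1 / 2)) *' (Bs * K))
| cross_FA : cross_rel (F * A) (A * F - qpow (- (3 / 2)) *' (B * K))
| cross_KB : cross_rel (K * B) (qpow (-1) *' (B * K))
| cross_EB : cross_rel (E * B)
    (q%:C *' (B * E) - (qpow (1 / 2) * (1 + qpow 2)) *' (A * K)
     + (theta * qpow (1 / 2)) *' K)
| cross_FB : cross_rel (F * B) (q%:C *' (B * F))
| cross_KBs : cross_rel (K * Bs) (q%:C *' (Bs * K))
| cross_EBs : cross_rel (E * Bs) (qpow (-1) *' (Bs * E))
| cross_FBs : cross_rel (F * Bs)
    (qpow (-1) *' (Bs * F) + (qpow (- (1 / 2)) * (1 + qpow 2)) *' (A * K)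
     - (theta * qpow (- (1 / 2))) *' K).

Definition uq_pres : presentation C := Presentation uq_starK uq_rel.
Definition cross_pres : presentation C := Presentation cross_starK cross_rel.

Definition Uq : starAlgType C := presented uq_pres.
Definition crossAlg : starAlgType C := presented cross_pres.

Definition uq_incl : starHom Uq crossAlg :=
  @phom C uq_pres cross_pres inr (fun=> erefl) cross_uq.

End CrossProduct.

(* The half-integer l0 is encoded by the natural number m = 2 * l0, and the
   weight j of v^l_j, l = l0 + n, by k = l + j, so that 0 <= k <= 2 l. *)
Section SpinSum.
Variables (R : realType) (q : R) (m : nat).
Local Notation C := R[i].
Local Open Scope complex_scope.

Definition qnum (x : R) : R := (q `^ x - q `^ (- x)) / (q - q^-1).

Definition spin_idx : choiceType := {n : nat & 'I_(m + n.*2).+1}.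

Definition spin_space : lmodType C := malg spin_idx C.

Definition spin_ip : {dot spin_space for Num.conj} := @fsip C spin_idx.

Definition spin (n : nat) : R := m%:R / 2 + n%:R.

(* v^l_{k-l}; it is 0 outside the range 0 <= k <= 2 l. *)
Definition spin_vec (n : nat) (k : int) : spin_space :=
  match k with
  | Posz k' =>
      if insub k' is Some i
      then mkmalgU (existT (fun n => 'I_(m + n.*2).+1) n i) 1 else 0
  | Negz _ => 0
  end.

(* rho is the direct sum of the T_{l0 + n}, n >= 0; the action of K^-1 is
   forced by that of K. *)
Definition is_spin_sum (rho : starRep (Uq q) spin_ip) : Prop :=
  forall (n : nat) (k : 'I_(m + n.*2).+1),
    let l := spin n in
    let j := k%:R - l in
    let v := spin_vec n in
    [/\ rho (@pgen _ (uq_pres q) gK) (v k) = (q `^ j)%:C *: v k,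
        rho (@pgen _ (uq_pres q) gE) (v k) =
          (Num.sqrt (qnum (l - j)) * Num.sqrt (qnum (l + j + 1)))%:C
            *: v (k%:Z + 1) &
        rho (@pgen _ (uq_pres q) gF) (v k) =
          (Num.sqrt (qnum (l - j + 1)) * Num.sqrt (qnum (l + j)))%:C
            *: v (k%:Z - 1)].

Definition has_property_star (c : \bar R)
    (pi : starRep (crossAlg q c) spin_ip) : Prop :=
  is_spin_sum (restriction (uq_incl q c) pi).

End SpinSum.

(* Main.v *)
Require Import Defs.
From HB Require Import structures.
From mathcomp Require Import all_boot all_order all_algebra.
From mathcomp Require Import finmap complex.
From mathcomp Require Import boolp constructive_ereal reals exp.
From mathcomp Require monalg.
Import -(notations) monalg.
From mathcomp Require Import ring zify.

Set Implicit Arguments.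
Unset Strict Implicit.
Unset Printing Implicit Defensive.

Import Order.TTheory GRing.Theory Num.Theory.
Local Open Scope ring_scope.

(** For a representation with property (star), let e_n be the lowest weight vector
    of V_(l0 + n).  Commuting with F and K shows that B e_n is a multiple
    bet n of e_(n+1), that A e_n has components only along e_n and E e_(n+1), with
    coefficients given by alp n = <A e_n, e_n> and bet n, and similarly for B*.
    Since E generates V_l from its lowest weight vector and its commutators with
    A, B, B* are known, the numbers alp n and bet n determine the representation,
    and the phases of the bet n can be removed by a unitary which is a scalar on
    every V_l.  The relation for B* B expresses |bet n|^2 through alp n, the relation
    A B = q^-2 B A is a first-order recursion for alp, and for l0 > 0 the relation
    for B B* at the bottom leaves d^2 = c + theta^2 / 4 for the remaining
    parameter d (with c replaced by 1 when c is infinite).  The two roots d give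
    different alp 0; for l0 = 0 both roots give the same sequence alp.

    Conversely, for either root the formulas define a representation: in a
    suitably rescaled basis all coefficients are rational, the cross relations are
    direct computations, and the sphere relations, being compatible with E, need
    to be verified on the e_n only.

    Irreducibility: F and K act diagonally on an orthogonal splitting, so e_0 lies
    in one of the two summands, and B and E generate everything from e_0 as all
    bet n are nonzero. *)

(** * Representations of presented *-algebras *)

(** The relations with E, F and K say that A, B and B*, up to a shift of A by a multiple of theta,
    form a spin 1 tensor operator. Hence they join a level n only to the levels n - 1, n and n + 1,
    each time with one reduced coefficient, and adjointness ties the downward coefficients to the
    upward ones. This is why so few numbers survive. The recursion for [alp] alone leaves one
    constant free. Subtracting theta / 2 and multiplying by 1 - q^(4 l + 4) turns it into a linear
    recursion with constant ratio q^2, which is solved explicitly. The constant is pinned down only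
    at the bottom, where no lower level contributes to B* e_0. Existence and irreducibility rest on
    one inequality: theta a - a^2 + c has to be positive at every a = [alp n], because it is |bet
    n|^2 up to a positive factor. It follows from a factorization and from c + theta^2 / 4 > 0,
    which also separates the two roots. *)

Section LinearMaps.
Variables (C : numClosedFieldType) (D : lmodType C) (f : {linear D -> D}).

Lemma linZ z u : f (z *: u) = z *: f u.
Proof. exact: linearZ. Qed.

Lemma linD u v : f (u + v) = f u + f v.
Proof. exact: linearD. Qed.

Lemma linB u v : f (u - v) = f u - f v.
Proof. exact: linearB. Qed.

End LinearMaps.

Section DotProduct.
Variables (C : numClosedFieldType) (D : lmodType C).
Variable ip : {dot D for Num.conj}.

Lemma ipDl u v w : ip (u + v) w = ip u w + ip v w.
Proof. exact: linearDl. Qed.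

Lemma ipDr u v w : ip u (v + w) = ip u v + ip u w.
Proof. exact: linearDr. Qed.

Lemma ipZl z u v : ip (z *: u) v = z * ip u v.
Proof. exact: linearZl_LR. Qed.

Lemma ipZr z u v : ip u (z *: v) = z^* * ip u v.
Proof. exact: linearZr_LR. Qed.

Lemma ipBl u v w : ip (u - v) w = ip u w - ip v w.
Proof. exact: linearBl. Qed.

Lemma ipBr u v w : ip u (v - w) = ip u v - ip u w.
Proof. exact: linearBr. Qed.

Lemma ipNl u v : ip (- u) v = - ip u v.
Proof. exact: linearNl. Qed.

Lemma ip0l u : ip 0 u = 0.
Proof. exact: linear0l. Qed.

Lemma ip0r u : ip u 0 = 0.
Proof. exact: linear0r. Qed.

Lemma ipC u v : ip u v = (ip v u)^*.
Proof. by rewrite hermC expr0 mul1r. Qed.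

Lemma ip_eq0 u : (ip u u == 0) = (u == 0).
Proof. exact: dnorm_eq0. Qed.

Lemma ip_inj u v : (forall w, ip u w = ip v w) -> u = v.
Proof.
by move=> uv; apply/eqP; rewrite -subr_eq0 -ip_eq0 ipBl uv subrr.
Qed.

Lemma adj_swap (X Y : D -> D) :
  (forall u v, ip (X u) v = ip u (Y v)) -> forall u v, ip (Y u) v = ip u (X v).
Proof. by move=> XY u v; rewrite ipC -XY -ipC. Qed.

(** Adjoints are unique because the form is definite. This is what makes evaluation respect the
    closure of the congruence under [estar]. *)
Lemma adj_eq (X X' Y Y' : D -> D) :
  (forall u v, ip (X u) v = ip u (Y v)) ->
  (forall u v, ip (X' u) v = ip u (Y' v)) -> X =1 X' -> Y =1 Y'.
Proof.
move=> XY XY' XX' u; apply: ip_inj => w.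
by rewrite (adj_swap XY) (adj_swap XY') XX'.
Qed.

End DotProduct.

Section Evaluation.
Variables (C : numClosedFieldType) (G : Type) (D : lmodType C).

Fixpoint ev (o : G -> {linear D -> D}) (e : expr C G) : {linear D -> D} :=
  match e with
  | Gen g => o g
  | Cst z => ( *:%R z : {linear D -> D})
  | Add a b => (ev o a \+ ev o b : {linear D -> D})
  | Mul a b => (ev o a \o ev o b : {linear D -> D})
  end.

End Evaluation.

Section PresentedRep.
Variables (C : numClosedFieldType) (P : presentation C) (D : lmodType C).
Variable ip : {dot D for Num.conj}.

Definition rep_gen (pi : starRep (presented P) ip) (g : gen P) :
  {linear D -> D} := pi (pgen g).

Lemma rep_cls (pi : starRep (presented P) ip) e :
  pi (cls e) =1 ev (rep_gen pi) e.
Proof.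
elim: e => [g|z|a iha b ihb|a iha b ihb] u //=.
- have -> : cls (Cst z) = z *: (saone : presented P).
    change (cls (P := P) (Cst z) = pscale z (cls (Cst 1))).
    by rewrite clsZ; apply/clsP/congr_sym/congr_1r.
  by rewrite repZ rep1.
- have -> : cls (Add a b) = (cls a : presented P) + cls b.
    change (cls (P := P) (Add a b) = padd (cls a) (cls b)).
    by rewrite clsD.
  by rewrite repD iha ihb.
- have -> : cls (Mul a b) = samul (cls a : presented P) (cls b).
    change (cls (P := P) (Mul a b) = pmul (cls a) (cls b)).
    by rewrite clsM.
  by rewrite repM ihb iha.
Qed.

Lemma rep_rels (pi : starRep (presented P) ip) a b :
  rels a b -> ev (rep_gen pi) a =1 ev (rep_gen pi) b.
Proof.
move=> ab u; rewrite -!rep_cls; congr (pi _ u).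
by apply/clsP; constructor.
Qed.

Lemma rep_gen_adj (pi : starRep (presented P) ip) g u v :
  ip (rep_gen pi g u) v = ip u (rep_gen pi (gstar g) v).
Proof.
rewrite repS; congr (ip u (pi _ v)).
change (pstar (cls (P := P) (Gen g)) = cls (Gen (gstar g))).
by rewrite clsS.
Qed.

Section Construction.
Variable o : gen P -> {linear D -> D}.
Hypothesis oadj : forall g u v, ip (o g u) v = ip u (o (gstar g) v).
Hypothesis orels : forall a b, rels a b -> ev o a =1 ev o b.

Lemma ev_adj e u v : ip (ev o e u) v = ip u (ev o (estar e) v).
Proof.
elim: e u v => [g|z|a iha b ihb|a iha b ihb] u v /=.
- exact: oadj.
- by rewrite ipZl ipZr conjCK.
- by rewrite ipDl ipDr iha ihb.
- by rewrite iha ihb.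
Qed.

Lemma ev_congr a b : congr a b -> ev o a =1 ev o b.
Proof.
elim=> /=.
- exact: orels.
- by [].
- by move=> {}a {}b _ ab u.
- by move=> {}a {}b e _ ab _ be u; rewrite ab be.
- by move=> {}a a' {}b b' _ ha _ hb u /=; rewrite ha hb.
- by move=> {}a a' {}b b' _ ha _ hb u /=; rewrite hb ha.
- move=> {}a {}b _ ab; exact: (adj_eq (ev_adj a) (ev_adj b)).
- by move=> *; move=> u /=; rewrite addrA.
- by move=> *; move=> u /=; rewrite addrC.
- by [].
- by [].
- by move=> *; move=> u /=; rewrite linearD.
- by move=> *; move=> u /=; rewrite scale0r add0r.
- by move=> *; move=> u /=; rewrite scaleN1r addNr scale0r.
- by move=> *; move=> u /=; rewrite scale1r.
- by move=> *; move=> u /=; rewrite scale1r.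
- by move=> *; move=> u /=; rewrite scalerDl.
- by move=> *; move=> u /=; rewrite scalerA.
- by move=> *; move=> u /=; rewrite linearZ.
Qed.

Let pi0 (x : presented P) : {linear D -> D} := ev o (rpr x).

Fact pi0_cls e u : pi0 (cls e) u = ev o e u.
Proof. exact/ev_congr/rpr_cls. Qed.

Fact pi0_1 u : pi0 saone u = u.
Proof. by rewrite pi0_cls /= scale1r. Qed.

Fact pi0_D a b u : pi0 (a + b) u = pi0 a u + pi0 b u.
Proof.
elim/presentedW: a => a; elim/presentedW: b => b.
change (pi0 (padd (cls a) (cls b)) u = pi0 (cls a) u + pi0 (cls b) u).
by rewrite clsD !pi0_cls.
Qed.

Fact pi0_Z z a u : pi0 (z *: a) u = z *: pi0 a u.
Proof.
elim/presentedW: a => a.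
change (pi0 (pscale z (cls a)) u = z *: pi0 (cls a) u).
by rewrite clsZ !pi0_cls.
Qed.

Fact pi0_M a b u : pi0 (samul a b) u = pi0 a (pi0 b u).
Proof.
elim/presentedW: a => a; elim/presentedW: b => b.
change (pi0 (pmul (cls a) (cls b)) u = pi0 (cls a) (pi0 (cls b) u)).
by rewrite clsM !pi0_cls.
Qed.

Fact pi0_S a u v : ip (pi0 a u) v = ip u (pi0 (star a) v).
Proof.
elim/presentedW: a => a.
change (ip (pi0 (cls a) u) v = ip u (pi0 (pstar (cls a)) v)).
by rewrite clsS !pi0_cls ev_adj.
Qed.

Definition rep_of_gens : starRep (presented P) ip :=
  StarRep pi0_1 pi0_D pi0_Z pi0_M pi0_S.

Lemma rep_of_gensE g u : rep_gen rep_of_gens g u = o g u.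
Proof. exact: pi0_cls. Qed.

End Construction.

Lemma unitarily_equivalent_gens (pi1 pi2 : starRep (presented P) ip)
    (U : {linear D -> D}) :
  bijective U -> (forall u v, ip (U u) (U v) = ip u v) ->
  (forall g u, U (rep_gen pi1 g u) = rep_gen pi2 g (U u)) ->
  unitarily_equivalent pi1 pi2.
Proof.
move=> bU iU hU; exists U; split=> //; elim/presentedW => e u.
rewrite !rep_cls; elim: e u => [g|z|a iha b ihb|a iha b ihb] u //=.
- by rewrite linearZ.
- by rewrite linearD iha ihb.
- by rewrite iha ihb.
Qed.

End PresentedRep.

(** * Orthonormal bases of spin vectors *)

Definition dimN (m n : nat) : nat := (m + n.*2)%N.

Lemma dimNS m n : dimN m n.+1 = (dimN m n).+2.
Proof. by rewrite /dimN doubleS !addnS. Qed.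

(* With [l0 = m / 2] and [l = l0 + n] one has [dimN m n = 2 l], and [bvec n k] is
   the vector [v^l_(k - l)], so that [k = 0] is the lowest weight. *)
Record spinBasis (C : numClosedFieldType) (m : nat) := SpinBasis {
  bspace : lmodType C;
  bform : {dot bspace for Num.conj};
  bvec : nat -> int -> bspace;
  bvec_out : forall n k, ~~ (0 <= k <= (dimN m n)%:Z) -> bvec n k = 0;
  bform_vec : forall n (k : int) n' (k' : int), 0 <= k' <= (dimN m n')%:Z ->
    bform (bvec n k) (bvec n' k') = ((n == n') && (k == k'))%:R;
  bvec_ind : forall P : bspace -> Prop, P 0 ->
    (forall z u v, P u -> P v -> P (z *: u + v)) ->
    (forall n (k : nat), (k <= dimN m n)%N -> P (bvec n k)) -> forall u, P u;
  bvec_lin : (nat -> int -> bspace) -> {linear bspace -> bspace};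
  bvec_linE : forall f n (k : nat), (k <= dimN m n)%N ->
    bvec_lin f (bvec n k) = f n k
}.

Section BasisTheory.
Variables (C : numClosedFieldType) (m : nat) (b : spinBasis C m).
Local Notation V := (bspace b).
Local Notation ip := (bform b).
Local Notation sv := (bvec b).

Lemma bvec_inj (u v : V) :
  (forall n (k : nat), (k <= dimN m n)%N -> ip u (sv n k) = ip v (sv n k)) ->
  u = v.
Proof.
move=> uv; apply: (ip_inj (ip := ip)) => w; elim/bvec_ind: w => [|z w w' hw hw'|//].
  by rewrite !ip0r.
by rewrite !ipDr !ipZr hw hw'.
Qed.

Lemma lin_ext (f g : {linear V -> V}) :
  (forall n (k : nat), (k <= dimN m n)%N -> f (sv n k) = g (sv n k)) -> f =1 g.
Proof.
move=> fg; apply: bvec_ind => [|z u v fu fv|//]; first by rewrite !linear0.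
by rewrite !linearP fu fv.
Qed.

Lemma adj_ext (f g : {linear V -> V}) :
  (forall n (k : nat) n' (k' : nat), (k <= dimN m n)%N -> (k' <= dimN m n')%N ->
     ip (f (sv n k)) (sv n' k') = ip (sv n k) (g (sv n' k'))) ->
  forall u v, ip (f u) v = ip u (g v).
Proof.
move=> fg u v; elim/bvec_ind: u => [|z u u' hu hu'|n k kN].
- by rewrite (linear0 f) !ip0l.
- by rewrite (linearP f) !ipDl !ipZl hu hu'.
elim/bvec_ind: v => [|z v v' hv hv'|n' k' kN'].
- by rewrite (linear0 g) !ip0r.
- by rewrite (linearP g) !ipDr !ipZr hv hv'.
exact: fg.
Qed.

Lemma iso_ext (f : {linear V -> V}) :
  (forall n (k : nat) n' (k' : nat), (k <= dimN m n)%N -> (k' <= dimN m n')%N ->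
     ip (f (sv n k)) (f (sv n' k')) = ip (sv n k) (sv n' k')) ->
  forall u v, ip (f u) (f v) = ip u v.
Proof.
move=> fg u v; elim/bvec_ind: u => [|z u u' hu hu'|n k kN].
- by rewrite (linear0 f) !ip0l.
- by rewrite (linearP f) !ipDl !ipZl hu hu'.
elim/bvec_ind: v => [|z v v' hv hv'|n' k' kN'].
- by rewrite (linear0 f) !ip0r.
- by rewrite (linearP f) !ipDr !ipZr hv hv'.
exact: fg.
Qed.

End BasisTheory.

Section ConcreteBasis.
Variables (R : realType) (m : nat).
Local Notation C := R[i].
Local Notation V := (spin_space R m).
Local Notation ip := (spin_ip R m).

Definition sv (n : nat) (k : int) : V := spin_vec R m n k.
Arguments sv : simpl never.

Definition sidx (n k : nat) (h : (k < (dimN m n).+1)%N) : spin_idx m :=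
  existT (fun n => 'I_(m + n.*2).+1) n (Ordinal h).

Lemma sv_idx n k (h : (k < (dimN m n).+1)%N) : sv n k = mkmalgU (sidx h) 1.
Proof. by rewrite /sv /= (insubT (fun k => (k < (m + n.*2).+1)%N) h). Qed.

Lemma sv_out n k : ~~ (0 <= k <= (dimN m n)%:Z) -> sv n k = 0.
Proof.
case: k => [k|k] // kN; rewrite /sv /= insubF //; apply/negbTE.
by move: kN; rewrite /= lez_nat ltnS.
Qed.

Lemma sidx_surj i : exists n k (h : (k < (dimN m n).+1)%N), i = sidx h.
Proof. by case: i => n [k h]; exists n, k, h. Qed.

Lemma ip_mkmalgU (u : V) i : ip u (mkmalgU i 1) = mcoeff i u.
Proof.
rewrite /spin_ip /= (@fsipE _ _ (i |` msupp u)%fset) ?fsubsetUr //.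
rewrite (big_fsetD1 i) ?fset1U1 //= mcoeffUU conjC1 mulr1 big1_seq ?addr0 //.
move=> j /andP[_]; rewrite !inE mcoeffU eq_sym => /andP[/negbTE-> _].
by rewrite mulr0n conjC0 mulr0.
Qed.

Lemma ip_sv n (k : int) n' (k' : int) : 0 <= k' <= (dimN m n')%:Z ->
  ip (sv n k) (sv n' k') = ((n == n') && (k == k'))%:R.
Proof.
case: k' => [k'|//] /=; rewrite lez_nat -ltnS => h'.
rewrite (sv_idx h') ip_mkmalgU.
have [/andP[]|kN] := boolP (0 <= k <= (dimN m n)%:Z); last first.
  rewrite sv_out // mcoeff0; case: eqVneq => //= nn'.
  by case: eqVneq => // kk'; rewrite kk' nn' /= lez_nat -ltnS h' in kN.
case: k => [k|//] _; rewrite lez_nat -ltnS => h.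
rewrite (sv_idx h) mcoeffU; congr (_%:R); congr nat_of_bool.
apply/eqP/andP => [e|[/eqP nn' /eqP[kk']]].
  have en : n = n' by case: e.
  split; first exact/eqP.
  have := congr1 (fun i : spin_idx m => val (projT2 i)) e.
  by move=> /= ->.
by subst n' k'; congr existT; apply/val_inj.
Qed.

Lemma sv_ind (P : V -> Prop) :
  P 0 -> (forall z u v, P u -> P v -> P (z *: u + v)) ->
  (forall n (k : nat), (k <= dimN m n)%N -> P (sv n k)) -> forall u, P u.
Proof.
move=> P0 PD Psv u; rewrite [u]monalgE.
apply: (big_ind P) => // [x y Px Py|i _]; first by rewrite -[x]scale1r; apply: PD.
have [n [k [h ->]]] := sidx_surj i.
have -> : mkmalgU (sidx h) (mcoeff (sidx h) u) =
          mcoeff (sidx h) u *: (sv n k : V).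
  by rewrite (sv_idx h); apply/malgP => j; rewrite mcoeffZ !mcoeffU mulrnAr mulr1.
by rewrite -[_ *: _]addr0; apply: PD => //; exact: Psv.
Qed.

Section LinearExtension.
Variable f : nat -> int -> V.

Definition spin_lin_fun (u : V) : V :=
  \sum_(i <- msupp u) mcoeff i u *: f (tag i) (tagged i : nat).

Fact spin_lin_is_linear : linear spin_lin_fun.
Proof.
have E (d : {fset spin_idx m}) (u : V) : (msupp u `<=` d)%fset ->
    spin_lin_fun u = \sum_(i <- d) mcoeff i u *: f (tag i) (tagged i : nat).
  move=> ud; rewrite /spin_lin_fun; apply: big_fset_incl => // i _.
  by rewrite -mcoeff_eq0 => /eqP->; rewrite scale0r.
move=> z u v; pose d := (msupp u `|` msupp v `|` msupp (z *: u + v))%fset.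
rewrite !(@E d); try by apply/fsubsetP => i; rewrite !inE => ->; rewrite ?orbT.
rewrite scaler_sumr -big_split /=; apply: eq_bigr => i _.
by rewrite mcoeffD mcoeffZ scalerDl scalerA.
Qed.

HB.instance Definition _ :=
  GRing.isLinear.Build C V V *:%R spin_lin_fun spin_lin_is_linear.

Definition spin_lin : {linear V -> V} := spin_lin_fun.

Lemma spin_linE n (k : nat) : (k <= dimN m n)%N -> spin_lin (sv n k) = f n k.
Proof.
rewrite -ltnS => h; rewrite (sv_idx h) /spin_lin /= /spin_lin_fun.
by rewrite msuppU oner_eq0 big_seq_fset1 mcoeffUU scale1r.
Qed.

End LinearExtension.

Definition spin_basis : spinBasis C m :=
  SpinBasis sv_out ip_sv sv_ind spin_linE.

End ConcreteBasis.

(** * The relations of the cross product *)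

Section Scalars.
Variables (C : numClosedFieldType) (s : C).
Hypotheses (s_gt0 : 0 < s) (s_lt1 : s < 1).

Lemma sq_neq0 : s != 0.
Proof. by rewrite gt_eqF. Qed.

Lemma sq_ge0 : 0 <= s.
Proof. exact: ltW. Qed.

Lemma conj_sq : s^* = s.
Proof. exact/geC0_conj/sq_ge0. Qed.

Lemma sqD a b : s ^ (a + b) = s ^ a * s ^ b.
Proof. by rewrite expfzDr ?sq_neq0. Qed.

Lemma sqN a : s ^ (- a) = (s ^ a)^-1.
Proof. by rewrite invr_expz. Qed.

Lemma sq_exp_gt0 (z : int) : 0 < s ^ z.
Proof. by rewrite exprz_gt0. Qed.

Lemma sq_exp_neq0 (z : int) : s ^ z != 0.
Proof. by rewrite gt_eqF ?sq_exp_gt0. Qed.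

Lemma conj_sq_exp (z : int) : (s ^ z)^* = s ^ z.
Proof. exact/geC0_conj/ltW/sq_exp_gt0. Qed.

Lemma sq_expn_lt1 (n : nat) : (0 < n)%N -> s ^+ n < 1.
Proof. by move=> n0; rewrite exprn_ilt1 ?sq_ge0 -?lt0n. Qed.

(** As 0 < s < 1, distinct weights give distinct eigenvalues of K. *)
Lemma sq_exp_inj : injective (fun z : int => s ^ z).
Proof.
have aux (n : nat) (z : int) : s ^ (z + n) = s ^ z -> n = 0%N.
  rewrite sqD -[RHS]mulr1 => /(mulfI (sq_exp_neq0 z)) e.
  by apply/eqP; rewrite -leqn0 leqNgt; apply/negP => /sq_expn_lt1; rewrite -e ltxx.
move=> a b /= ab; have [ab'|/ltW ab'] := lerP a b.
  have E : b = a + `|b - a|%N by lia.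
  by have := aux `|b - a|%N a; rewrite -E ab => /(_ erefl); lia.
have E : a = b + `|a - b|%N by lia.
by have := aux `|a - b|%N b; rewrite -E ab => /(_ erefl); lia.
Qed.

(* [s] stands for the square root of [q], so that [br z] is the q-number [z]. *)
Definition br (z : int) : C :=
  (s ^ z * s ^ z - s ^ (- z) * s ^ (- z)) / (s ^+ 2 - s ^- 2).

Lemma lam_lt0 : s ^+ 2 - s ^- 2 < 0.
Proof.
rewrite subr_lt0 (@lt_trans _ _ 1) ?sq_expn_lt1 // -exprVn exprn_egt1 //.
by rewrite invf_gt1 .
Qed.

Lemma lam_neq0 : s ^+ 2 - s ^- 2 != 0.
Proof. by rewrite lt_eqF ?lam_lt0. Qed.

Lemma br0 : br 0 = 0.
Proof. by rewrite /br oppr0 subrr mul0r. Qed.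

Lemma br1 : br 1 = 1.
Proof. by rewrite /br exprN1 !expr1z -!expr2 exprVn divff ?lam_neq0. Qed.

Lemma brN z : br (- z) = - br z.
Proof. by rewrite /br opprK -[RHS]mulNr opprB. Qed.

Lemma br_gt0 (n : nat) : (0 < n)%N -> 0 < br n.
Proof.
move=> n0; rewrite -[br n]opprK -brN /br opprK oppr_gt0.
rewrite pmulr_rlt0 ?invr_lt0 ?lam_lt0 // subr_gt0 sqN -!invfM.
have lt1 : s ^ n * s ^ n < 1 by rewrite -exprD sq_expn_lt1 // addn_gt0 n0.
by rewrite (lt_trans lt1) // invf_gt1 // mulr_gt0 ?sq_exp_gt0.
Qed.

Lemma br_ge0 (n : nat) : 0 <= br n.
Proof. by case: n => [|n]; rewrite ?br0 // ltW ?br_gt0. Qed.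

Lemma br_neq0 (n : nat) : (0 < n)%N -> br n != 0.
Proof. by move=> /br_gt0 n0; rewrite gt_eqF. Qed.

Lemma conj_br z : (br z)^* = br z.
Proof.
have cs n : (s ^+ n)^* = s ^+ n by rewrite rmorphXn /= conj_sq.
by rewrite /br rmorphM fmorphV !rmorphB !rmorphM fmorphV /= !conj_sq_exp cs !conj_sq.
Qed.

Definition rt (n : nat) : C := sqrtC (br n).

Lemma rt_sqr n : rt n * rt n = br n.
Proof. by rewrite -expr2 sqrtCK. Qed.

Lemma rt_ge0 n : 0 <= rt n.
Proof. by rewrite sqrtC_ge0 br_ge0. Qed.

Lemma rt_neq0 n : (0 < n)%N -> rt n != 0.
Proof. by move=> n0; rewrite sqrtC_eq0 br_neq0. Qed.

Lemma rt0 : rt 0 = 0.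
Proof. by rewrite /rt br0 sqrtC0. Qed.

Lemma rt1 : rt 1 = 1.
Proof. by rewrite /rt br1 sqrtC1. Qed.

Lemma conj_rt n : (rt n)^* = rt n.
Proof. exact/geC0_conj/rt_ge0. Qed.

End Scalars.

Arguments br {C} s z : simpl never.
Arguments rt {C} s n : simpl never.

Section CrossRelations.
Variables (C : numClosedFieldType) (s th ct : C) (D : lmodType C).

(** With [s] = q^(1/2) every exponent is an integer. The parameters [th] and [ct] cover finite and
    infinite c by a single pair of sphere relations. *)
Record cross_relations (A B Bs E F K Ki : {linear D -> D}) : Prop := {
  cKKi : forall u, K (Ki u) = u;
  cKiK : forall u, Ki (K u) = u;
  cKE : forall u, K (E u) = s ^+ 2 *: E (K u);
  cFK : forall u, F (K u) = s ^+ 2 *: K (F u);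
  cEF : forall u, E (F u) - F (E u) =
    (s ^+ 2 - s ^- 2)^-1 *: (K (K u) - Ki (Ki u));
  cKA : forall u, K (A u) = A (K u);
  cEA : forall u, E (A u) = A (E u) + s^-1 *: Bs (K u);
  cFA : forall u, F (A u) = A (F u) - s ^- 3 *: B (K u);
  cKB : forall u, K (B u) = s ^- 2 *: B (K u);
  cEB : forall u, E (B u) =
    s ^+ 2 *: B (E u) - (s * (1 + s ^+ 4)) *: A (K u) + (th * s) *: K u;
  cFB : forall u, F (B u) = s ^+ 2 *: B (F u);
  cKBs : forall u, K (Bs u) = s ^+ 2 *: Bs (K u);
  cEBs : forall u, E (Bs u) = s ^- 2 *: Bs (E u);
  cFBs : forall u, F (Bs u) =
    s ^- 2 *: Bs (F u) + (s^-1 * (1 + s ^+ 4)) *: A (K u) - (th * s^-1) *: K u;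
  cAB : forall u, A (B u) = s ^- 4 *: B (A u);
  cABs : forall u, A (Bs u) = s ^+ 4 *: Bs (A u);
  cBsB : forall u, Bs (B u) = th *: A u - A (A u) + ct *: u;
  cBBs : forall u, B (Bs u) =
    (th * s ^+ 4) *: A u - s ^+ 8 *: A (A u) + ct *: u
}.

Definition cross_op (A B Bs E F K Ki : {linear D -> D}) (g : cross_gen) :
    {linear D -> D} :=
  match g with
  | inl gA => A | inl gB => B | inl gBs => Bs
  | inr gE => E | inr gF => F | inr gK => K | inr gKi => Ki
  end.

End CrossRelations.

(** * Half-integer powers of q as integer powers of its square root *)

Section RealScalars.
Variables (R : realType) (q : R).
Hypotheses (q_gt0 : 0 < q) (q_lt1 : q < 1).
Local Notation C := R[i].
Local Notation toC := (real_complex R).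

Definition sq : C := toC (Num.sqrt q).
Local Notation s := sq.

Lemma sq_gt0 : 0 < s.
Proof. by rewrite ltcR sqrtr_gt0. Qed.

Lemma sq_sqr : s ^+ 2 = toC q.
Proof. by rewrite -rmorphXn /= sqr_sqrtr // ltW. Qed.

Lemma sq_lt1 : s < 1.
Proof.
by rewrite -(@ltr_pXn2r _ 2) ?nnegrE ?(ltW sq_gt0) ?ler01 // sq_sqr expr1n ltcR.
Qed.

Lemma powR_half (z : int) : toC (q `^ (z%:~R / 2)) = s ^ z.
Proof.
rewrite mulrC powRrM powR12_sqrt ?(ltW q_gt0) // powR_intmul ?sqrtr_ge0 //.
by rewrite fmorphXz.
Qed.

Lemma qnum_br (z : int) : toC (qnum q z%:~R) = br s z.
Proof.
rewrite /qnum /br -!expr2 !rmorphM fmorphV !rmorphB /= -!sq_sqr fmorphV /=.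
rewrite sq_sqr; congr (_ / _); congr (_ - _).
  by rewrite -powR_half -rmorphXn /= -powR_mulrn ?powR_ge0 // -powRrM divfK ?pnatr_eq0.
rewrite -powR_half -rmorphXn /= -powR_mulrn ?powR_ge0 // -powRrM divfK ?pnatr_eq0 //.
by rewrite mulrNz.
Qed.

Lemma rtE n : rt s n = toC (Num.sqrt (qnum q n%:R)).
Proof.
have q0 : 0 <= qnum q n%:R.
  by rewrite -lecR -[n%:R]/((n%:Z)%:~R) qnum_br br_ge0 ?sq_gt0 ?sq_lt1.
apply/eqP; rewrite -(@eqrXn2 _ 2) ?rt_ge0 ?sq_gt0 ?sq_lt1 ?lecR ?sqrtr_ge0 //.
by rewrite expr2 rt_sqr -rmorphXn /= sqr_sqrtr // -qnum_br.
Qed.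

End RealScalars.

Arguments sq {R} q.

Section SatisfiedRelations.
Variables (R : realType) (q : R) (c : \bar R).
Hypotheses (q_gt0 : 0 < q) (c_ge0 : (0 <= c)%E).
Local Notation C := R[i].
Local Notation s := (sq q).
Local Notation toC := (real_complex R).
Variable D : lmodType C.

(** For infinite c the value 1, together with theta = 0, turns theta A - A^2 + ct into 1 - A^2. *)
Definition sphere_const : C := if c is r%:E then toC r else 1.
Local Notation ct := sphere_const.
Local Notation th := (theta c).
Local Notation cross_relations := (cross_relations s th ct).

Lemma qpowE (x : R) (z : int) : x * 2 = z%:~R -> qpow q x = s ^ z.
Proof.
by move=> xz; rewrite /qpow -powR_half // -xz mulfK // pnatr_eq0.
Qed.

Lemma qpowsE :
  (qpow q (-2) = s ^- 4) * (qpow q 2 = s ^+ 4) * (qpow q 4 = s ^+ 8) *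
  (qpow q (- (1 / 2)) = s^-1) * (qpow q (- (3 / 2)) = s ^- 3) *
  (qpow q (-1) = s ^- 2) * (qpow q (1 / 2) = s).
Proof.
have n2 : (2 : R) != 0 by rewrite pnatr_eq0.
have E n : s ^- n = s ^ (- n%:Z) by rewrite sqN.
have E1 : s^-1 = s ^ (-1) by rewrite exprN1.
do !split; rewrite ?E ?E1.
- by apply: qpowE; rewrite mulNr -natrM mulrNz.
- by apply: (@qpowE _ 4); rewrite -natrM.
- by apply: (@qpowE _ 8); rewrite -natrM.
- by apply: (@qpowE _ (-1)); rewrite mulNr divfK // mulrNz.
- by apply: (@qpowE _ (-3)); rewrite mulNr divfK // mulrNz.
- by apply: (@qpowE _ (-2)); rewrite mulN1r mulrNz.
- by rewrite -[RHS]expr1z; apply: qpowE; rewrite divfK.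
Qed.

Lemma lamE : toC (q - q^-1)^-1%R = (s ^+ 2 - s ^- 2)^-1.
Proof. by rewrite fmorphV rmorphB fmorphV /= sq_sqr. Qed.

Lemma cross_relationsP (A B Bs E F K Ki : {linear D -> D}) :
  (forall a b, cross_rel q c a b ->
     ev (cross_op A B Bs E F K Ki) a =1 ev (cross_op A B Bs E F K Ki) b) <->
  cross_relations A B Bs E F K Ki.
Proof.
have Q := qpowsE.
split=> [H|H a b].
  have Hu a b (ab : uq_rel q a b) u := H _ _ (@cross_uq _ q c _ _ ab) u.
  have Hs a b (ab : sphere_rel q c a b) u := H _ _ (@cross_sphere _ q c _ _ ab) u.
  split=> u.
  - by have := Hu _ _ (rel_KKi q) u; rewrite /= scale1r.
  - by have := Hu _ _ (rel_KiK q) u; rewrite /= scale1r.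
  - by have := Hu _ _ (rel_KE q) u; rewrite /= sq_sqr.
  - by have := Hu _ _ (rel_FK q) u; rewrite /= sq_sqr.
  - by have := Hu _ _ (rel_EF q) u; rewrite /= lamE !scaleN1r.
  - by have := H _ _ (cross_KA q c) u.
  - by have := H _ _ (cross_EA q c) u; rewrite /= !Q.
  - by have := H _ _ (cross_FA q c) u; rewrite /= !Q scaleN1r.
  - by have := H _ _ (cross_KB q c) u; rewrite /= !Q.
  - by have := H _ _ (cross_EB q c) u; rewrite /= !Q scaleN1r sq_sqr.
  - by have := H _ _ (cross_FB q c) u; rewrite /= sq_sqr.
  - by have := H _ _ (cross_KBs q c) u; rewrite /= sq_sqr.
  - by have := H _ _ (cross_EBs q c) u; rewrite /= !Q.
  - by have := H _ _ (cross_FBs q c) u; rewrite /= !Q scaleN1r.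
  - by have := Hs _ _ (rel_AB q c) u; rewrite /= !Q.
  - by have := Hs _ _ (rel_ABs q c) u; rewrite /= !Q.
  - rewrite /ct /theta; case: (c) c_ge0 Hs => [r||//] _ Hs.
      have := Hs _ _ (rel_BsB q (erefl _)) u.
      by rewrite /= scaleN1r scale1r.
    have := Hs _ _ (rel_BsB_oo q (erefl _)) u.
    rewrite eqxx; by rewrite /= scaleN1r !scale1r scale0r add0r addrC.
  - rewrite /ct /theta; case: (c) c_ge0 Hs => [r||//] _ Hs.
      have := Hs _ _ (rel_BBs q (erefl _)) u.
      by rewrite /= !Q scaleN1r mul1r.
    have := Hs _ _ (rel_BBs_oo q (erefl _)) u.
    by rewrite eqxx /= !Q scaleN1r mul0r !scale1r scale0r add0r addrC.
case=> [{}a {}b []|{}a {}b []|||||||||] /=; rewrite ?Q -?(sq_sqr q_gt0) //.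
- by move=> u /=; rewrite (cKKi H) scale1r.
- by move=> u /=; rewrite (cKiK H) scale1r.
- by move=> u /=; rewrite (cKE H).
- by move=> u /=; rewrite (cFK H).
- by move=> u /=; rewrite lamE !scaleN1r (cEF H).
- by move=> u /=; rewrite (cAB H).
- by move=> u /=; rewrite (cABs H).
- by move=> r e u /=; rewrite (cBsB H) /ct /theta e scaleN1r scale1r.
- by move=> r e u /=; rewrite (cBBs H) /ct /theta e scaleN1r mul1r.
- move=> e u /=; rewrite (cBsB H) /ct /theta e eqxx scaleN1r !scale1r.
  by rewrite scale0r add0r addrC.
- move=> e u /=; rewrite (cBBs H) /ct /theta e eqxx scaleN1r !scale1r.
  by rewrite mul0r scale0r add0r addrC.
- by move=> u /=; rewrite (cKA H).
- by move=> u /=; rewrite (cEA H).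
- by move=> u /=; rewrite scaleN1r (cFA H).
- by move=> u /=; rewrite (cKB H).
- by move=> u /=; rewrite scaleN1r (cEB H).
- by move=> u /=; rewrite (cFB H).
- by move=> u /=; rewrite (cKBs H).
- by move=> u /=; rewrite (cEBs H).
- by move=> u /=; rewrite scaleN1r (cFBs H).
Qed.

End SatisfiedRelations.

(** * Representations with property (star) as systems of seven operators *)

Section SpinModel.
Variables (C : numClosedFieldType) (s th ct : C).
Variables (m : nat) (b : spinBasis C m).
Local Notation V := (bspace b).
Local Notation ip := (bform b).
Local Notation sv := (bvec b).
Local Notation N := (dimN m).

Record spin_model (A B Bs E F K Ki : {linear V -> V}) : Prop := {
  mrel : cross_relations s th ct A B Bs E F K Ki;
  madjA : forall u v, ip (A u) v = ip u (A v);
  madjB : forall u v, ip (B u) v = ip u (Bs v);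
  madjE : forall u v, ip (E u) v = ip u (F v);
  madjK : forall u v, ip (K u) v = ip u (K v);
  madjKi : forall u v, ip (Ki u) v = ip u (Ki v);
  mK : forall n (k : nat), (k <= N n)%N ->
    K (sv n k) = s ^ (k%:Z * 2 - (N n)%:Z) *: sv n k;
  mE : forall n (k : nat), (k <= N n)%N ->
    E (sv n k) = (rt s (N n - k) * rt s k.+1) *: sv n k.+1;
  mF0 : forall n, F (sv n 0%N) = 0;
  mFS : forall n (k : nat), (k < N n)%N ->
    F (sv n k.+1) = (rt s (N n - k) * rt s k.+1) *: sv n k
}.

End SpinModel.

Section ModelsOfReps.
Variables (R : realType) (q : R) (c : \bar R) (m : nat).
Hypotheses (q_gt0 : 0 < q) (q_lt1 : q < 1) (c_ge0 : (0 <= c)%E).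
Local Notation C := R[i].
Local Notation s := (sq q).
Local Notation V := (bspace (spin_basis R m)).
Local Notation ip := (spin_ip R m).
Local Notation N := (dimN m).
Local Notation toC := (real_complex R).
Local Notation spin_model :=
  (@spin_model C s (theta c) (sphere_const c) m (spin_basis R m)).

(** Since l + j = k, l - j = [N n - k] and 2 j = 2 k - [N n], all real exponents and q-numbers take
    integer arguments. *)
Lemma spin_sumP (rho : starRep (Uq q) ip) : is_spin_sum rho <->
  forall n (k : nat), (k <= N n)%N ->
  [/\ rep_gen (P := uq_pres q) rho gK (sv R m n k) =
        s ^ (k%:Z * 2 - (N n)%:Z) *: sv R m n k,
      rep_gen (P := uq_pres q) rho gE (sv R m n k) =
        (rt s (N n - k) * rt s k.+1) *: sv R m n (k%:Z + 1) &
      rep_gen (P := uq_pres q) rho gF (sv R m n k) =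
        (rt s (N n - k).+1 * rt s k) *: sv R m n (k%:Z - 1)].
Proof.
have n2 : (2 : R) != 0 by rewrite pnatr_eq0.
have E1 n k : (k <= N n)%N -> spin R m n - (k%:R - spin R m n) = (N n - k)%:R.
  by move=> kN; rewrite natrB // /dimN natrD -muln2 natrM /spin; field.
have E2 n k : spin R m n + (k%:R - spin R m n) = k%:R by rewrite addrC subrK.
have E3 n k : k%:R - spin R m n = (k%:Z * 2 - (N n)%:Z)%:~R / 2.
  rewrite rmorphB rmorphM /= /spin /dimN. rewrite -!pmulrn -addnn !natrD.
  by field.
split=> H n k.
  move=> kN; have kN' : (k < (N n).+1)%N by [].
  have [] := H n (Ordinal kN').
  rewrite [nat_of_ord _]/= (E1 _ _ kN) E2 E3 (powR_half q_gt0) !natr1.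
  move=> h1 h2 h3; split; first exact: h1.
    rewrite !(rtE q_gt0 q_lt1) -[X in _ = X *: _]rmorphM; exact: h2.
  rewrite !(rtE q_gt0 q_lt1) -[X in _ = X *: _]rmorphM; exact: h3.
have kN : (k <= N n)%N by rewrite -ltnS.
have [h1 h2 h3] := H n k kN.
rewrite /= (E1 _ _ kN) E2 E3 (powR_half q_gt0) !natr1.
rewrite !(rtE q_gt0 q_lt1) -[X in _ = X *: _]rmorphM in h2.
rewrite !(rtE q_gt0 q_lt1) -[X in _ = X *: _]rmorphM in h3.
by split; [exact: h1|exact: h2|exact: h3].
Qed.

Lemma restr_gen (pi : starRep (crossAlg q c) ip) g u :
  rep_gen (P := uq_pres q) (restriction (uq_incl q c) pi) g u =
  rep_gen (P := cross_pres q c) pi (inr g) u.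
Proof.
rewrite /rep_gen; change (pi (uq_incl q c (pgen (P := uq_pres q) g)) u =
  pi (pgen (P := cross_pres q c) (inr g)) u).
rewrite /pgen [uq_incl _ _ _]phom_cls //; exact: cross_uq.
Qed.

Section OfRep.
Variable pi : starRep (crossAlg q c) ip.
Local Notation o := (rep_gen (P := cross_pres q c) pi).

Lemma model_of_rep : has_property_star pi ->
  spin_model (o (inl gA)) (o (inl gB)) (o (inl gBs))
             (o (inr gE)) (o (inr gF)) (o (inr gK)) (o (inr gKi)).
Proof.
move=> /spin_sumP H; split.
- apply/cross_relationsP => // a b ab u.
  have -> x v : ev (cross_op (o (inl gA)) (o (inl gB)) (o (inl gBs))
     (o (inr gE)) (o (inr gF)) (o (inr gK)) (o (inr gKi))) x v = ev o x v.
    by elim: x v => [[[]|[]]|z|x ihx y ihy|x ihx y ihy] v //=;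
      rewrite ?ihx ?ihy.
  rewrite [RHS](_ : _ = ev o b u); first exact: (rep_rels (P := cross_pres q c) pi).
  by elim: b u {ab} => [[[]|[]]|z|x ihx y ihy|x ihx y ihy] v //=;
      rewrite ?ihx ?ihy.
- exact: (rep_gen_adj (P := cross_pres q c)).
- exact: (rep_gen_adj (P := cross_pres q c)).
- exact: (rep_gen_adj (P := cross_pres q c)).
- exact: (rep_gen_adj (P := cross_pres q c)).
- exact: (rep_gen_adj (P := cross_pres q c)).
- by move=> n k /H[+ _ _]; rewrite restr_gen.
- move=> n k kN; have [_ + _] := H n k kN; rewrite restr_gen => ->.
  have -> : k%:Z + 1 = k.+1 by rewrite -PoszD addn1.
  by [].
- move=> n; have [_ _] := H n 0%N isT; rewrite restr_gen => ->.
  by rewrite rt0 mulr0 scale0r.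
- move=> n k kN; have [_ _] := H n k.+1 kN; rewrite restr_gen => ->.
  have -> : k.+1%:Z - 1 = k by rewrite -addn1 PoszD addrK.
  by rewrite (subnSK kN).
Qed.

End OfRep.

Lemma rep_of_model (A B Bs E F K Ki : {linear V -> V}) :
  spin_model A B Bs E F K Ki ->
  exists2 pi : starRep (crossAlg q c) ip, has_property_star pi &
    forall g u, rep_gen (P := cross_pres q c) pi g u =
                cross_op A B Bs E F K Ki g u.
Proof.
move=> M; have rM := (@cross_relationsP _ _ _ q_gt0 c_ge0 _ A B Bs E F K Ki).2 (mrel M).
have aM (g : gen (cross_pres q c)) u v : ip (cross_op A B Bs E F K Ki g u) v =
    ip u (cross_op A B Bs E F K Ki (gstar g) v).
  case: g => [[]|[]] /=; rewrite ?(madjA M) ?(madjB M) ?(madjE M) //.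
  - exact/adj_swap/(madjB M).
  - exact/adj_swap/(madjE M).
  - exact: (madjK M).
  - exact: (madjKi M).
exists (rep_of_gens aM rM); last exact: rep_of_gensE.
apply/spin_sumP => n k kN; rewrite !restr_gen !rep_of_gensE.
split; first exact: (mK M).
  have -> : k%:Z + 1 = k.+1 by rewrite -PoszD addn1.
  exact: (mE M).
case: k kN => [|k] kN; first by rewrite rt0 mulr0 scale0r; exact: (mF0 M).
have -> : k.+1%:Z - 1 = k by rewrite -addn1 PoszD addrK.
by rewrite (subnSK kN); exact: (mFS M).
Qed.

End ModelsOfReps.

(** * Lowest weight vectors *)

Section LowestWeights.
Variables (C : numClosedFieldType) (s th ct : C).
Hypotheses (s_gt0 : 0 < s) (s_lt1 : s < 1) (conj_theta : th^* = th).
Variables (m : nat) (b : spinBasis C m).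
Local Notation V := (bspace b).
Local Notation ip := (bform b).
Local Notation sv := (bvec b).
Local Notation N := (dimN m).

Variables A B Bs E F K Ki : {linear V -> V}.
Hypothesis M : spin_model s th ct A B Bs E F K Ki.
Let rM := mrel M.

(** K is self-adjoint with real eigenvalues, so only basis vectors of the same weight occur in u. A
    component along [sv n k.+1] is excluded because this vector is a nonzero multiple of E [sv n k],
    and E is adjoint to F. *)
Lemma lowest_weight u (z : int) : K u = s ^ z *: u -> F u = 0 ->
  forall n (k : nat), (k <= N n)%N -> ip u (sv n k) != 0 ->
  k = 0%N /\ z = - (N n)%:Z.
Proof.
move=> Ku Fu n k kN u0.
have zE : z = k%:Z * 2 - (N n)%:Z.
  apply: (sq_exp_inj s_gt0 s_lt1); apply: (mulIf u0).
  by rewrite -ipZl -Ku (madjK M) (mK M) // ipZr conj_sq_exp.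
case: k kN u0 zE => [|k] kN u0 zE; first by rewrite zE mul0r sub0r.
have := ip0l ip (sv n k); rewrite -Fu (adj_swap (madjE M)) (mE M) ?(ltnW kN) //.
move/eqP; rewrite ipZr mulf_eq0 (negbTE u0) orbF.
rewrite conjC_eq0 mulf_eq0 !(negbTE (rt_neq0 s_gt0 s_lt1 _)) //.
by rewrite subn_gt0.
Qed.

Lemma lowest_weight_sv u n : K u = s ^ (- (N n)%:Z) *: u -> F u = 0 ->
  u = ip u (sv n 0%N) *: sv n 0%N.
Proof.
move=> Ku Fu; apply: bvec_inj => n' k kN; rewrite ipZl.
have [u0|u0] := eqVneq (ip u (sv n' k)) 0.
  rewrite u0 bform_vec //; have [/andP[/eqP nn /eqP kk]|_] := boolP (_ && _).
    by rewrite nn kk u0 mul0r.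
  by rewrite mulr0.
have [k0 nn] := lowest_weight Ku Fu kN u0.
have <- : n = n' by move: nn; rewrite /dimN; lia.
by rewrite k0 bform_vec // !eqxx mulr1.
Qed.

Lemma lowest_weight_0 u (z : int) : K u = s ^ z *: u -> F u = 0 ->
  (forall n, z <> - (N n)%:Z) -> u = 0.
Proof.
move=> Ku Fu zN; apply: bvec_inj => n k kN; rewrite ip0l; apply/eqP.
by apply/negPn/negP => u0; have [_ /zN] := lowest_weight Ku Fu kN u0.
Qed.

Lemma F_1 n : (0 < N n)%N -> F (sv n 1%N) = rt s (N n) *: sv n 0%N.
Proof.
by move=> n0; rewrite (mFS M) // subn0 rt1 // mulr1.
Qed.

Lemma K_low n : K (sv n 0%N) = s ^ (- (N n)%:Z) *: sv n 0%N.
Proof. by rewrite (mK M) // mul0r sub0r. Qed.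

(* The matrix coefficients of A, B and B* on the lowest weight vectors:
   the values of [kap], [xi1] and [xi2] are found by applying F. *)
Definition bet n : C := ip (B (sv n 0%N)) (sv n.+1 0%N).
Definition alp n : C := ip (A (sv n 0%N)) (sv n 0%N).
Definition kap n : C := - (s ^+ 3 * s ^ (N n)%:Z * rt s (N n).+2)^-1.
Definition xi1 n : C :=
  ((1 + s ^+ 4) * alp n - th) / (s * s ^ (N n)%:Z * rt s (N n)).
Definition xi2 n : C := (1 + s ^+ 4) * kap n * bet n /
  (s * s ^ (N n)%:Z * (rt s (N n).+1 * rt s 2)).

Lemma conj_alp n : (alp n)^* = alp n.
Proof. by rewrite /alp -ipC (madjA M). Qed.

Lemma conj_kap n : (kap n)^* = kap n.
Proof.
by rewrite /kap rmorphN fmorphV !rmorphM /= conj_sq_exp // conj_rt ?(conj_sq s_gt0).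
Qed.

Lemma conj_xi1 n : (xi1 n)^* = xi1 n.
Proof.
rewrite /xi1 rmorphM fmorphV rmorphB !rmorphM rmorphD rmorph1 rmorphXn /=.
rewrite conj_alp conj_theta. rewrite (conj_sq_exp s_gt0). rewrite conj_rt //. by rewrite ?(conj_sq s_gt0).
Qed.

Lemma B_low n : B (sv n 0%N) = bet n *: sv n.+1 0%N.
Proof.
apply: lowest_weight_sv.
  rewrite (cKB rM) K_low linearZ scalerA; congr (_ *: _).
  have -> : - (N n.+1)%:Z = - 2%:Z + - (N n)%:Z by rewrite dimNS; lia.
  by rewrite (sqD s_gt0) (sqN s 2%:Z).
by rewrite (cFB rM) (mF0 M) !linear0.
Qed.

Let sN_neq0 n : s ^ (N n)%:Z != 0.
Proof. exact: sq_exp_neq0. Qed.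

Let s_neq0 : s != 0.
Proof. exact: sq_neq0. Qed.

Lemma A_low n : A (sv n 0%N) = alp n *: sv n 0%N + (kap n * bet n) *: sv n.+1 1%N.
Proof.
apply/eqP; rewrite -subr_eq; apply/eqP; set y := LHS.
have N1 : (1 <= N n.+1)%N by rewrite dimNS.
have -> : alp n = ip y (sv n 0%N).
  by rewrite ipBl ipZl bform_vec // eqn_leq ltnn andbF /= mulr0 subr0.
apply: lowest_weight_sv.
  rewrite linearB (cKA rM) K_low linearZ scalerBr; congr (_ - _).
  rewrite linearZ /= (mK M) // !scalerA; congr (_ *: _); rewrite mulrC.
  by congr (_ ^ _ * _); rewrite dimNS; lia.
rewrite linearB (cFA rM) (mF0 M) linear0 K_low !linearZ /= B_low F_1 //.
rewrite dimNS sqN.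
have r0 : rt s (N n).+2 != 0 by rewrite rt_neq0.
apply: (ip_inj (ip := ip)) => w; rewrite !(ipDl, ipNl, ipZl, ip0l) /kap. field.
by rewrite s_neq0 r0 sN_neq0.
Qed.

(** At spin 0 the vector e_n is killed by E, so F B* e_n is orthogonal to e_n. The relation for F B*
    turns this into a linear equation for [alp n]. *)
Lemma alp_N0 n : N n = 0%N -> (1 + s ^+ 4) * alp n = th.
Proof.
move=> N0.
have : ip (F (Bs (sv n 0%N))) (sv n 0%N) = 0.
  rewrite (adj_swap (madjE M)) (mE M) // N0 subn0 rt0 // mul0r.
  by rewrite scale0r ip0r.
have K0 : K (sv n 0%N) = sv n 0%N by rewrite K_low N0 oppr0 expr0z scale1r.
rewrite (cFBs rM) (mF0 M) !linear0 add0r K0 ipBl !ipZl -/(alp n).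
rewrite bform_vec // !eqxx mulr1 => e; apply/eqP; rewrite -subr_eq0.
apply/eqP; apply: (mulfI (invr_neq0 s_neq0)); rewrite mulr0 -[RHS]e.
by ring.
Qed.

Lemma Bs_low n : Bs (sv n 0%N) = xi2 n *: sv n.+1 2%N + xi1 n *: sv n 1%N +
  (if n is n'.+1 then (bet n')^* *: sv n' 0%N else 0).
Proof.
rewrite [RHS]addrC; apply/eqP; rewrite -subr_eq; apply/eqP; set y := LHS.
have N2 : (2 <= N n.+1)%N by rewrite dimNS.
have K1 : K (sv n 1%N) = s ^ (2 - (N n)%:Z) *: sv n 1%N.
  have [n0|n0] := posnP (N n); last by rewrite (mK M).
  by rewrite bvec_out ?n0 // !linear0.
have Ky : K y = s ^ (2 - (N n)%:Z) *: y.
  rewrite /y linearB linearD !linearZ /= (cKBs rM) K_low K1 (mK M) //.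
  rewrite scalerBr scalerDr linearZ /= !scalerA; congr (_ *: _ - (_ *: _ + _ *: _)).
  - by rewrite (sqD s_gt0 2).
  - by rewrite mulrC; congr (_ ^ _ * _); rewrite dimNS; lia.
  - by rewrite mulrC.
have rt20 : rt s 2 != 0 by rewrite rt_neq0.
have r10 : rt s (N n).+1 != 0 by rewrite rt_neq0.
have Fy : F y = 0.
  have FBs : F (Bs (sv n 0%N)) = ((s * s ^ (N n)%:Z)^-1 *
      ((1 + s ^+ 4) * alp n - th)) *: sv n 0%N +
      ((s * s ^ (N n)%:Z)^-1 * ((1 + s ^+ 4) * kap n * bet n)) *: sv n.+1 1%N.
    rewrite (cFBs rM) (mF0 M) !linear0 add0r K_low linearZ /= A_low sqN.
    apply: (ip_inj (ip := ip)) => w; rewrite !(ipDl, ipNl, ipZl); field.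
    by rewrite s_neq0 sN_neq0.
  rewrite /y linearB linearD !linearZ FBs /= (mFS M N2) dimNS subn1 /=.
  (* At spin 0 the denominator of [xi1] is zero, but [xi1] only multiplies the vector [sv n 1],
     which is zero as well. The remaining coefficient of [sv n 0] vanishes by [alp_N0]. *)
  have [n0|n0] := posnP (N n).
    rewrite [sv n 1%N]bvec_out ?n0 // linear0 scaler0 addr0 alp_N0 // subrr.
    rewrite mulr0 scale0r add0r; apply: (ip_inj (ip := ip)) => w.
    rewrite !(ipDl, ipNl, ipZl, ip0l) /xi2 n0 expr0z.
    by rewrite n0 in r10; field; rewrite rt20 r10 s_neq0.
  have r0 : rt s (N n) != 0 by rewrite rt_neq0.
  rewrite F_1 //; apply: (ip_inj (ip := ip)) => w.
  rewrite !(ipDl, ipNl, ipZl, ip0l) /xi2 /xi1; field.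
  by rewrite rt20 r0 r10 s_neq0 sN_neq0.
(* The weight of y is the lowest weight of the preceding level. No such level exists for n = 0, so y
   = 0 there. *)
case: n @y N2 K1 Ky r10 Fy => [|n] y N2 K1 Ky r10 Fy.
  apply: (lowest_weight_0 Ky Fy) => n; rewrite /dimN; lia.
have -> : (bet n)^* = ip y (sv n 0%N).
  rewrite /y ipBl ipDl !ipZl !bform_vec // (adj_swap (madjB M)) B_low ipZr bform_vec //.
  rewrite !eqxx /= !andbF /=.
  by rewrite !mulr0 addr0 subr0 mulr1.
apply: lowest_weight_sv => //; rewrite Ky dimNS; congr (_ ^ _ *: _); lia.
Qed.

(** This is the diagonal entry at e_n of the relation for B* B: the left side is the square norm of
    B e_n, and A^2 contributes the square norm of A e_n, whose second component gives the summand
    with [kap]. *)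
Lemma norm_bet n :
  bet n * (bet n)^* * (1 + kap n ^+ 2) = th * alp n - alp n ^+ 2 + ct.
Proof.
have N1 : (1 <= N n.+1)%N by rewrite dimNS.
have := congr1 (fun u => ip u (sv n 0%N)) (cBsB rM (sv n 0%N)).
rewrite /= ipDl ipBl !ipZl -/(alp n) (adj_swap (madjB M)) (madjA M (A _)).
rewrite B_low A_low !(ipDl, ipDr, ipZl, ipZr) !bform_vec // !eqxx /=.
rewrite ltn_eqF // gtn_eqF //= rmorphM /= conj_alp conj_kap !(mulr0, mulr1).
move=> e; rewrite mulrDr mulr1 {1}e; ring.
Qed.

(** The coefficient of e_(n+1) in A B e_n = q^-2 B A e_n. The right side is read off by moving B
    onto e_(n+1) as B*, and then [bet n] cancels. *)
Lemma alp_rec n : bet n != 0 ->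
  s ^+ 4 * alp n.+1 = alp n + kap n * xi1 n.+1.
Proof.
move=> b0; have N1 : (2 <= N n.+1)%N by rewrite dimNS.
have := congr1 (fun u => ip u (sv n.+1 0%N)) (cAB rM (sv n 0%N)).
rewrite /= ipZl B_low linearZ ipZl -/(alp n.+1) (madjB M) A_low Bs_low.
rewrite !(ipDl, ipDr, ipZl, ipZr) !bform_vec ?dimNS // !eqxx /=.
rewrite !andbF /=.
rewrite conjCK conj_xi1 !(mulr0, mulr1, addr0, add0r) => e.
apply: (mulfI b0); rewrite mulrCA e; field.
exact: s_neq0.
Qed.

(** The diagonal entry at e_0 of the relation for B B*. At the bottom B* e_0 has no component in a
    lower level, which makes this an equation independent of the recursion. *)
Lemma norm_xi : (0 < m)%N -> xi1 0 ^+ 2 + xi2 0 * (xi2 0)^* =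
  th * s ^+ 4 * alp 0 - s ^+ 8 * (alp 0 ^+ 2 + kap 0 ^+ 2 * (bet 0 * (bet 0)^*))
  + ct.
Proof.
move=> m0; have N1 : (2 <= N 1)%N by rewrite dimNS.
have N0 : (1 <= N 0)%N by rewrite /dimN addn0.
have := congr1 (fun u => ip u (sv 0 0%N)) (cBBs rM (sv 0 0%N)).
rewrite /= ipDl ipBl !ipZl -/(alp 0) (madjB M) (madjA M (A _)).
rewrite A_low Bs_low addr0 !(ipDl, ipDr, ipZl, ipZr) !bform_vec ?(ltnW N1) //=; last 2 first.
- exact: ltnW N1.
- exact: ltnW N1.
rewrite conj_alp conj_xi1 !(mulr0, mulr1, addr0, add0r) (rmorphM _ (kap 0)) /= conj_kap.
by move=> e; rewrite expr2 addrC e; ring.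
Qed.

End LowestWeights.

(** * The recursion for the coefficients of A *)

Section Spectrum.
Variables (C : numClosedFieldType) (s th ct : C).
Hypotheses (s_gt0 : 0 < s) (s_lt1 : s < 1).
Hypotheses (conj_theta : th^* = th) (ct_ge0 : 0 <= ct).
Hypothesis disc_gt0 : 0 < ct + th ^+ 2 / 4.
Variable m : nat.
Local Notation N := (dimN m).

(* For the spin [l = l0 + n], [qx n] is q^(2 l + 2); [qx0] is q^(2 l0). *)
Definition qx n : C := (s ^ (N n)%:Z * s ^+ 2) ^+ 2.
Definition qx0 : C := (s ^ (N 0)%:Z) ^+ 2.
(** The general solution of the recursion in [alp_step]. For g = (1 - qx^2) (alp - th / 2) it reads
    g' = s^4 g + th / 2 (1 - s^4) (1 - s^4 qx^2). A particular solution is th / 2 (1 + qx^2), and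
    the homogeneous ones are the multiples of qx, as qx is multiplied by s^4 in each step. For l0 =
    0 one has qx0 = 1, and the factor of qx is -th whatever d is. *)
Definition spec (d : C) n : C := th / 2 + (th / 2 * (1 + qx n ^+ 2) +
  ((d - th / 2) / qx0 - (d + th / 2) * qx0) * qx n) / (1 - qx n ^+ 2).

Let s_neq0 : s != 0.
Proof. exact: sq_neq0. Qed.

Let S_neq0 z : s ^ z != 0.
Proof. exact: sq_exp_neq0. Qed.

Lemma sdimNS n : s ^ (N n.+1)%:Z = s ^ (N n)%:Z * s ^+ 2.
Proof. by rewrite dimNS -addn2 PoszD sqD. Qed.

Lemma qxS n : qx n.+1 = qx n * s ^+ 4.
Proof. by rewrite /qx sdimNS; ring. Qed.

Lemma qx_0 : qx 0 = qx0 * s ^+ 4.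
Proof. by rewrite /qx /qx0; set S := s ^ _; ring. Qed.

Lemma qx_gt0 n : 0 < qx n.
Proof. by rewrite exprn_gt0 // mulr_gt0 ?sq_exp_gt0 ?exprn_gt0. Qed.

Lemma qx0_gt0 : 0 < qx0.
Proof. by rewrite exprn_gt0 ?sq_exp_gt0. Qed.

Lemma qx0_neq0 : qx0 != 0.
Proof. by rewrite gt_eqF ?qx0_gt0. Qed.

Lemma qx0_le1 : qx0 <= 1.
Proof. by rewrite /qx0 exprn_ile1 ?exprn_ge0 ?exprn_ile1 ?ltW. Qed.

Lemma qx_lt0 n : qx n < qx0.
Proof.
have s4 : s ^+ 4 < 1 by rewrite sq_expn_lt1.
elim: n => [|n]; last first.
  by rewrite qxS; apply: lt_trans; rewrite gtr_pMr ?qx_gt0.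
by rewrite qx_0 gtr_pMr ?qx0_gt0.
Qed.

Lemma qx_lt1 n : qx n < 1.
Proof. exact: lt_le_trans (qx_lt0 n) qx0_le1. Qed.

Lemma qx_sqr_neq1 n : 1 - qx n ^+ 2 != 0.
Proof.
by rewrite subr_eq0 gt_eqF // exprn_ilt1 ?qx_lt1 // ltW ?qx_gt0.
Qed.

Lemma disc_real (d : C) : d ^+ 2 = ct + th ^+ 2 / 4 -> d^* = d.
Proof.
move=> d2; have : d ^+ 2 == sqrtC (ct + th ^+ 2 / 4) ^+ 2 by rewrite sqrtCK d2.
have r : (sqrtC (ct + th ^+ 2 / 4))^* = sqrtC (ct + th ^+ 2 / 4).
  by rewrite geC0_conj // sqrtC_ge0 ltW.
by rewrite eqf_sqr => /orP[] /eqP->; rewrite ?rmorphN /= r.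
Qed.

(* The roots of th a - a^2 + ct are th / 2 + d and th / 2 - d.  Replacing [qx n]
   by [qx0], one step below the bottom, [spec d] would take the value th / 2 + d:
   this is where the factor [qx0 - qx n] comes from. *)
Lemma spec_pos d n : d ^+ 2 = ct + th ^+ 2 / 4 ->
  0 < th * spec d n - spec d n ^+ 2 + ct.
Proof.
move=> d2; have dr := disc_real d2.
have x0 := qx0_gt0; have x := qx_gt0 n.
have x1 := qx_sqr_neq1 n.
pose e := (d - th / 2) / qx0; pose f := d + th / 2.
have ctE : ct = d ^+ 2 - th ^+ 2 / 4 by rewrite d2 addrK.
have -> : th * spec d n - spec d n ^+ 2 + ct =
    (qx0 - qx n) * (1 - qx0 * qx n) * ((e + f * qx n) * (f + e * qx n)) /
    (1 - qx n ^+ 2) ^+ 2.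
  rewrite /spec /e /f ctE; field.
  by rewrite x1 qx0_neq0.
have er : e \is Num.real.
  rewrite CrealE rmorphM rmorphB fmorphV rmorphM fmorphV /= conjC_nat.
  by rewrite dr conj_theta (geC0_conj (ltW x0)).
have fr : f \is Num.real.
  by rewrite CrealE rmorphD rmorphM fmorphV /= conjC_nat dr conj_theta.
have pos1 : 0 < (qx0 - qx n) * (1 - qx0 * qx n).
  rewrite mulr_gt0 ?subr_gt0 ?qx_lt0 //.
  by rewrite (le_lt_trans _ (qx_lt1 n)) // ler_piMl ?qx0_le1 ?ltW.
have pos2 : 0 < (1 - qx n ^+ 2) ^+ 2.
  by rewrite exprn_gt0 // subr_gt0 exprn_ilt1 ?qx_lt1 //; exact: ltW.
rewrite mulr_gt0 ?invr_gt0 // mulr_gt0 //.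
(* The product e f equals ct / qx0, which is nonnegative. The summand e^2 + f^2 makes the inequality
   strict, since e = f = 0 would force d = 0 against [disc_gt0]. *)
have -> : (e + f * qx n) * (f + e * qx n) =
      ct / qx0 * (1 + qx n ^+ 2) + (e ^+ 2 + f ^+ 2) * qx n.
    by rewrite /e /f ctE; field; rewrite qx0_neq0.
apply: ltr_wpDl.
  have [x0' x'] := (ltW x0, ltW x).
  apply: mulr_ge0; first exact: divr_ge0.
  by apply: addr_ge0 => //; exact: exprn_ge0.
rewrite mulr_gt0 // lt_def addr_ge0 ?real_exprn_even_ge0 // andbT.
rewrite paddr_eq0 ?real_exprn_even_ge0 // !expf_eq0 /=.
apply/negP => /andP[/eqP e0 /eqP f0].
have d0 : d = (e * qx0 + f) / 2 by rewrite /e /f; field; rewrite qx0_neq0.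
by move: disc_gt0; rewrite -d2 d0 e0 f0 mul0r addr0 mul0r expr0n ltxx.
Qed.

Lemma br_qx n : br s (N n).+2 = (qx n - (qx n)^-1) / (s ^+ 2 - s ^- 2).
Proof.
by rewrite /br sqN -addn2 PoszD (sqD s_gt0) /qx -!expr2 exprVn.
Qed.

Lemma br_qx0 (j : nat) : br s (N 0 + j)%N =
  (qx0 * s ^+ (j * 2) - (qx0 * s ^+ (j * 2))^-1) / (s ^+ 2 - s ^- 2).
Proof.
by rewrite /br sqN PoszD (sqD s_gt0) /qx0 exprM -!expr2 exprVn exprMn.
Qed.

Lemma kap_sqr n : kap s m n ^+ 2 = (s ^+ 6 * (qx n / s ^+ 4) * br s (N n).+2)^-1.
Proof.
rewrite /kap -(rt_sqr s) /qx; have r0 : rt s (N n).+2 != 0.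
  exact: rt_neq0.
by set S := s ^ _; field; rewrite r0 s_neq0 S_neq0.
Qed.

Variable b : spinBasis C m.
Local Notation V := (bspace b).
Variables A B Bs E F K Ki : {linear V -> V}.
Hypothesis M : spin_model s th ct A B Bs E F K Ki.
Local Notation alp := (alp A).
Local Notation bet := (bet B).

(** The square roots in [kap n] and [xi1 n.+1] are the same, since [N n.+1] is [(N n).+2]; their
    product is therefore rational in qx and s, and the recursion can be cleared of denominators. *)
Lemma alp_step n : bet n != 0 -> (1 - qx n.+1 ^+ 2) * alp n.+1 =
  s ^+ 4 * (1 - qx n ^+ 2) * alp n - th * (s ^+ 4 - 1).
Proof.
move=> b0; have e := alp_rec s_gt0 s_lt1 conj_theta M b0.
have r0 : rt s (N n).+2 != 0 by rewrite rt_neq0.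
have x0 : qx n != 0 by rewrite gt_eqF ?qx_gt0.
have L0 := lam_neq0 s_gt0 s_lt1.
have {}e : s ^+ 4 * alp n.+1 = alp n -
    ((1 + s ^+ 4) * alp n.+1 - th) / (s ^+ 6 * (qx n / s ^+ 4) * br s (N n).+2).
  rewrite e /xi1 /kap sdimNS dimNS -(rt_sqr s) /qx.
  have := S_neq0 (N n); set S := s ^ _ => S0; field.
  by rewrite s_neq0 r0 S0.
rewrite br_qx in e; rewrite qxS.
have qx_sqr1 : qx n * qx n - 1 != 0.
  by have := qx_sqr_neq1 n; rewrite -expr2 -oppr_eq0 opprB.
have s41 : (s * s) ^+ 2 - 1 != 0.
  by rewrite subr_eq0 lt_eqF // -expr2 -exprM sq_expn_lt1.
have -> : alp n = s ^+ 4 * alp n.+1 + ((1 + s ^+ 4) * alp n.+1 - th) /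
    (s ^+ 6 * (qx n / s ^+ 4) * ((qx n - (qx n)^-1) / (s ^+ 2 - s ^- 2))).
  by rewrite e subrK.
by field; rewrite s_neq0 s41 x0 qx_sqr1.
Qed.

Lemma alp_specS d n : bet n != 0 -> alp n = spec d n -> alp n.+1 = spec d n.+1.
Proof.
move=> /alp_step e aE; have x1 := qx_sqr_neq1 n.+1.
rewrite qxS in x1 e.
apply: (mulfI x1); rewrite e aE /spec qxS; field.
by rewrite x1 qx_sqr_neq1 qx0_neq0.
Qed.

(* The value of [d] for which [spec d 0 = a]. *)
Definition bottom a : C := (th / 2 * (1 + qx0 ^+ 2) +
  ((a - th / 2) * (1 - qx 0 ^+ 2) - th / 2 * (1 + qx 0 ^+ 2)) / qx 0 * qx0) /
  (1 - qx0 ^+ 2).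

Lemma qx0_sqr_neq1 : (0 < m)%N -> 1 - qx0 ^+ 2 != 0.
Proof.
move=> m0; rewrite subr_eq0 gt_eqF // /qx0 -exprM.
have -> : s ^ (N 0)%:Z = s ^+ m by rewrite /dimN addn0.
by rewrite -exprM sq_expn_lt1 // muln_gt0 m0.
Qed.

Lemma bottomK a : (0 < m)%N -> spec (bottom a) 0 = a.
Proof.
move=> m0; have x1 := qx_sqr_neq1 0; rewrite qx_0 in x1.
rewrite /spec /bottom qx_0; field.
by rewrite x1 qx0_sqr_neq1 // s_neq0 qx0_neq0.
Qed.

(** Eliminating |bet 0|^2 between [norm_bet] and [norm_xi] leaves a quadratic equation for [alp 0].
    The affine substitution [bottom] completes the square. *)
Lemma bottom_sqr : (0 < m)%N -> bottom (alp 0) ^+ 2 = ct + th ^+ 2 / 4.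
Proof.
move=> m0; have e1 := norm_bet s_gt0 s_lt1 M 0.
have e2 := norm_xi s_gt0 s_lt1 conj_theta M m0.
have r0 : rt s (N 0) != 0 by rewrite rt_neq0 // /dimN addn0.
have r1 : rt s (N 0).+1 != 0 by rewrite rt_neq0.
have r2 : rt s 2 != 0 by rewrite rt_neq0.
set be := bet 0 * _ in e1 e2.
have {}e2 : ((1 + s ^+ 4) * alp 0 - th) ^+ 2 / (s ^+ 2 * qx0 * br s (N 0)) +
    (1 + s ^+ 4) ^+ 2 * kap s m 0 ^+ 2 * be /
      (s ^+ 2 * qx0 * (br s (N 0).+1 * br s 2)) =
    th * s ^+ 4 * alp 0 - s ^+ 8 * (alp 0 ^+ 2 + kap s m 0 ^+ 2 * be) + ct.
  have c4 : (1 + s ^+ 4)^* = 1 + s ^+ 4.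
    by rewrite rmorphD rmorphXn /= conjC1 conj_sq.
  rewrite -e2 /xi1 /xi2 !(rmorphM, fmorphV) /= c4 conj_kap // !conj_rt //.
  rewrite conj_sq_exp // (conj_sq s_gt0) -!(rt_sqr s).
  rewrite /be /qx0; have := S_neq0 (N 0); set S := s ^ _ => S0.
  by field; rewrite s_neq0 r0 r1 r2 S0.
have b0 := br_qx0 0; rewrite addn0 mul0n expr0 mulr1 in b0.
have b1 := br_qx0 1; rewrite addn1 mul1n in b1.
have b2 := br_qx0 2; rewrite addn2 in b2.
have b3 := br_qx0 3.
have bb : br s 2%N = s ^+ 2 + s ^- 2.
  rewrite /br sqN -!expr2; have := lam_neq0 s_gt0 s_lt1 => L0.
  by apply: (mulIf L0); rewrite divfK //; field; exact: s_neq0.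
have n0 j : (0 < N 0 + j)%N by rewrite /dimN addn0 addn_gt0 m0.
have bz j : br s (N 0 + j)%N != 0 by rewrite br_neq0.
have bz0 : br s (N 0) != 0 by have := bz 0; rewrite addn0.
have bz1 : br s (N 0).+1 != 0 by have := bz 1; rewrite addn1.
have bz2 : br s (N 0).+2 != 0 by have := bz 2; rewrite addn2.
have s41 : (s * s) ^+ 2 - 1 != 0.
  by rewrite subr_eq0 lt_eqF // -expr2 -exprM sq_expn_lt1.
have x41 j : qx0 * s ^+ j * (qx0 * s ^+ j) - 1 != 0.
  have := qx0_sqr_neq1 m0; rewrite subr_eq0 eq_sym => x1.
  rewrite subr_eq0 lt_eqF // -expr2 exprn_ilt1 ?mulr_ge0 ?exprn_ge0 //;
    try exact: ltW qx0_gt0; try exact: ltW.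
  rewrite (@le_lt_trans _ _ qx0) ?ler_piMr ?exprn_ile1 ?(ltW s_gt0) ?(ltW s_lt1) ?(ltW qx0_gt0) //.
  rewrite lt_neqAle qx0_le1 andbT; apply: contraNneq x1 => ->.
  by rewrite expr1n.
have k2 : kap s m 0 ^+ 2 = (s ^+ 6 * qx0 * br s (N 0).+2)^-1.
  by rewrite kap_sqr qx_0 mulfK // expf_neq0.
have k1 : 1 + kap s m 0 ^+ 2 = s ^- 2 * br s (N 0 + 3) / br s (N 0).+2.
  rewrite k2 b2 b3; field.
  by rewrite s_neq0 s41 qx0_neq0 (x41 4).
have {e1} beE : be = s ^+ 2 * (th * alp 0 - alp 0 ^+ 2 + ct) * br s (N 0).+2 /
    br s (N 0 + 3).
  rewrite -e1 k1; field.
  by rewrite s_neq0 bz bz2.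
(* The ratio between the two sides' difference in [e2], after the elimination, and bottom^2 - ct -
   th^2 / 4. It is nonzero because l0 > 0. *)
have f0 : s ^+ 2 * (br s (N 0) / br s (N 0).+1) != 0.
  by rewrite mulf_neq0 ?expf_neq0 // mulf_neq0 ?invr_neq0.
apply/eqP; rewrite -subr_eq0; apply/eqP/(mulIf f0); rewrite mul0r.
move/eqP: e2; rewrite -subr_eq0 => /eqP e2; rewrite -[RHS]e2.
rewrite beE k2 b0 b1 b2 b3 bb /bottom qx_0; field.
rewrite s_neq0 s41 qx0_neq0 (x41 6) (x41 4) (x41 2) qx0_sqr_neq1 // andbT.
have := x41 0; rewrite expr0 mulr1 => ->; rewrite andbT /=.
by rewrite gt_eqF // addr_gt0 ?ltr01 // exprn_gt0 // mulr_gt0.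
Qed.

Lemma bet_neq0 d n : d ^+ 2 = ct + th ^+ 2 / 4 -> alp n = spec d n ->
  bet n != 0.
Proof.
move=> d2 aE; have := norm_bet s_gt0 s_lt1 M n; rewrite aE.
by apply: contra_eqN => /eqP->; rewrite !mul0r lt_eqF // spec_pos.
Qed.

Theorem alp_spec : exists2 d, d ^+ 2 = ct + th ^+ 2 / 4 &
  forall n, alp n = spec d n /\ bet n != 0.
Proof.
suff [d d2 a0] : exists2 d, d ^+ 2 = ct + th ^+ 2 / 4 & alp 0 = spec d 0.
  (* The two claims feed each other: [alp n = spec d n] gives [bet n != 0] through [spec_pos], and
     [bet n != 0] allows the next step of the recursion. *)
  exists d => //; elim=> [|n [aE bE]]; first by split=> //; exact: bet_neq0 a0.
  by have aS := alp_specS bE aE; split=> //; exact: bet_neq0 aS.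
have [m0|m_gt0] := posnP m; last first.
  by exists (bottom (alp 0)); rewrite ?bottom_sqr ?bottomK.
(* For l0 = 0 the value [alp 0] is forced by [alp_N0] and [spec d 0] does not depend on d, so either
   root serves. *)
exists (sqrtC (ct + th ^+ 2 / 4)); first exact: sqrtCK.
set d := sqrtC _.
have N0 : N 0 = 0%N by rewrite /dimN m0.
have x0 : qx0 = 1 by rewrite /qx0 N0 expr0z expr1n.
have := alp_N0 s_gt0 M N0 => aE.
have s41 : 1 + s ^+ 4 != 0 by rewrite gt_eqF // addr_gt0 ?ltr01 ?exprn_gt0.
have := qx_sqr_neq1 0; rewrite qx_0 x0 mul1r => x1.
by apply: (mulfI s41); rewrite aE /spec qx_0 x0 mul1r; field; exact: x1.
Qed.

End Spectrum.

(** * Uniqueness and irreducibility *)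

Section Uniqueness.
Variables (C : numClosedFieldType) (s th ct : C).
Hypotheses (s_gt0 : 0 < s) (s_lt1 : s < 1) (conj_theta : th^* = th).
Variables (m : nat) (b : spinBasis C m).
Local Notation V := (bspace b).
Local Notation ip := (bform b).
Local Notation sv := (bvec b).
Local Notation N := (dimN m).
Variables A1 B1 Bs1 E1 F1 K1 Ki1 A2 B2 Bs2 E2 F2 K2 Ki2 : {linear V -> V}.
Hypothesis M1 : spin_model s th ct A1 B1 Bs1 E1 F1 K1 Ki1.
Hypothesis M2 : spin_model s th ct A2 B2 Bs2 E2 F2 K2 Ki2.
Hypothesis alp12 : forall n, alp A1 n = alp A2 n.
Hypothesis bet1_neq0 : forall n, bet B1 n != 0.
Let r1 := mrel M1.
Let r2 := mrel M2.

(** The solution, with value 1 at the bottom, of phase (n+1) bet1 n = phase n bet2 n, which is the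
    condition for a scalar on each level to intertwine B1 and B2 on the lowest weight vectors. *)
Fixpoint phase (n : nat) : C :=
  if n is n'.+1 then phase n' * (bet B2 n' / bet B1 n') else 1.

Lemma kap1_neq0 n : 1 + kap s m n ^+ 2 != 0.
Proof.
rewrite gt_eqF // ltr_wpDr ?ltr01 // real_exprn_even_ge0 //.
by rewrite CrealE conj_kap.
Qed.

Lemma norm_bet12 n : bet B2 n * (bet B2 n)^* = bet B1 n * (bet B1 n)^*.
Proof.
apply: (mulIf (kap1_neq0 n)).
by rewrite (norm_bet s_gt0 s_lt1 M1) (norm_bet s_gt0 s_lt1 M2) alp12.
Qed.

Lemma norm_phase n : phase n * (phase n)^* = 1.
Proof.
elim: n => [|n IHn] /=; first by rewrite conjC1 mulr1.
rewrite !rmorphM fmorphV /= mulrACA IHn mul1r mulrACA norm_bet12 -invfM.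
by rewrite divff // mulf_neq0 ?conjC_eq0.
Qed.

Lemma phase_neq0 n : phase n != 0.
Proof. by apply: contra_eq_neq (norm_phase n) => ->; rewrite mul0r eq_sym oner_eq0. Qed.

Definition phaseU : {linear V -> V} :=
  @bvec_lin C m b (fun n k => phase n *: sv n k).

Definition phaseV : {linear V -> V} :=
  @bvec_lin C m b (fun n k => (phase n)^-1 *: sv n k).

Lemma phaseU_vec n (k : nat) : phaseU (sv n k) = phase n *: sv n k.
Proof.
have [kN|kN] := leqP k (N n); first by rewrite bvec_linE.
by rewrite bvec_out ?linear0 //= lez_nat -ltnNge.
Qed.

Lemma phaseV_vec n (k : nat) : phaseV (sv n k) = (phase n)^-1 *: sv n k.
Proof.
have [kN|kN] := leqP k (N n); first by rewrite bvec_linE.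
by rewrite bvec_out ?linear0 //= lez_nat -ltnNge.
Qed.

Lemma phaseU_bij : bijective phaseU.
Proof.
exists phaseV => u.
  apply: (lin_ext (f := phaseV \o phaseU) (g := idfun)) => n k _ /=.
  by rewrite phaseU_vec (linZ phaseV) phaseV_vec scalerA divff ?phase_neq0 // scale1r.
apply: (lin_ext (f := phaseU \o phaseV) (g := idfun)) => n k _ /=.
by rewrite phaseV_vec (linZ phaseU) phaseU_vec scalerA mulVf ?phase_neq0 // scale1r.
Qed.

Lemma phaseU_iso u v : ip (phaseU u) (phaseU v) = ip u v.
Proof.
move: u v; apply: iso_ext => n k n' k' kN kN'.
rewrite !phaseU_vec ipZl ipZr bform_vec //.
case: eqVneq => [<-|_] /=; last by rewrite !mulr0.
by rewrite mulrA norm_phase mul1r.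
Qed.

Lemma phaseU_K u : phaseU (K1 u) = K2 (phaseU u).
Proof.
apply: (lin_ext (f := phaseU \o K1) (g := K2 \o phaseU)) => n k kN /=.
by rewrite (mK M1) // !(linZ phaseU) !phaseU_vec (linZ K2) (mK M2) // !scalerA mulrC.
Qed.

Lemma phaseU_Ki u : phaseU (Ki1 u) = Ki2 (phaseU u).
Proof. by rewrite -[LHS](cKiK r2) -phaseU_K (cKKi r1). Qed.

Lemma phaseU_E u : phaseU (E1 u) = E2 (phaseU u).
Proof.
apply: (lin_ext (f := phaseU \o E1) (g := E2 \o phaseU)) => n k kN /=.
by rewrite (mE M1) // !(linZ phaseU) !phaseU_vec (linZ E2) (mE M2) // !scalerA mulrC.
Qed.

Lemma phaseU_F u : phaseU (F1 u) = F2 (phaseU u).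
Proof.
apply: (lin_ext (f := phaseU \o F1) (g := F2 \o phaseU)) => n [|k] kN /=.
  by rewrite (mF0 M1) phaseU_vec (linZ F2) (mF0 M2) !linear0.
by rewrite (mFS M1) // !(linZ phaseU) !phaseU_vec (linZ F2) (mFS M2) // !scalerA mulrC.
Qed.

Definition intertwined u := [/\ phaseU (A1 u) = A2 (phaseU u),
  phaseU (B1 u) = B2 (phaseU u) & phaseU (Bs1 u) = Bs2 (phaseU u)].

Lemma intertwinedZ z u : intertwined u -> intertwined (z *: u).
Proof.
move=> [hA hB hBs]; split.
- by rewrite (linZ A1) !(linZ phaseU) (linZ A2) hA.
- by rewrite (linZ B1) !(linZ phaseU) (linZ B2) hB.
- by rewrite (linZ Bs1) !(linZ phaseU) (linZ Bs2) hBs.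
Qed.

(** The three operators have to be carried along together: commuting E past A produces B* K, and
    past B it produces A K. Since u is a weight vector, intertwining at K u comes for free. *)
Lemma intertwinedE z u : K1 u = z *: u -> intertwined u -> intertwined (E1 u).
Proof.
move=> Ku /[dup] hu [hA hB hBs].
have [kA kB kBs] : intertwined (K1 u) by rewrite Ku; exact: intertwinedZ.
have s0 : s != 0 by rewrite gt_eqF.
split.
- have e1 := cEA r1 u; have e2 := cEA r2 (phaseU u).
  rewrite [LHS](_ : _ = phaseU (E1 (A1 u) - s^-1 *: Bs1 (K1 u))); last first.
    by rewrite e1 addrK.
  rewrite (linB phaseU) (linZ phaseU) !phaseU_E hA e2 kBs phaseU_K addrK.
  by [].
- have BE (B E A K : {linear V -> V}) :
      (forall u, E (B u) = s ^+ 2 *: B (E u) - (s * (1 + s ^+ 4)) *: A (K u)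
         + (th * s) *: K u) -> forall u, B (E u) =
       s ^- 2 *: (E (B u) + (s * (1 + s ^+ 4)) *: A (K u) - (th * s) *: K u).
    move=> H v; rewrite H addrAC addrK subrK scalerA mulVf ?scale1r //.
    by rewrite expf_neq0.
  rewrite (BE _ _ _ _ (cEB r1)) !phaseU_E (BE _ _ _ _ (cEB r2)).
  rewrite (linZ phaseU) (linB phaseU) (linD phaseU) !(linZ phaseU) phaseU_E hB kA !phaseU_K.
  by [].
- have BE (B E : {linear V -> V}) : (forall u, E (B u) = s ^- 2 *: B (E u)) ->
      forall u, B (E u) = s ^+ 2 *: E (B u).
    by move=> H v; rewrite H scalerA divff ?scale1r // expf_neq0.
  rewrite (BE _ _ (cEBs r1)) phaseU_E (BE _ _ (cEBs r2)).
  by rewrite (linZ phaseU) phaseU_E hBs.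
Qed.

Lemma phaseS n : phase n.+1 * bet B1 n = phase n * bet B2 n.
Proof. by rewrite /= -mulrA divfK. Qed.

Lemma intertwined_low n : intertwined (sv n 0%N).
Proof.
split.
- rewrite (A_low s_gt0 s_lt1 M1) (linD phaseU) !(linZ phaseU) !phaseU_vec (linZ A2).
  rewrite (A_low s_gt0 s_lt1 M2) alp12 scalerDr !scalerA [_ * phase n]mulrC.
  congr (_ + _ *: _); rewrite -mulrA [bet _ _ * _]mulrC phaseS; ring.
- rewrite (B_low s_gt0 s_lt1 M1) !(linZ phaseU) !phaseU_vec (linZ B2).
  by rewrite (B_low s_gt0 s_lt1 M2) !scalerA mulrC phaseS.
rewrite (Bs_low s_gt0 s_lt1 M1) !(linD phaseU) !(linZ phaseU) !phaseU_vec.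
rewrite (linZ Bs2) (Bs_low s_gt0 s_lt1 M2) !scalerDr !scalerA.
congr (_ *: _ + _ *: _ + _).
- rewrite /xi2; set d := (X in _ / X).
  transitivity ((1 + s ^+ 4) * kap s m n / d * (phase n.+1 * bet B1 n)).
    by ring.
  by rewrite phaseS; ring.
- by rewrite /xi1 alp12 mulrC.
case: n => [|n]; rewrite ?linear0 //= (linZ phaseU) phaseU_vec !scalerA.
congr (_ *: _); apply: (mulfI (bet1_neq0 n)) => /=.
transitivity (phase n * (bet B2 n * (bet B2 n)^*)).
  by rewrite norm_bet12; ring.
by field; exact: bet1_neq0.
Qed.

Lemma phaseU_intertwines u : intertwined u.
Proof.
have vec_ok n (k : nat) : (k <= N n)%N -> intertwined (sv n k).
  elim: k => [|k IHk] kN; first exact: intertwined_low.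
  have c0 : rt s (N n - k) * rt s k.+1 != 0.
    by rewrite mulf_neq0 ?rt_neq0 // subn_gt0.
  have -> : sv n k.+1 = (rt s (N n - k) * rt s k.+1)^-1 *: E1 (sv n k).
    by rewrite (mE M1) ?(ltnW kN) // scalerA mulVf // scale1r.
  apply/intertwinedZ/(intertwinedE (mK M1 (ltnW kN))).
  exact/IHk/ltnW.
split.
- apply: (lin_ext (f := phaseU \o A1) (g := A2 \o phaseU)).
  by move=> n k /vec_ok[].
- apply: (lin_ext (f := phaseU \o B1) (g := B2 \o phaseU)).
  by move=> n k /vec_ok[].
apply: (lin_ext (f := phaseU \o Bs1) (g := Bs2 \o phaseU)).
by move=> n k /vec_ok[].
Qed.

Lemma phaseU_cross_op g u :
  phaseU (cross_op A1 B1 Bs1 E1 F1 K1 Ki1 g u) =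
  cross_op A2 B2 Bs2 E2 F2 K2 Ki2 g (phaseU u).
Proof.
have [hA hB hBs] := phaseU_intertwines u.
by case: g => [[]|[]] //=; rewrite ?phaseU_E ?phaseU_F ?phaseU_K ?phaseU_Ki.
Qed.

End Uniqueness.

(** * Irreducibility *)

Section Irreducibility.
Variables (C : numClosedFieldType) (s th ct : C).
Hypotheses (s_gt0 : 0 < s) (s_lt1 : s < 1).
Variables (m : nat) (b : spinBasis C m).
Local Notation V := (bspace b).
Local Notation ip := (bform b).
Local Notation sv := (bvec b).
Local Notation N := (dimN m).
Variables A B Bs E F K Ki : {linear V -> V}.
Hypothesis M : spin_model s th ct A B Bs E F K Ki.
Hypothesis bet_neq0 : forall n, bet B n != 0.

Definition stable (W : V -> Prop) := [/\ W 0,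
  forall z u v, W u -> W v -> W (z *: u + v) &
  forall u, W u -> [/\ W (B u), W (E u), W (F u) & W (K u)]].

Lemma stableZ W z u : stable W -> W u -> W (z *: u).
Proof. by move=> [W0 WD _] Wu; rewrite -[_ *: _]addr0; exact: WD. Qed.

Lemma stable_full W : stable W -> W (sv 0 0%N) -> forall u, W u.
Proof.
move=> sW W00; have [W0 WD WX] := sW; apply: bvec_ind => // n k kN.
have Wn0 : W (sv n 0%N).
  elim: n {k kN} => // n /WX[+ _ _ _]; rewrite (B_low s_gt0 s_lt1 M).
  move/(stableZ (bet B n)^-1 sW).
  by rewrite scalerA mulVf // scale1r.
elim: k kN => // k IHk kN; have [_ + _ _] := WX _ (IHk (ltnW kN)).
rewrite (mE M) ?(ltnW kN) // => /(stableZ (rt s (N n - k) * rt s k.+1)^-1 sW).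
by rewrite scalerA mulVf ?scale1r // mulf_neq0 ?rt_neq0 // subn_gt0.
Qed.

Lemma orthogonal_zero (W1 W2 : V -> Prop) x y :
  (forall u v, W1 u -> W2 v -> ip u v = 0) -> W1 x -> W2 y -> x + y = 0 ->
  x = 0 /\ y = 0.
Proof.
move=> W12 W1x W2y /eqP; rewrite addr_eq0 => /eqP xy.
have y0 : y = 0.
  apply/eqP; rewrite -(ip_eq0 ip) -oppr_eq0 -ipNl -xy; apply/eqP; exact: W12.
by rewrite xy y0 oppr0.
Qed.

Lemma no_orthogonal_splitting (W1 W2 : V -> Prop) : stable W1 -> stable W2 ->
  (exists2 u, W1 u & u <> 0) -> (exists2 u, W2 u & u <> 0) ->
  (forall u v, W1 u -> W2 v -> ip u v = 0) ->
  ~ (forall w, exists u v, [/\ W1 u, W2 v & w = u + v]).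
Proof.
move=> sW1 sW2 [x W1x x0] [y W2y y0] W12 /(_ (sv 0 0%N)) [u [v [W1u W2v uv]]].
have [W10 W1D W1X] := sW1; have [W20 W2D W2X] := sW2.
have [_ _ W1F W1K] := W1X u W1u; have [_ _ W2F W2K] := W2X v W2v.
have [Fu Fv] : F u = 0 /\ F v = 0.
  by apply: (orthogonal_zero W12) => //; rewrite -linearD -uv (mF0 M).
pose z := s ^ (- (N 0)%:Z).
have [Ku Kv] : - z *: u + K u = 0 /\ - z *: v + K v = 0.
  apply: (orthogonal_zero W12); [exact: W1D|exact: W2D|].
  rewrite addrACA -scalerDr -linearD -uv (K_low M) -scalerDl.
  by rewrite addNr scale0r.
have uE : u = ip u (sv 0 0%N) *: sv 0 0%N.
  apply: (lowest_weight_sv s_gt0 s_lt1 M) => //.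
  by move/eqP: Ku; rewrite scaleNr addrC subr_eq0 => /eqP.
have vE : v = ip v (sv 0 0%N) *: sv 0 0%N.
  apply: (lowest_weight_sv s_gt0 s_lt1 M) => //.
  by move/eqP: Kv; rewrite scaleNr addrC subr_eq0 => /eqP.
have [u0|u0] := eqVneq (ip u (sv 0 0%N)) 0.
  have W2e : W2 (sv 0 0%N) by rewrite uv uE u0 scale0r add0r.
  by apply/x0/eqP; rewrite -(ip_eq0 ip); apply/eqP/W12 => //; exact: stable_full.
have W1e : W1 (sv 0 0%N).
  by move: W1u; rewrite uE => /(stableZ (ip u (sv 0 0%N))^-1 sW1);
    rewrite scalerA mulVf // scale1r.
by apply/y0/eqP; rewrite -(ip_eq0 ip); apply/eqP/W12 => //; exact: stable_full.
Qed.

End Irreducibility.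

(** * Construction *)

Local Ltac real_closure :=
  repeat match goal with
  | |- is_true (?x + ?y \is Num.real) => apply: realD
  | |- is_true (- ?x \is Num.real) => rewrite realN
  | |- is_true (?x * ?y \is Num.real) => apply: realM
  | |- is_true (?x^-1 \is Num.real) => rewrite realV
  | |- is_true (?x ^+ ?n \is Num.real) => apply: realX
  | |- is_true (1 \is Num.real) => exact: real1
  | |- _ => by []
  end.

Local Ltac drop_conj := repeat match goal with
  | |- context [?x^*] => rewrite (_ : x^* = x); [|by apply/CrealP; real_closure]
  end.

Section Construction.
Variables (C : numClosedFieldType) (s th ct d : C).
Hypotheses (s_gt0 : 0 < s) (s_lt1 : s < 1).
Hypotheses (conj_theta : th^* = th) (ct_ge0 : 0 <= ct).
Hypothesis disc_gt0 : 0 < ct + th ^+ 2 / 4.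
Hypothesis d_sqr : d ^+ 2 = ct + th ^+ 2 / 4.
Variables (m : nat) (b : spinBasis C m).
Local Notation V := (bspace b).
Local Notation ip := (bform b).
Local Notation sv := (bvec b).
Local Notation N := (dimN m).
Local Notation spec := (spec s th m).
Local Notation qx := (qx s m).

(** By [norm_bet] this has to be |bet n|^2 (1 + kap n^2). *)
Definition gapQ n : C := th * spec d n - spec d n ^+ 2 + ct.

Lemma gapQ_gt0 n : 0 < gapQ n.
Proof. exact: spec_pos. Qed.

(** * An orthogonal basis with rational matrix coefficients *)

Fixpoint brfact (k : nat) : C :=
  if k is k'.+1 then brfact k' * br s k else 1.

Lemma brfact_gt0 k : 0 < brfact k.
Proof. by elim: k => [|k IHk] /=; rewrite ?ltr01 // mulr_gt0 ?br_gt0. Qed.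

(** The square norm of the rescaled e_n, normalized so that B sends the rescaled e_n to the rescaled
    e_(n+1). The factor is the value of |bet n|^2 given by [norm_bet], with 1 + kap n^2 = s^-2
    [N + 3] / [N + 2]. *)
Fixpoint levelW (n : nat) : C :=
  if n is n'.+1 then
    levelW n' * (s ^+ 2 * br s (N n').+2 / br s (N n').+3 * gapQ n')
  else 1.

Lemma levelW_gt0 n : 0 < levelW n.
Proof.
elim: n => [|n IHn] /=; first exact: ltr01.
apply: mulr_gt0 => //; apply: mulr_gt0; last exact: gapQ_gt0.
apply: divr_gt0; last exact: br_gt0.
apply: mulr_gt0; [exact: exprn_gt0|exact: br_gt0].
Qed.

(** Within a level these are inverse q-binomial coefficients: the square norms for which E and F,
    acting with coefficients [N - k] and [k], are adjoint. *)
Definition wt n (k : nat) : C :=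
  levelW n * (brfact k * brfact (N n - k) / brfact (N n)).

Lemma wt_gt0 n k : 0 < wt n k.
Proof. by rewrite !mulr_gt0 ?invr_gt0 ?brfact_gt0 ?levelW_gt0. Qed.

Lemma wtS n k : (k < N n)%N -> wt n k.+1 * br s (N n - k)%N = wt n k * br s k.+1.
Proof.
move=> kN; rewrite /wt -(subnSK kN) /=; ring.
Qed.

Definition nrm n (k : nat) : C := sqrtC (wt n k).

Lemma nrm_gt0 n k : 0 < nrm n k.
Proof. by rewrite sqrtC_gt0 wt_gt0. Qed.

Lemma nrm_neq0 n k : nrm n k != 0.
Proof. by rewrite gt_eqF ?nrm_gt0. Qed.

Lemma nrm_sqr n k : nrm n k * nrm n k = wt n k.
Proof. by rewrite -expr2 sqrtCK. Qed.

Lemma conj_nrm n k : (nrm n k)^* = nrm n k.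
Proof. exact/geC0_conj/ltW/nrm_gt0. Qed.

(* The rescaled basis in which all matrix coefficients are rational in
   [s], [s ^ N] and [s ^ k]. *)
Definition uv n (k : int) : V := locked (nrm n `|k| *: sv n k).

Lemma uv_out n k : ~~ (0 <= k <= (N n)%:Z) -> uv n k = 0.
Proof. by move=> kN; rewrite /uv -lock bvec_out ?scaler0. Qed.

Lemma ip_uv n k n' (k' : nat) : (k' <= N n')%N ->
  ip (uv n k) (uv n' k') = ((n == n') && (k == k'))%:R * wt n' k'.
Proof.
move=> kN; rewrite /uv -!lock ipZl ipZr bform_vec // conj_nrm mulrCA.
have [/andP[/eqP-> /eqP->]|_] := boolP (_ && _); last by rewrite !mulr0 !mul0r.
by rewrite mulr1 mul1r nrm_sqr.
Qed.

Lemma uvE n (k : nat) : uv n k = nrm n k *: sv n k.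
Proof. by rewrite /uv -lock. Qed.

Lemma svE n (k : nat) : sv n k = (nrm n k)^-1 *: uv n k.
Proof. by rewrite uvE scalerA mulVf ?scale1r ?nrm_neq0. Qed.

Lemma uv_ext (f g : {linear V -> V}) :
  (forall n (k : nat), (k <= N n)%N -> f (uv n k) = g (uv n k)) -> f =1 g.
Proof.
move=> fg; apply: lin_ext => n k kN.
by rewrite !svE (linZ f) (linZ g) fg.
Qed.

Lemma uv_adj (f g : {linear V -> V}) :
  (forall n (k : nat) n' (k' : nat), (k <= N n)%N -> (k' <= N n')%N ->
     ip (f (uv n k)) (uv n' k') = ip (uv n k) (g (uv n' k'))) ->
  forall u v, ip (f u) v = ip u (g v).
Proof.
move=> fg; apply: adj_ext => n k n' k' kN kN'.
by rewrite !svE (linZ f) (linZ g) !(ipZl, ipZr) fg.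
Qed.

Definition uvlin (f : nat -> int -> V) : {linear V -> V} :=
  @bvec_lin C m b (fun n k => (nrm n `|k|)^-1 *: f n k).

Lemma uvlinE f n (k : nat) : (k <= N n)%N -> uvlin f (uv n k) = f n k.
Proof.
move=> kN; rewrite uvE linearZ /= bvec_linE // scalerA divff ?scale1r //.
exact: nrm_neq0.
Qed.

(** This is q^k, kept as one symbol: on the k-th vector of level n the operator K acts by
    [qk k / S n], and q-numbers are rational in [qk k] by [br_qk]. *)
Definition qk (k : int) : C := s ^ k * s ^ k.

Arguments qk : simpl never.

Lemma qkD j k : qk (j + k) = qk j * qk k.
Proof. by rewrite /qk sqD // mulrACA. Qed.

Lemma qkN j : qk (- j) = (qk j)^-1.
Proof. by rewrite /qk sqN invfM. Qed.

Lemma qk_nat (j : nat) : qk j = s ^+ (j * 2).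
Proof. by rewrite exprM expr2. Qed.

Lemma qk_neq0 k : qk k != 0.
Proof. by rewrite mulf_neq0 ?sq_exp_neq0. Qed.

Lemma conj_qk k : (qk k)^* = qk k.
Proof. by rewrite rmorphM /= conj_sq_exp. Qed.

Lemma br_qk k : br s k = (qk k - (qk k)^-1) / (s ^+ 2 - s ^- 2).
Proof. by rewrite -qkN. Qed.

Local Notation S n := (s ^ (N n)%:Z).
Local Notation brN n k := (br s ((N n)%:Z - k)).

(** * The seven operators *)

Definition opE := uvlin (fun n k => brN n k *: uv n (k + 1)).
Definition opF := uvlin (fun n k => br s k *: uv n (k - 1)).
Definition opK := uvlin (fun n k => (qk k / S n) *: uv n k).
Definition opKi := uvlin (fun n k => (S n / qk k) *: uv n k).

(** Determined by adjointness: with this factor the part of [opB] from level n + 1 down to n is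
    adjoint to the upward part of [opBs] for the weights [wt]. *)
Definition cup n : C := - (gapQ n / (br s (N n).+1 * br s (N n).+3 * qx n)).
(** The value 0 at the bottom removes the spurious terms in which [n.-1] is again level 0. *)
Definition cdown n : C := if n is n'.+1 then cup n' else 0.
(** This is [xi1] carried over to the rescaled basis. At spin 0 the denominator is zero, and so is
    the value. *)
Definition cdiag n : C :=
  ((1 + s ^+ 4) * spec d n - th) / (s ^+ 3 * S n * br s (N n)).

(** The relation F B = q B F fixes how each of the three parts depends on k, up to one factor per
    level: 1 upwards, [cdiag n] within the level, [cdown n] downwards. *)
Definition opB := uvlin (fun n k =>
  qk k *: uv n.+1 k + (qk k * br s k * cdiag n) *: uv n (k - 1) +
  (qk k * br s k * br s (k - 1) * cdown n) *: uv n.-1 (k - 2)).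
(** The adjoint of [opB] with respect to [wt]. *)
Definition opBs := uvlin (fun n k =>
  (- (qk k / (s ^+ 2 * S n ^+ 2))) *: uv n.+1 (k + 2) +
  (qk k * s ^+ 2 * cdiag n * brN n k) *: uv n (k + 1) +
  (- (qk k * s ^+ 2 * S n ^+ 2 * cdown n * brN n k * brN n (k + 1)))
    *: uv n.-1 k).
(** Like the other coefficients of [opA], this is obtained by solving the relation for E B for A. *)
Definition diagA n k : C := th / (1 + s ^+ 4) - S n / (s * (1 + s ^+ 4)) *
  cdiag n * (br s k * brN n (k - 1) - s ^+ 4 * brN n k * br s (k + 1)).
Definition opA := uvlin (fun n k =>
  (- (qk k / (s ^+ 3 * S n))) *: uv n.+1 (k + 1) + diagA n k *: uv n k +
  (S n * qk k / s * cdown n * br s k * brN n k) *: uv n.-1 (k - 1)).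

(* Where the target of a matrix coefficient leaves the index range, either the
   basis vector or the coefficient vanishes. *)
Lemma uvlinZ f c n k : (forall j, j < 0 -> f n j = 0) ->
  c = 0 \/ k <= (N n)%:Z -> c *: uvlin f (uv n k) = c *: f n k.
Proof.
move=> f0 [->|kN]; first by rewrite !scale0r.
case: k kN => [k|k] kN; first by rewrite uvlinE.
by rewrite f0 // uv_out // linear0.
Qed.

Lemma opFZ c n k : c = 0 \/ k <= (N n)%:Z ->
  c *: opF (uv n k) = (c * br s k) *: uv n (k - 1).
Proof.
move=> ck; rewrite uvlinZ ?scalerA // => j j0; rewrite uv_out ?scaler0 //.
by rewrite negb_and -ltNge; lia.
Qed.

Lemma opEZ c n k : c = 0 \/ 0 <= k ->
  c *: opE (uv n k) = (c * brN n k) *: uv n (k + 1).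
Proof.
move=> [->|]; first by rewrite mul0r !scale0r.
case: k => // k _; have [kN|kN] := leqP k (N n).
  by rewrite uvlinE // scalerA.
by rewrite !uv_out ?linear0 ?scaler0 // -?PoszD lez_nat -ltnNge // ltn_addr.
Qed.

Lemma opKE n k : opK (uv n k) = (qk k / S n) *: uv n k.
Proof.
have [/andP[k0 kN]|kN] := boolP (0 <= k <= (N n)%:Z); last first.
  by rewrite uv_out // linear0 scaler0.
by case: k k0 kN => // k _ kN; rewrite uvlinE.
Qed.

Lemma opKiE n k : opKi (uv n k) = (S n / qk k) *: uv n k.
Proof.
have [/andP[k0 kN]|kN] := boolP (0 <= k <= (N n)%:Z); last first.
  by rewrite uv_out // linear0 scaler0.
by case: k k0 kN => // k _ kN; rewrite uvlinE.
Qed.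

Lemma opBZ c n k : c = 0 \/ k <= (N n)%:Z ->
  c *: opB (uv n k) = (c * qk k) *: uv n.+1 k +
    (c * (qk k * br s k * cdiag n)) *: uv n (k - 1) +
    (c * (qk k * br s k * br s (k - 1) * cdown n)) *: uv n.-1 (k - 2).
Proof.
move=> ck; rewrite uvlinZ ?scalerDr ?scalerA // => j j0.
by rewrite !uv_out ?scaler0 ?addr0 // negb_and -!ltNge; lia.
Qed.

Lemma opAZ c n (k : int) : c = 0 \/ 0 <= k <= (N n)%:Z ->
  c *: opA (uv n k) = (c * - (qk k / (s ^+ 3 * S n))) *: uv n.+1 (k + 1) +
    (c * diagA n k) *: uv n k +
    (c * (S n * qk k / s * cdown n * br s k * brN n k)) *: uv n.-1 (k - 1).
Proof.
case=> [->|]; first by rewrite !(mul0r, scale0r) !addr0.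
by case: k => // k /= kN; rewrite uvlinE // !scalerDr !scalerA.
Qed.

Lemma ip_uvr n (k : nat) n' k' : (k <= N n)%N ->
  ip (uv n k) (uv n' k') = ((n' == n) && (k' == k))%:R * wt n k.
Proof.
move=> kN; rewrite ipC ip_uv // rmorphM /= (geC0_conj (ltW (wt_gt0 n k))).
by rewrite conjC_nat.
Qed.

Lemma conj_S n : (S n)^* = S n.
Proof. exact: conj_sq_exp. Qed.

Lemma conj_s k : (s ^+ k)^* = s ^+ k.
Proof. exact: (conj_sq_exp s_gt0 k). Qed.

Lemma conj_qx n : (qx n)^* = qx n.
Proof. by rewrite geC0_conj // ltW // qx_gt0. Qed.

Lemma conj_spec n : (spec d n)^* = spec d n.
Proof.
have c0 : qx0 s m \is Num.real by rewrite ger0_real // ltW // qx0_gt0.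
have cx : qx n \is Num.real by rewrite ger0_real // ltW // qx_gt0.
have cd : d \is Num.real by rewrite CrealE; apply/eqP; exact: disc_real d_sqr.
have ch : th / 2 \is Num.real.
  by rewrite rpredM ?realV ?realn // CrealE conj_theta.
apply/CrealP; rewrite /spec; move: (th / 2) ch => h ch.
by real_closure.
Qed.

Lemma conj_gapQ n : (gapQ n)^* = gapQ n.
Proof. exact/geC0_conj/ltW/gapQ_gt0. Qed.

Lemma conj_cup n : (cup n)^* = cup n.
Proof.
have cb j : br s j \is Num.real by rewrite CrealE conj_br.
have cx : qx n \is Num.real by rewrite CrealE conj_qx.
have cg : gapQ n \is Num.real by rewrite CrealE conj_gapQ.
by apply/CrealP; rewrite /cup; real_closure.
Qed.

Lemma conj_cdown n : (cdown n)^* = cdown n.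
Proof. by case: n => [|n]; rewrite /= ?conjC0 ?conj_cup. Qed.

Lemma conj_cdiag n : (cdiag n)^* = cdiag n.
Proof.
have cs : s \is Num.real by rewrite ger0_real // ltW.
have cS : S n \is Num.real by rewrite CrealE conj_S.
have cb : br s (N n) \is Num.real by rewrite CrealE conj_br.
have ct' : th \is Num.real by rewrite CrealE conj_theta.
have ca : spec d n \is Num.real by rewrite CrealE conj_spec.
apply/CrealP; rewrite /cdiag.
by real_closure.
Qed.

Lemma conj_diagA n k : (diagA n k)^* = diagA n k.
Proof.
have cs : s \is Num.real by rewrite ger0_real // ltW.
have cS : S n \is Num.real by rewrite CrealE conj_S.
have cb j : br s j \is Num.real by rewrite CrealE conj_br.
have ct' : th \is Num.real by rewrite CrealE conj_theta.
have cc : cdiag n \is Num.real by rewrite CrealE conj_cdiag.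
apply/CrealP; rewrite /diagA.
by real_closure.
Qed.

(* Picked up from the context by [drop_conj]. *)
Let real_s : s \is Num.real. Proof. by rewrite ger0_real // ltW. Qed.
Let real_S n : S n \is Num.real. Proof. by rewrite CrealE conj_S. Qed.
Let real_br k : br s k \is Num.real. Proof. by rewrite CrealE conj_br. Qed.
Let real_qk k : qk k \is Num.real. Proof. by rewrite CrealE conj_qk. Qed.
Let real_cdown n : cdown n \is Num.real.
Proof. by rewrite CrealE conj_cdown. Qed.
Let real_cup n : cup n \is Num.real.
Proof. by rewrite CrealE conj_cup. Qed.
Let real_cdiag n : cdiag n \is Num.real.
Proof. by rewrite CrealE conj_cdiag. Qed.
Let real_diagA n k : diagA n k \is Num.real.
Proof. by rewrite CrealE conj_diagA. Qed.

(** Relates the norms of consecutive levels to the downward coefficient [cup n]; the three ratios of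
    weights needed for the adjoints follow from it. *)
Lemma wt_step n : levelW n.+1 / brfact (N n.+1) =
  - s ^+ 2 * qx n * cup n * (levelW n / brfact (N n)).
Proof.
rewrite dimNS /= /cup; field.
rewrite !br_neq0 // !gt_eqF ?brfact_gt0 ?qx_gt0 //.
Qed.

Lemma wtE n k : wt n k =
  levelW n / brfact (N n) * (brfact k * brfact (N n - k)).
Proof. by rewrite /wt mulrCA mulrC mulrAC. Qed.

Lemma wt_up0 n k : (k <= N n)%N -> wt n.+1 k = - s ^+ 2 * qx n * cup n *
  (br s (N n - k).+1 * br s (N n - k).+2) * wt n k.
Proof.
move=> kN; rewrite wtE wt_step wtE.
have -> : (N n.+1 - k)%N = (N n - k).+2 by rewrite dimNS !subSn // leqW.
by rewrite /=; ring.
Qed.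

Lemma wt_up1 n k : (k <= N n)%N -> wt n.+1 k.+1 = - s ^+ 2 * qx n * cup n *
  (br s k.+1 * br s (N n - k).+1) * wt n k.
Proof.
move=> kN; rewrite wtE wt_step wtE.
have -> : (N n.+1 - k.+1)%N = (N n - k).+1 by rewrite dimNS subSS subSn.
by rewrite /=; ring.
Qed.

Lemma wt_up2 n k : (k <= N n)%N -> wt n.+1 k.+2 = - s ^+ 2 * qx n * cup n *
  (br s k.+1 * br s k.+2) * wt n k.
Proof.
move=> kN; rewrite wtE wt_step wtE.
have -> : (N n.+1 - k.+2)%N = (N n - k)%N by rewrite dimNS !subSS.
by rewrite /=; ring.
Qed.

(** * Adjoints *)

Lemma opE_adj u v : ip (opE u) v = ip u (opF v).
Proof.
move: u v; apply: uv_adj => n k n' k' kN kN'.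
rewrite !uvlinE // ipZl ipZr ip_uv // ip_uvr // conj_br //.
rewrite eq_sym subr_eq eq_sym; case: eqVneq => [nn|_]; last by rewrite !mul0r !mulr0.
rewrite nn in kN *; case: (eqVneq (k%:Z + 1)) => [kk|_]; last by rewrite !mul0r !mulr0.
have {}kk : k' = k.+1 by lia.
rewrite kk in kN' *; rewrite !mul1r subzn // mulrC wtS //; ring.
Qed.

Lemma opK_adj u v : ip (opK u) v = ip u (opK v).
Proof.
move: u v; apply: uv_adj => n k n' k' kN kN'.
rewrite !opKE ipZl ipZr ip_uv // rmorphM fmorphV /= conj_qk conj_S.
case: eqVneq => [->|_] /=; last by rewrite !mul0r !mulr0.
by case: eqVneq => [[->]|_] /=; rewrite ?mul0r ?mulr0.
Qed.

Lemma opKi_adj u v : ip (opKi u) v = ip u (opKi v).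
Proof.
move: u v; apply: uv_adj => n k n' k' kN kN'.
rewrite !opKiE ipZl ipZr ip_uv // rmorphM fmorphV /= conj_qk conj_S.
case: eqVneq => [->|_] /=; last by rewrite !mul0r !mulr0.
by case: eqVneq => [[->]|_] /=; rewrite ?mul0r ?mulr0.
Qed.

Lemma qk1 : qk 1 = s ^+ 2.
Proof. by rewrite (qk_nat 1). Qed.

Lemma qk2 : qk 2 = s ^+ 4.
Proof. by rewrite (qk_nat 2). Qed.

Lemma qk_dim n : qk (N n) = S n * S n.
Proof. by []. Qed.

Lemma qx_S n : qx n = (S n * s ^+ 2) ^+ 2.
Proof. by []. Qed.

Lemma opB_adj u v : ip (opB u) v = ip u (opBs v).
Proof.
have s0 : s != 0 by rewrite gt_eqF.
have Sn n : S n != 0 by rewrite sq_exp_neq0.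
move: u v; apply: uv_adj => n k n' k' kN kN'.
rewrite !uvlinE // !(ipDl, ipDr, ipZl, ipZr) ![in LHS]ip_uv // ![in RHS]ip_uvr //.
(* The upward part of one operator is paired with the downward part of the other, so the summands on
   the right are matched in reverse order. *)
rewrite [RHS]addrC [X in _ = _ + X]addrC addrA; congr (_ + _ + _).
- case: n' kN' => [|n'] kN' /=; first by rewrite !(mulr0, mul0r, oppr0, rmorph0).
  rewrite eqSS [n' == n]eq_sym; case: eqVneq => [nn|_]; last by rewrite !mul0r !mulr0.
  rewrite [(k' : int) == k]eq_sym; case: eqVneq => [[kk]|_]; last by rewrite !mul0r !mulr0.
  rewrite -{}nn -{}kk in kN' *.
  rewrite !mul1r wt_up0 //; drop_conj.
  have -> : (N n.+1)%:Z - k%:Z = (N n - k).+2 by rewrite dimNS; lia.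
  have -> : (N n.+1)%:Z - (k%:Z + 1) = (N n - k).+1 by rewrite dimNS; lia.
  by rewrite sdimNS // qx_S; ring.
- rewrite eq_sym subr_eq eq_sym; case: eqVneq => [nn|_]; last by rewrite !mul0r !mulr0.
  rewrite nn in kN *; case: (eqVneq (k'%:Z + 1)) => [kk|_]; last by rewrite !mul0r !mulr0.
  have {}kk : k = k'.+1 by lia.
  rewrite kk in kN *; rewrite !mul1r; drop_conj.
  rewrite subzn //; transitivity
    (qk k' * s ^+ 2 * cdiag n' * (wt n' k'.+1 * br s (N n' - k')%N)).
    by rewrite wtS // -addn1 PoszD qkD qk1; ring.
  by ring.
case: n kN => [|n] kN /=; first by rewrite !(mulr0, mul0r).
rewrite eqSS [n' == n]eq_sym; case: eqVneq => [nn|_]; last by rewrite !mul0r !mulr0.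
rewrite subr_eq eq_sym; case: eqVneq => [kk|_]; last by rewrite !mul0r !mulr0.
have {}kk : k = k'.+2 by lia.
rewrite kk nn in kN *; rewrite !mul1r wt_up2 //; drop_conj.
have -> : k'.+2%:Z - 1 = k'.+1 by lia.
have -> : k'.+2%:Z = k'%:Z + 2 by lia.
by rewrite qkD qk2 qx_S; field; rewrite Sn s0.
Qed.

Let s_neq0 : s != 0. Proof. by rewrite gt_eqF. Qed.
Let S_neq0 n : S n != 0. Proof. by rewrite sq_exp_neq0. Qed.
Let L_neq0 : (s * s) ^+ 2 - 1 != 0.
Proof. by rewrite subr_eq0 lt_eqF // -expr2 -exprM sq_expn_lt1. Qed.
Let s4_neq0 : 1 + s ^+ 4 != 0.
Proof. by rewrite gt_eqF // addr_gt0 ?ltr01 ?exprn_gt0. Qed.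

Lemma opA_adj u v : ip (opA u) v = ip u (opA v).
Proof.
move: u v; apply: uv_adj => n k n' k' kN kN'.
rewrite !uvlinE // !(ipDl, ipDr, ipZl, ipZr) ![in LHS]ip_uv // ![in RHS]ip_uvr //.
rewrite [RHS]addrC [X in _ = _ + X]addrC addrA; congr (_ + _ + _).
- case: n' kN' => [|n'] kN' /=; first by rewrite !(mulr0, mul0r, rmorph0).
  rewrite eqSS [n' == n]eq_sym; case: eqVneq => [nn|_]; last by rewrite !mul0r !mulr0.
  rewrite subr_eq [(k' : int) == _]eq_sym; case: (eqVneq (k%:Z + 1)) => [kk|_]; last by rewrite !mul0r !mulr0.
  have {}kk : k' = k.+1 by lia.
  rewrite -{}nn {}kk in kN' *; rewrite !mul1r wt_up1 //; drop_conj.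
  have -> : (N n.+1)%:Z - k.+1%:Z = (N n - k).+1 by rewrite dimNS; lia.
  have -> : k.+1%:Z = k%:Z + 1 by lia.
  by rewrite sdimNS // qx_S qkD qk1; field; rewrite s_neq0 S_neq0.
- rewrite eq_sym; case: eqVneq => [nn|_]; last by rewrite !mul0r !mulr0.
  rewrite nn in kN *; rewrite [(k : int) == _]eq_sym; case: eqVneq => [[kk]|_]; last by rewrite !mul0r !mulr0.
  by rewrite -kk !mul1r; drop_conj.
case: n kN => [|n] kN /=; first by rewrite !(mulr0, mul0r).
rewrite eqSS [n' == n]eq_sym; case: eqVneq => [nn|_]; last by rewrite !mul0r !mulr0.
rewrite subr_eq eq_sym; case: eqVneq => [kk|_]; last by rewrite !mul0r !mulr0.
have {}kk : k = k'.+1 by lia.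
rewrite kk nn in kN *; rewrite !mul1r wt_up1 //; drop_conj.
have -> : (N n'.+1)%:Z - k'.+1%:Z = (N n' - k').+1 by rewrite dimNS; lia.
have -> : k'.+1%:Z = k'%:Z + 1 by lia.
by rewrite sdimNS // qx_S qkD qk1; field; rewrite s_neq0 S_neq0.
Qed.

Lemma qk_dimS n : qk (N n.+1) = S n * S n * s ^+ 4.
Proof. by rewrite qk_dim sdimNS //; ring. Qed.

Definition qkE := (qkD, qkN, qk1, qk2).

(** * The cross relations, by computation in the rescaled basis *)

Lemma op_KKi u : opK (opKi u) = u.
Proof.
apply: (uv_ext (f := opK \o opKi) (g := idfun)) => n k kN /=.
rewrite opKiE (linZ opK) opKE scalerA -[RHS]scale1r; congr (_ *: _).
by field; rewrite S_neq0 qk_neq0.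
Qed.

Lemma op_KiK u : opKi (opK u) = u.
Proof.
apply: (uv_ext (f := opKi \o opK) (g := idfun)) => n k kN /=.
rewrite opKE (linZ opKi) opKiE scalerA -[RHS]scale1r; congr (_ *: _).
by field; rewrite S_neq0 qk_neq0.
Qed.

Lemma op_KE u : opK (opE u) = s ^+ 2 *: opE (opK u).
Proof.
apply: (uv_ext (f := opK \o opE) (g := *:%R (s ^+ 2) \o (opE \o opK))) => n k kN /=.
rewrite opKE (linZ opE) !uvlinE // (linZ opK) opKE !scalerA; congr (_ *: _).
by rewrite !qkE; field; rewrite S_neq0.
Qed.

Lemma op_EF u : opE (opF u) - opF (opE u) =
  (s ^+ 2 - s ^- 2)^-1 *: (opK (opK u) - opKi (opKi u)).
Proof.
apply: (uv_ext (f := (opE \o opF) \- (opF \o opE))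
  (g := *:%R (s ^+ 2 - s ^- 2)^-1 \o ((opK \o opK) \- (opKi \o opKi)))) => n k kN /=.
rewrite opKE opKiE (linZ opK) (linZ opKi) opKE opKiE !uvlinE //.
rewrite (linZ opE) (linZ opF) opEZ ?opFZ; last 2 first.
- have [->|kN'] := eqVneq k (N n); [left; rewrite subrr; exact: br0|right; lia].
- by case: k {kN} => [|k]; [left; exact: br0|right; lia].
rewrite subrK addrK !scalerA -!scalerBl scalerA; congr (_ *: _).
rewrite !br_qk !qkE qk_dim; field.
by rewrite s_neq0 S_neq0 qk_neq0 L_neq0.
Qed.

Lemma op_KB u : opK (opB u) = s ^- 2 *: opB (opK u).
Proof.
apply: (uv_ext (f := opK \o opB) (g := *:%R (s ^- 2) \o (opB \o opK))) => n k kN /=.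
rewrite opKE (linZ opB) uvlinE // !(linD opK) !(linZ opK) !opKE.
apply: (ip_inj (ip := ip)) => w; rewrite !(ipDl, ipZl) !qkE sdimNS //.
case: n kN => [|n] kN /=; last by rewrite sdimNS //; field; rewrite s_neq0 S_neq0.
by field; rewrite s_neq0 S_neq0.
Qed.

Lemma op_KA u : opK (opA u) = opA (opK u).
Proof.
apply: (uv_ext (f := opK \o opA) (g := opA \o opK)) => n k kN /=.
rewrite opKE (linZ opA) uvlinE // !(linD opK) !(linZ opK) !opKE.
apply: (ip_inj (ip := ip)) => w; rewrite !(ipDl, ipZl) !qkE sdimNS //.
case: n kN => [|n] kN /=; last by rewrite sdimNS //; field; rewrite s_neq0 S_neq0.
by field; rewrite s_neq0 S_neq0.
Qed.

Lemma op_FB u : opF (opB u) = s ^+ 2 *: opB (opF u).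
Proof.
apply: (uv_ext (f := opF \o opB) (g := *:%R (s ^+ 2) \o (opB \o opF))) => n k kN /=.
rewrite !uvlinE // !(linD opF) !(linZ opF) (linZ opB).
case: n kN => [|n] kN.
  rewrite /= !mulr0 !scale0r addr0 !opFZ ?opBZ; try by right; rewrite ?dimNS; lia.
  apply: (ip_inj (ip := ip)) => w; rewrite !(ipDl, ipZl) /= !qkE; field.
  exact: s_neq0.
rewrite /= !opFZ ?opBZ; try by right; move: kN; rewrite ?dimNS; lia.
apply: (ip_inj (ip := ip)) => w; rewrite !(ipDl, ipZl) /= !qkE.
have -> : k%:Z - 1 - 2 = k%:Z - 2 - 1 by lia.
have -> : k%:Z - 1 - 1 = k%:Z - 2 by lia.
by field; exact: s_neq0.
Qed.

Lemma op_EB u : opE (opB u) = s ^+ 2 *: opB (opE u) -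
  (s * (1 + s ^+ 4)) *: opA (opK u) + (th * s) *: opK u.
Proof.
apply: (uv_ext (f := opE \o opB) (g := ( *:%R (s ^+ 2) \o (opB \o opE)) \-
  ( *:%R (s * (1 + s ^+ 4)) \o (opA \o opK)) \+ ( *:%R (th * s) \o opK))) => n k kN /=.
have h1 : qk k * br s k * cdiag n = 0 \/ 0 <= k%:Z - 1.
  by case: (k) => [|?]; [left; rewrite br0 mulr0 mul0r|right; lia].
have h2 : qk k * br s k * br s (k%:Z - 1) * cdown n = 0 \/ 0 <= k%:Z - 2.
  case: (k) => [|[|?]]; [left|left|right; lia].
    by rewrite br0 mulr0 !mul0r.
  by rewrite subrr br0 mulr0 mul0r.
have h3 : qk k = 0 \/ 0 <= k%:Z by right.
have h4 : brN n k%:Z = 0 \/ k%:Z + 1 <= (N n)%:Z.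
  by have [->|kN'] := eqVneq k (N n); [left; rewrite subrr; exact: br0|right; lia].
have h5 : qk k / S n = 0 \/ 0 <= k%:Z <= (N n)%:Z by right; lia.
rewrite opKE (linZ opA) (opAZ h5) !uvlinE // (linZ opB) (opBZ h4).
rewrite !(linD opE) !(linZ opE) !opEZ //.
apply: (ip_inj (ip := ip)) => w; rewrite !(ipDl, ipNl, ipZl) /diagA.
rewrite subrK addrK.
have -> : k%:Z + 1 - 2 = k%:Z - 1 by lia.
have -> : k%:Z - 2 + 1 = k%:Z - 1 by lia.
case: n {h1 h2 h3 h4 h5} kN => [|n] kN /=.
  rewrite !br_qk !qkE qk_dimS qk_dim; field.
  by rewrite s_neq0 S_neq0 qk_neq0 L_neq0 s4_neq0.
rewrite !br_qk !qkE !qk_dimS !qk_dim !sdimNS //; field.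
by rewrite s_neq0 S_neq0 qk_neq0 L_neq0 s4_neq0.
Qed.

Lemma op_FA u : opF (opA u) = opA (opF u) - s ^- 3 *: opB (opK u).
Proof.
apply: (uv_ext (f := opF \o opA) (g := (opA \o opF) \-
  ( *:%R (s ^- 3) \o (opB \o opK)))) => n k kN /=.
have h1 : br s k = 0 \/ 0 <= k%:Z - 1 <= (N n)%:Z.
  by case: (k) kN => [|?] ?; [left; exact: br0|right; lia].
have h2 : S n * qk k / s * cdown n * br s k * brN n k%:Z = 0 \/
    k%:Z - 1 <= (N n.-1)%:Z.
  have [->|kN'] := eqVneq k (N n); first by left; rewrite subrr br0 mulr0.
  by right; case: (n) kN' kN => [|n']; rewrite ?dimNS /=; lia.
have h3 : - (qk k / (s ^+ 3 * S n)) = 0 \/ k%:Z + 1 <= (N n.+1)%:Z.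
  by right; rewrite dimNS; lia.
have h4 : diagA n k = 0 \/ k%:Z <= (N n)%:Z by right; lia.
rewrite opKE (linZ opB) !uvlinE // (linZ opA) (opAZ h1).
rewrite !(linD opF) !(linZ opF) !opFZ //.
apply: (ip_inj (ip := ip)) => w; rewrite !(ipDl, ipNl, ipZl) /diagA.
rewrite subrK addrK.
have -> : k%:Z - 1 - 1 = k%:Z - 2 by lia.
case: n {h1 h2 h3 h4} kN => [|n] kN /=.
  rewrite !br_qk !qkE ?qk_dimS ?qk_dim; field.
  by rewrite s_neq0 S_neq0 qk_neq0 L_neq0 s4_neq0.
rewrite !br_qk !qkE ?qk_dimS ?qk_dim ?sdimNS //; field.
by rewrite s_neq0 S_neq0 qk_neq0 L_neq0 s4_neq0.
Qed.

(** * The remaining cross relations, by taking adjoints *)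

Lemma op_KBs u : opK (opBs u) = s ^+ 2 *: opBs (opK u).
Proof.
apply: (ip_inj (ip := ip)) => w; rewrite ipZl opK_adj !(adj_swap opB_adj) opK_adj.
by rewrite op_KB ipZr fmorphV /= conj_s mulVKf // expf_neq0.
Qed.

Lemma op_FK u : opF (opK u) = s ^+ 2 *: opK (opF u).
Proof.
apply: (ip_inj (ip := ip)) => w; rewrite ipZl opK_adj !(adj_swap opE_adj) opK_adj.
by rewrite op_KE ipZr conj_s.
Qed.

Lemma op_EBs u : opE (opBs u) = s ^- 2 *: opBs (opE u).
Proof.
apply: (ip_inj (ip := ip)) => w; rewrite ipZl opE_adj !(adj_swap opB_adj) opE_adj.
by rewrite op_FB ipZr conj_s mulKf // expf_neq0.
Qed.

Lemma op_EA u : opE (opA u) = opA (opE u) + s^-1 *: opBs (opK u).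
Proof.
apply: (ip_inj (ip := ip)) => w; rewrite ipDl ipZl opE_adj !opA_adj opE_adj.
rewrite (adj_swap opB_adj) opK_adj op_KB op_FA (ipBr _) !ipZr !fmorphV /= !conj_s.
by field; exact: s_neq0.
Qed.

Lemma op_FBs u : opF (opBs u) = s ^- 2 *: opBs (opF u) +
  (s^-1 * (1 + s ^+ 4)) *: opA (opK u) - (th * s^-1) *: opK u.
Proof.
apply: (ip_inj (ip := ip)) => w; rewrite !(ipDl, ipNl, ipZl).
rewrite !(adj_swap opE_adj) !(adj_swap opB_adj) !opA_adj !opK_adj.
rewrite (adj_swap opE_adj) op_EB op_KA.
have real_th : th \is Num.real by rewrite CrealE conj_theta.
by rewrite ipDr ipBr !ipZr; drop_conj; field; exact: s_neq0.
Qed.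

(** Also true at spin 0, where the definition of [cdiag] divides by zero: there qx0 = 1, and the
    numerator on the right vanishes. *)
Lemma cdiagE n : br s (N n) * cdiag n =
  ((1 + s ^+ 4) * spec d n - th) / (s ^+ 3 * S n).
Proof.
have [n0|n0] := posnP (N n); last first.
  have bn : br s (N n) != 0 by rewrite br_neq0.
  by rewrite /cdiag; field; rewrite s_neq0 S_neq0 bn.
rewrite n0 br0 mul0r.
have [m0 nn] : m = 0%N /\ n = 0%N by move: n0; rewrite /dimN; lia.
have x0 : qx0 s m = 1 by rewrite /qx0 /dimN m0 expr0z expr1n.
have x1 := qx_sqr_neq1 s_gt0 s_lt1 m 0; rewrite qx_0 x0 mul1r in x1.
rewrite nn /spec qx_0 x0 mul1r; field.
by rewrite ?s_neq0 ?S_neq0 ?x1.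
Qed.

(** Away from the bottom the sphere relations use only this recursion: with [spec d n.+1]
    eliminated, [spec d n] can be treated as an arbitrary scalar. *)
Lemma specS n : spec d n.+1 =
  (s ^+ 4 * (1 - qx n ^+ 2) * spec d n - th * (s ^+ 4 - 1)) / (1 - qx n.+1 ^+ 2).
Proof.
have x1 := qx_sqr_neq1 s_gt0 s_lt1 m n.+1.
have x0 := qx_sqr_neq1 s_gt0 s_lt1 m n.
rewrite /spec !qxS // in x1 *; field.
by rewrite x1 x0 qx0_neq0.
Qed.

(* An operator that commutes with E up to a scalar vanishes as soon as it kills
   the lowest weight vectors. *)
Lemma zero_of_low (X : {linear V -> V}) (z : C) :
  (forall u, opE (X u) = z *: X (opE u)) -> z != 0 ->
  (forall n, X (uv n 0%N) = 0) -> forall u, X u = 0.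
Proof.
move=> XE z0 X0.
apply: (uv_ext (g := \0)) => n k kN.
elim: k kN => [|k IHk] kN; first exact: X0.
have := XE (uv n k); rewrite IHk ?(ltnW kN) // linear0 uvlinE ?(ltnW kN) //.
rewrite (linZ X) scalerA => /esym/eqP; rewrite scaler_eq0 mulf_eq0 (negbTE z0) /=.
rewrite subzn ?(ltnW kN) // (negbTE (br_neq0 s_gt0 s_lt1 _)) ?subn_gt0 //=.
by rewrite -PoszD addn1 => /eqP.
Qed.

(** * The sphere relations *)

Lemma A_uv0 n : opA (uv n 0%N) = (- (s ^+ 3 * S n)^-1) *: uv n.+1 1%N +
  diagA n 0 *: uv n 0%N.
Proof.
rewrite uvlinE // br0 mulr0 mul0r scale0r addr0; congr (_ *: _ + _ *: _).
by rewrite /qk expr0z mulr1 div1r.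
Qed.

Lemma Bs_uv0 n : opBs (uv n 0%N) =
  (- (s ^+ 2 * S n ^+ 2)^-1) *: uv n.+1 2%N +
  (s ^+ 2 * (br s (N n) * cdiag n)) *: uv n 1%N +
  (- (s ^+ 2 * S n ^+ 2 * cdown n * br s (N n) * brN n 1%:Z)) *: uv n.-1 0%N.
Proof.
rewrite uvlinE // subr0 add0r; congr (_ *: _ + _ *: _ + _ *: _);
  rewrite /qk expr0z mulr1 ?div1r ?mul1r //.
by rewrite mulrAC mulrA.
Qed.

Lemma B_uv0 n : opB (uv n 0%N) = uv n.+1 0%N.
Proof.
rewrite uvlinE // br0 !(mulr0, mul0r) !scale0r !addr0.
by rewrite /qk expr0z mulr1 scale1r.
Qed.

Lemma diagA0 n : diagA n 0 = spec d n.
Proof.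
rewrite /diagA br0 subr0 add0r br1 //.
transitivity (th / (1 + s ^+ 4) +
  s ^+ 3 * S n / (1 + s ^+ 4) * (br s (N n) * cdiag n)).
  by field; rewrite s_neq0 s4_neq0.
by rewrite cdiagE; field; rewrite s_neq0 S_neq0 s4_neq0.
Qed.

Lemma qk1n : qk 1%N = s ^+ 2.
Proof. by rewrite qk_nat. Qed.
Lemma qk2n : qk 2%N = s ^+ 4.
Proof. by rewrite qk_nat. Qed.
Lemma qk3n : qk 3%N = s ^+ 6.
Proof. by rewrite qk_nat. Qed.
Lemma qk0n : qk 0%N = 1.
Proof. by rewrite qk_nat. Qed.
Definition qknE := (qk0n, qk1n, qk2n, qk3n).

Lemma A_uv1 n : (0 < N n)%N -> opA (uv n 1%N) =
  (- (s ^+ 3 * S n)^-1 * s ^+ 2) *: uv n.+1 2%N + diagA n 1%N *: uv n 1%N +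
  (S n * s * cdown n * brN n 1%:Z) *: uv n.-1 0%N.
Proof.
move=> n0; rewrite uvlinE //; congr (_ *: _ + _ *: _ + _ *: _).
  by rewrite qk1n mulNr [_^-1 * _]mulrC.
by rewrite qk1n br1 //; field; exact: s_neq0.
Qed.

Lemma A_uv2 n : (1 < N n)%N -> opA (uv n 2%N) =
  (- (s ^+ 3 * S n)^-1 * s ^+ 4) *: uv n.+1 3%N + diagA n 2%N *: uv n 2%N +
  (S n * s ^+ 3 * cdown n * br s 2%N * brN n 2%:Z) *: uv n.-1 1%N.
Proof.
move=> n0; rewrite uvlinE //; congr (_ *: _ + _ *: _ + _ *: _).
  by rewrite qk2n mulNr [_^-1 * _]mulrC.
by rewrite qk2n; field; exact: s_neq0.
Qed.

Lemma Bs_uv1 n : (0 < N n)%N -> opBs (uv n 1%N) =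
  (- (S n ^+ 2)^-1) *: uv n.+1 3%N + (s ^+ 4 * cdiag n * brN n 1%:Z) *: uv n 2%N +
  (- (s ^+ 4 * S n ^+ 2 * cdown n * brN n 1%:Z * brN n 2%:Z)) *: uv n.-1 1%N.
Proof.
move=> n0; rewrite uvlinE // qk1n; congr (_ *: _ + _ *: _ + _ *: _); try ring.
by field; rewrite s_neq0 S_neq0.
Qed.

Lemma diagA1 n : diagA n 1%N = th / (1 + s ^+ 4) - S n / (s * (1 + s ^+ 4)) *
  cdiag n * (brN n 0%:Z - s ^+ 4 * brN n 1%:Z * br s 2%N).
Proof. by rewrite /diagA br1 // mul1r subrr. Qed.

Lemma diagA2 n : diagA n 2%N = th / (1 + s ^+ 4) - S n / (s * (1 + s ^+ 4)) *
  cdiag n * (br s 2%N * brN n 1%:Z - s ^+ 4 * brN n 2%:Z * br s 3%N).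
Proof. by []. Qed.

Lemma eq_neq0 (x y : C) : y != 0 -> x = y \/ x = - y -> x != 0.
Proof. by move=> y0 [->|->] //; rewrite oppr_eq0. Qed.

Lemma br_dim n j : br s (N n + j)%N = (S n * S n * s ^+ (j * 2) -
  (S n * S n * s ^+ (j * 2))^-1) / (s ^+ 2 - s ^- 2).
Proof. by rewrite br_qk PoszD qkD qk_dim qk_nat. Qed.

Lemma level_neq0 n j : (0 < N n + j)%N ->
  (S n * S n * s ^+ (j * 2)) ^+ 2 - 1 != 0.
Proof.
move=> nj; rewrite subr_eq0 lt_eqF // exprn_ilt1 //.
  rewrite mulr_ge0 ?exprn_ge0 ?ltW //; by rewrite mulr_gt0 ?sq_exp_gt0.
have -> : S n * S n * s ^+ (j * 2) = s ^+ ((N n + j) * 2).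
  by rewrite -!exprD; congr (_ ^+ _); lia.
by rewrite sq_expn_lt1 // muln_gt0 nj.
Qed.

Local Ltac nz :=
  repeat (apply/andP; split);
  first [ assumption | exact: s_neq0 | exact: S_neq0 | exact: s4_neq0
    | exact: L_neq0
    | match goal with h : is_true (_ - 1 != 0) |- _ =>
        apply: (eq_neq0 h); solve [left; ring | right; ring] end ].

Lemma ABs_up n :
  - (s ^+ 2 * S n ^+ 2)^-1 * diagA n.+1 2%N -
    s ^+ 2 * (br s (N n) * cdiag n) * ((s ^+ 3 * S n)^-1 * s ^+ 2) =
  s ^+ 4 * (- (s ^+ 3 * S n)^-1 * (s ^+ 4 * cdiag n.+1 * brN n.+1 1%:Z) -
    spec d n * (s ^+ 2 * S n ^+ 2)^-1).
Proof.
rewrite diagA2 cdiagE /cdiag specS qxS // qx_S !br_qk ?qknE !qkE ?qknE !qk_dimS !sdimNS //.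
have h2 : (S n * S n * s ^+ 4) ^+ 2 - 1 != 0.
  by apply: (@level_neq0 n 2); rewrite addn2.
have h4 : (S n * S n * s ^+ 8) ^+ 2 - 1 != 0.
  by apply: (@level_neq0 n 4); rewrite addn4.
move: (S_neq0 n) h2 h4; set X := S n => X0 h2 h4; field; nz.
Qed.

Lemma ABs_same n : - (s ^+ 2 * S n.+1 ^+ 2)^-1 *
    (S n.+2 * s ^+ 3 * cup n.+1 * br s 2%N * brN n.+2 2%:Z) +
    s ^+ 2 * (br s (N n.+1) * cdiag n.+1) * diagA n.+1 1%N +
    - (s ^+ 2 * S n.+1 ^+ 2 * cup n * br s (N n.+1) * brN n.+1 1%:Z) *
      - (s ^+ 3 * S n)^-1 =
  s ^+ 4 * (- (s ^+ 3 * S n.+1)^-1 *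
    - (s ^+ 4 * S n.+2 ^+ 2 * cup n.+1 * brN n.+2 1%:Z * brN n.+2 2%:Z) +
    spec d n.+1 * (s ^+ 2 * (br s (N n.+1) * cdiag n.+1))).
Proof.
rewrite cdiagE diagA1 /cdiag /cup /gapQ !specS !qxS // qx_S.
rewrite -[(N n.+1).+3]addn3 -[(N n.+1).+1]addn1 -[(N n).+3]addn3 -[(N n).+1]addn1.
rewrite !br_dim !br_qk ?qknE ?qkE ?qknE ?qk_dimS ?qk_dim ?sdimNS //.
have h1 : (S n * S n * s ^+ 2) ^+ 2 - 1 != 0.
  by apply: (@level_neq0 n 1); rewrite addn1.
have h2 : (S n * S n * s ^+ 4) ^+ 2 - 1 != 0.
  by apply: (@level_neq0 n 2); rewrite addn2.
have h3 : (S n * S n * s ^+ 6) ^+ 2 - 1 != 0.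
  by apply: (@level_neq0 n 3); rewrite addn3.
have h4 : (S n * S n * s ^+ 8) ^+ 2 - 1 != 0.
  by apply: (@level_neq0 n 4); rewrite addn4.
have h5 : (S n * S n * s ^+ 10) ^+ 2 - 1 != 0.
  by apply: (@level_neq0 n 5); rewrite addnS.
move: (S_neq0 n) h1 h2 h3 h4 h5; set X := S n => X0 h1 h2 h3 h4 h5.
by move: (spec d n) => a; field; nz.
Qed.

Lemma qx0_S : qx0 s m = S 0 ^+ 2.
Proof. by []. Qed.

Lemma ctE : ct = d ^+ 2 - th ^+ 2 / 4.
Proof. by rewrite d_sqr addrK. Qed.

(* The lowest level is where the value of [d] matters: the term with [cdown]
   is missing. *)
Lemma ABs_bottom : (0 < m)%N -> - (s ^+ 2 * S 0 ^+ 2)^-1 *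
    (S 1 * s ^+ 3 * cup 0 * br s 2%N * brN 1 2%:Z) +
    s ^+ 2 * (br s (N 0) * cdiag 0) * diagA 0 1%N =
  s ^+ 4 * (- (s ^+ 3 * S 0)^-1 *
    - (s ^+ 4 * S 1 ^+ 2 * cup 0 * brN 1 1%:Z * brN 1 2%:Z) +
    spec d 0 * (s ^+ 2 * (br s (N 0) * cdiag 0))).
Proof.
move=> m0; rewrite cdiagE diagA1 /cdiag /cup /gapQ ctE /spec qx_0 // qx0_S.
rewrite -[(N 0).+3]addn3 -[(N 0).+1]addn1 subr0.
rewrite !br_dim !br_qk ?qknE ?qkE ?qknE ?qk_dimS ?qk_dim ?sdimNS //.
have n0 j : (0 < N 0 + j)%N by rewrite /dimN addn0 addn_gt0 m0.
have h0 : (S 0 * S 0) ^+ 2 - 1 != 0.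
  by have := @level_neq0 0 0 (n0 0%N); rewrite expr0 mulr1.
have h1 : (S 0 * S 0 * s ^+ 2) ^+ 2 - 1 != 0 := @level_neq0 0 1 (n0 1%N).
have h2 : (S 0 * S 0 * s ^+ 4) ^+ 2 - 1 != 0 := @level_neq0 0 2 (n0 2%N).
have h3 : (S 0 * S 0 * s ^+ 6) ^+ 2 - 1 != 0 := @level_neq0 0 3 (n0 3%N).
move: (S_neq0 0) h0 h1 h2 h3; set X := S 0 => X0 h0 h1 h2 h3.
by field; nz.
Qed.

Lemma ABs_down n : s ^+ 2 * (br s (N n.+1) * cdiag n.+1) *
    (S n.+1 * s * cup n * brN n.+1 1%:Z) +
    - (s ^+ 2 * S n.+1 ^+ 2 * cup n * br s (N n.+1) * brN n.+1 1%:Z) *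
      spec d n =
  s ^+ 4 * (spec d n.+1 *
    - (s ^+ 2 * S n.+1 ^+ 2 * cup n * br s (N n.+1) * brN n.+1 1%:Z)).
Proof.
rewrite cdiagE !specS !qxS // qx_S; move: (cup n) (spec d n) => p a.
rewrite !br_qk ?qknE ?qkE ?qknE ?qk_dimS ?qk_dim ?sdimNS //.
have h4 : (S n * S n * s ^+ 8) ^+ 2 - 1 != 0.
  by apply: (@level_neq0 n 4); rewrite addn4.
by move: (S_neq0 n) h4; set X := S n => X0 h4; field; nz.
Qed.

(** Both sides have one component in each of the levels n + 2, n + 1, n and n - 1. Each component is
    a separate scalar identity, and the last two change their form near the bottom. *)
Lemma op_ABs_low n : opA (opBs (uv n 0%N)) = s ^+ 4 *: opBs (opA (uv n 0%N)).
Proof.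
have l1 : (0 < N n.+1)%N by rewrite dimNS.
have l2 : (1 < N n.+1)%N by rewrite dimNS.
rewrite A_uv0 Bs_uv0 !(linD opA) !(linZ opA) !(linD opBs) !(linZ opBs) Bs_uv0.
rewrite A_uv2 // Bs_uv1 // !diagA0.
have e1 := ABs_up n.
have e0 : - (s ^+ 2 * S n ^+ 2)^-1 * (- (s ^+ 3 * S n.+1)^-1 * s ^+ 4) =
    s ^+ 4 * (- (s ^+ 3 * S n)^-1 * - S n.+1 ^- 2).
  by rewrite sdimNS //; field; nz.
case: n l1 l2 e0 e1 => [|n] l1 l2 e0 e1.
  rewrite !mulr0 !mul0r oppr0 !scale0r !addr0 [cdown 1]/=.
  (* For l0 = 0 the bottom level is one-dimensional, so the component along [uv 0 1] is zero and
     needs no identity. *)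
  have [m0|m0] := posnP m.
    have N0 : N 0 = 0%N by rewrite /dimN m0.
    rewrite N0 in e0; rewrite N0 br0 mul0r mulr0 ?scale0r ?addr0 in e1 *.
    rewrite [uv 0.+1.-1 1%N]uv_out ?N0 // !scaler0 !addr0.
    apply: (ip_inj (ip := ip)) => w; rewrite !(ipDl, ipZl).
    lazymatch type of e0 with ?l0 = _ => lazymatch type of e1 with ?l1 = _ =>
    transitivity (l0 * ip (uv 2 3%N) w + l1 * ip (uv 1 2%N) w); first by ring
    end end.
    by rewrite e0 e1; ring.
  rewrite A_uv1 ?[cdown 0]/=; last by rewrite /dimN addn0.
  have e2 := ABs_bottom m0.
  apply: (ip_inj (ip := ip)) => w; rewrite !(ipDl, ipZl).
  lazymatch type of e0 with ?l0 = _ => lazymatch type of e1 with ?l1 = _ =>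
  lazymatch type of e2 with ?l2 = _ =>
  transitivity (l0 * ip (uv 2 3%N) w + l1 * ip (uv 1 2%N) w +
    l2 * ip (uv 0 1%N) w); first by rewrite [0.+1.-1]/=; ring
  end end end.
  by rewrite e0 e1 e2 [0.+1.-1]/=; ring.
rewrite A_uv1; last by rewrite dimNS.
rewrite A_uv0 diagA0 ![_.+1.-1]/=.
have e2 := ABs_same n; have e3 := ABs_down n.
rewrite [cdown n.+2]/= [cdown n.+1]/=.
apply: (ip_inj (ip := ip)) => w; rewrite !(ipDl, ipZl).
lazymatch type of e0 with ?l0 = _ => lazymatch type of e1 with ?l1 = _ =>
lazymatch type of e2 with ?l2 = _ => lazymatch type of e3 with ?l3 = _ =>
transitivity (l0 * ip (uv n.+3 3%N) w + l1 * ip (uv n.+2 2%N) w +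
  l2 * ip (uv n.+1 1%N) w + l3 * ip (uv n 0%N) w); first by ring
end end end end.
by rewrite e0 e1 e2 e3; ring.
Qed.

(** E commutes with B* up to a scalar, and the B* B* K terms coming from E A cancel. Hence the
    defect of this relation commutes with E up to s^-2, without the help of any other sphere
    relation. *)
Lemma op_ABs u : opA (opBs u) = s ^+ 4 *: opBs (opA u).
Proof.
pose T : {linear V -> V} :=
  (opA \o opBs) \- ( *:%R (s ^+ 4) \o (opBs \o opA)).
apply/eqP; rewrite -subr_eq0; apply/eqP; rewrite -[LHS]/(T u).
have s2 : s ^- 2 != 0 by rewrite invr_neq0 // expf_neq0.
apply: (zero_of_low _ s2) => [v|n]; rewrite /T /=; last first.
  by rewrite op_ABs_low subrr.
rewrite (linB opE) (linZ opE) op_EA op_EBs op_EBs op_EA !(linZ opA) op_KBs.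
rewrite !(linD opBs) !(linZ opBs).
apply: (ip_inj (ip := ip)) => w; rewrite !(ipDl, ipNl, ipZl).
by field; nz.
Qed.

Lemma op_AB u : opA (opB u) = s ^- 4 *: opB (opA u).
Proof.
apply: (ip_inj (ip := ip)) => w; rewrite ipZl !opA_adj !opB_adj opA_adj op_ABs.
by rewrite ipZr conj_s mulKf // expf_neq0.
Qed.

Lemma BsB_up n : s ^+ 2 * (br s (N n.+1) * cdiag n.+1) =
  th * - (s ^+ 3 * S n)^-1 - (- (s ^+ 3 * S n)^-1 * diagA n.+1 1%N +
    spec d n * - (s ^+ 3 * S n)^-1).
Proof.
rewrite cdiagE diagA1 /cdiag !specS !qxS // qx_S.
rewrite !br_qk ?qknE ?qkE ?qknE ?qk_dimS ?qk_dim ?sdimNS //.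
have h4 : (S n * S n * s ^+ 8) ^+ 2 - 1 != 0.
  by apply: (@level_neq0 n 4); rewrite addn4.
have h2 : (S n * S n * s ^+ 4) ^+ 2 - 1 != 0.
  by apply: (@level_neq0 n 2); rewrite addn2.
move: (S_neq0 n) h2 h4; set X := S n => X0 h2 h4.
by move: (spec d n) => a; field; nz.
Qed.

Lemma BsB_same n : - (s ^+ 2 * S n.+1 ^+ 2 * cup n * br s (N n.+1) * brN n.+1 1%:Z) =
  th * spec d n - (- (s ^+ 3 * S n)^-1 * (S n.+1 * s * cup n * brN n.+1 1%:Z) +
    spec d n * spec d n) + ct.
Proof.
rewrite /cup /gapQ qx_S -[(N n).+3]addn3 -[(N n).+1]addn1.
rewrite !br_dim !br_qk ?qknE ?qkE ?qknE ?qk_dimS ?qk_dim ?sdimNS //.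
have h1 : (S n * S n * s ^+ 2) ^+ 2 - 1 != 0.
  by apply: (@level_neq0 n 1); rewrite addn1.
have h3 : (S n * S n * s ^+ 6) ^+ 2 - 1 != 0.
  by apply: (@level_neq0 n 3); rewrite addn3.
move: (S_neq0 n) h1 h3; set X := S n => X0 h1 h3.
by move: (spec d n) => a; field; nz.
Qed.

Lemma op_BsB_low n : opBs (opB (uv n 0%N)) =
  th *: opA (uv n 0%N) - opA (opA (uv n 0%N)) + ct *: uv n 0%N.
Proof.
rewrite B_uv0 Bs_uv0 A_uv0 (linD opA) !(linZ opA) A_uv1; last by rewrite dimNS.
rewrite A_uv0 !diagA0 ![_.+1.-1]/= ![cdown n.+1]/=.
have e2 := BsB_up n; have e3 := BsB_same n.
have e1 : - (s ^+ 2 * S n.+1 ^+ 2)^-1 =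
    - (- (s ^+ 3 * S n)^-1 * (- (s ^+ 3 * S n.+1)^-1 * s ^+ 2)).
  by rewrite sdimNS //; field; nz.
apply: (ip_inj (ip := ip)) => w; rewrite !(ipDl, ipNl, ipZl).
by rewrite e1 e2 e3; ring.
Qed.

(** The defect commutes with E exactly, but only modulo the relation for A B*, which therefore comes
    first. *)
Lemma op_BsB u : opBs (opB u) = th *: opA u - opA (opA u) + ct *: u.
Proof.
pose Z : {linear V -> V} := (opBs \o opB) \- ( *:%R th \o opA) \+
  ((opA \o opA) \- *:%R ct).
have ZE v : Z v = opBs (opB v) - th *: opA v + (opA (opA v) - ct *: v) by [].
suff : Z u = 0.
  rewrite ZE => /eqP; rewrite addr_eq0 subr_eq => /eqP->.
  by rewrite opprB addrC addrA addrAC.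
apply: (zero_of_low _ (oner_neq0 C)) => [v|n]; last first.
  rewrite ZE op_BsB_low; apply: (ip_inj (ip := ip)) => w.
  by rewrite !(ipDl, ipNl, ipZl, ip0l); ring.
rewrite !ZE scale1r (linD opE) !(linB opE) !(linZ opE) op_EBs op_EB.
rewrite (op_EA (opA v)) op_EA (linD opA) (linZ opA) op_ABs op_KA.
rewrite (linD opBs) (linB opBs) !(linZ opBs).
by apply: (ip_inj (ip := ip)) => w; rewrite !(ipDl, ipNl, ipZl); field; nz.
Qed.

Lemma BBs_up n : - (s ^+ 2 * S n ^+ 2)^-1 * (s ^+ 4 * br s 2%N * cdiag n.+1) +
    s ^+ 2 * (br s (N n) * cdiag n) * s ^+ 2 =
  th * s ^+ 4 * - (s ^+ 3 * S n)^-1 - s ^+ 8 *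
    (- (s ^+ 3 * S n)^-1 * diagA n.+1 1%N + spec d n * - (s ^+ 3 * S n)^-1).
Proof.
rewrite cdiagE diagA1 /cdiag !specS !qxS // qx_S.
rewrite !br_qk ?qknE ?qkE ?qknE ?qk_dimS ?qk_dim ?sdimNS //.
have h4 : (S n * S n * s ^+ 8) ^+ 2 - 1 != 0.
  by apply: (@level_neq0 n 4); rewrite addn4.
have h2 : (S n * S n * s ^+ 4) ^+ 2 - 1 != 0.
  by apply: (@level_neq0 n 2); rewrite addn2.
move: (S_neq0 n) h2 h4; set X := S n => X0 h2 h4.
by move: (spec d n) => a; field; nz.
Qed.

Lemma BBs_same n :
  - (s ^+ 2 * S n.+1 ^+ 2)^-1 * (s ^+ 4 * br s 2%N * cup n.+1) +
    s ^+ 2 * (br s (N n.+1) * cdiag n.+1) * (s ^+ 2 * cdiag n.+1) -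
    s ^+ 2 * S n.+1 ^+ 2 * cup n * br s (N n.+1) * brN n.+1 1%:Z =
  th * s ^+ 4 * spec d n.+1 - s ^+ 8 * (- (s ^+ 3 * S n.+1)^-1 *
    (S n.+2 * s * cup n.+1 * brN n.+2 1%:Z) + spec d n.+1 * spec d n.+1) + ct.
Proof.
rewrite cdiagE /cdiag /cup /gapQ !specS !qxS // qx_S.
rewrite -[(N n.+1).+3]addn3 -[(N n.+1).+1]addn1 -[(N n).+3]addn3 -[(N n).+1]addn1.
rewrite !br_dim !br_qk ?qknE ?qkE ?qknE ?qk_dimS ?qk_dim ?sdimNS //.
have h1 : (S n * S n * s ^+ 2) ^+ 2 - 1 != 0.
  by apply: (@level_neq0 n 1); rewrite addn1.
have h2 : (S n * S n * s ^+ 4) ^+ 2 - 1 != 0.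
  by apply: (@level_neq0 n 2); rewrite addn2.
have h3 : (S n * S n * s ^+ 6) ^+ 2 - 1 != 0.
  by apply: (@level_neq0 n 3); rewrite addn3.
have h4 : (S n * S n * s ^+ 8) ^+ 2 - 1 != 0.
  by apply: (@level_neq0 n 4); rewrite addn4.
have h5 : (S n * S n * s ^+ 10) ^+ 2 - 1 != 0.
  by apply: (@level_neq0 n 5); rewrite addnS.
move: (S_neq0 n) h1 h2 h3 h4 h5; set X := S n => X0 h1 h2 h3 h4 h5.
by move: (spec d n) => a; field; nz.
Qed.

(** The counterpart of [bottom_sqr]: the contribution of a lower level is missing, and [ctE], that
    is the equation for d^2, makes up for it. *)
Lemma BBs_bottom : (0 < m)%N ->
  - (s ^+ 2 * S 0 ^+ 2)^-1 * (s ^+ 4 * br s 2%N * cup 0) +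
    s ^+ 2 * (br s (N 0) * cdiag 0) * (s ^+ 2 * cdiag 0) =
  th * s ^+ 4 * spec d 0 - s ^+ 8 * (- (s ^+ 3 * S 0)^-1 *
    (S 1 * s * cup 0 * brN 1 1%:Z) + spec d 0 * spec d 0) + ct.
Proof.
move=> m0; rewrite cdiagE /cdiag /cup /gapQ ctE /spec qx_0 // qx0_S.
rewrite -[(N 0).+3]addn3 -[(N 0).+1]addn1.
rewrite !br_dim !br_qk ?qknE ?qkE ?qknE ?qk_dimS ?qk_dim ?sdimNS //.
have n0 j : (0 < N 0 + j)%N by rewrite /dimN addn0 addn_gt0 m0.
have h0 : (S 0 * S 0) ^+ 2 - 1 != 0.
  by have := @level_neq0 0 0 (n0 0%N); rewrite expr0 mulr1.
have h1 : (S 0 * S 0 * s ^+ 2) ^+ 2 - 1 != 0 := @level_neq0 0 1 (n0 1%N).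
have h2 : (S 0 * S 0 * s ^+ 4) ^+ 2 - 1 != 0 := @level_neq0 0 2 (n0 2%N).
have h3 : (S 0 * S 0 * s ^+ 6) ^+ 2 - 1 != 0 := @level_neq0 0 3 (n0 3%N).
move: (S_neq0 0) h0 h1 h2 h3; set X := S 0 => X0 h0 h1 h2 h3.
by field; nz.
Qed.

Lemma BBs_bottom0 : N 0 = 0%N ->
  - (s ^+ 2 * S 0 ^+ 2)^-1 * (s ^+ 4 * br s 2%N * cup 0) =
  th * s ^+ 4 * spec d 0 - s ^+ 8 * (- (s ^+ 3 * S 0)^-1 *
    (S 1 * s * cup 0 * brN 1 1%:Z) + spec d 0 * spec d 0) + ct.
Proof.
move=> N0; have X1 : S 0 = 1 by rewrite N0 expr0z.
(* At spin 0 the identity [cdiagE] says that (1 + s^4) [spec d 0] = th, for either root d; this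
   replaces the equation for d^2. *)
have /esym/eqP := cdiagE 0; rewrite N0 br0 mul0r expr0z mulr1 mulf_eq0.
rewrite invr_eq0 expf_eq0 (negbTE s_neq0) orbF subr_eq0 => /eqP thE.
rewrite /cup /gapQ qx_S -[(N 0).+3]addn3 -[(N 0).+1]addn1.
rewrite !br_dim !br_qk ?qknE ?qkE ?qknE ?qk_dimS ?qk_dim ?sdimNS //.
have h1 : (s ^+ 2) ^+ 2 - 1 != 0.
  by have := @level_neq0 0 1; rewrite X1 !mul1r; apply; rewrite addn1.
have h3 : (s ^+ 6) ^+ 2 - 1 != 0.
  by have := @level_neq0 0 3; rewrite X1 !mul1r; apply; rewrite addn3.
rewrite X1; move: (spec d 0) thE => a <-; field; nz.
Qed.

Lemma B_uv1 n : (0 < N n)%N -> opB (uv n 1%N) =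
  s ^+ 2 *: uv n.+1 1%N + (s ^+ 2 * cdiag n) *: uv n 0%N.
Proof.
move=> n0; rewrite uvlinE // subrr br0 mulr0 mul0r scale0r addr0 qk1n br1 //.
by rewrite mulr1.
Qed.

Lemma B_uv2 n : (1 < N n)%N -> opB (uv n 2%N) = s ^+ 4 *: uv n.+1 2%N +
  (s ^+ 4 * br s 2%N * cdiag n) *: uv n 1%N +
  (s ^+ 4 * br s 2%N * cdown n) *: uv n.-1 0%N.
Proof.
move=> n0; rewrite uvlinE // qk2n -[2%N%:Z - 1]/(1%N : int) br1 // mulr1.
by rewrite -[2%N%:Z - 2]/(0%N : int).
Qed.

Lemma op_BBs_low n : opB (opBs (uv n 0%N)) = (th * s ^+ 4) *: opA (uv n 0%N) -
  s ^+ 8 *: opA (opA (uv n 0%N)) + ct *: uv n 0%N.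
Proof.
rewrite Bs_uv0 !(linD opB) !(linZ opB) A_uv0 (linD opA) !(linZ opA).
rewrite A_uv1; last by rewrite dimNS.
rewrite A_uv0 B_uv0 B_uv2; last by rewrite dimNS.
rewrite !diagA0 ![_.+1.-1]/= ![cdown n.+1]/=.
have e0 : - (s ^+ 2 * S n ^+ 2)^-1 * s ^+ 4 =
    - (s ^+ 8 * (- (s ^+ 3 * S n)^-1 * (- (s ^+ 3 * S n.+1)^-1 * s ^+ 2))).
  by rewrite sdimNS //; field; nz.
have e1 := BBs_up n.
case: n e0 e1 => [|n] e0 e1.
  rewrite [cdown 0]/= mulr0 !mul0r oppr0 scale0r addr0.
  have [m0|m0] := posnP m.
    have N0 : N 0 = 0%N by rewrite /dimN m0.
    have e2 := BBs_bottom0 N0.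
    rewrite N0 in e0 e1 e2 *; rewrite br0 mul0r mulr0 ?mul0r ?scale0r ?addr0 in e1 *.
    apply: (ip_inj (ip := ip)) => w; rewrite !(ipDl, ipNl, ipZl).
    lazymatch type of e0 with ?l0 = _ => lazymatch type of e1 with ?l1 = _ =>
    lazymatch type of e2 with ?l2 = _ =>
    transitivity (l0 * ip (uv 2 2%N) w + l1 * ip (uv 1 1%N) w +
      l2 * ip (uv 0 0%N) w); first by ring
    end end end.
    by rewrite e0 e1 e2; ring.
  have e2 := BBs_bottom m0.
  rewrite B_uv1; last by rewrite /dimN addn0.
  apply: (ip_inj (ip := ip)) => w; rewrite !(ipDl, ipNl, ipZl).
  lazymatch type of e0 with ?l0 = _ => lazymatch type of e1 with ?l1 = _ =>
  lazymatch type of e2 with ?l2 = _ =>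
  transitivity (l0 * ip (uv 2 2%N) w + l1 * ip (uv 1 1%N) w +
    l2 * ip (uv 0 0%N) w); first by ring
  end end end.
  by rewrite e0 e1 e2; ring.
rewrite B_uv1; last by rewrite dimNS.
have e2 := BBs_same n; rewrite [n.+1.-1]/= [cdown n.+1]/=.
apply: (ip_inj (ip := ip)) => w; rewrite !(ipDl, ipNl, ipZl).
lazymatch type of e0 with ?l0 = _ => lazymatch type of e1 with ?l1 = _ =>
lazymatch type of e2 with ?l2 = _ =>
transitivity (l0 * ip (uv n.+3 2%N) w + l1 * ip (uv n.+2 1%N) w +
  l2 * ip (uv n.+1 0%N) w); first by ring
end end end.
by rewrite e0 e1 e2; ring.
Qed.

Lemma op_BBs u : opB (opBs u) =
  (th * s ^+ 4) *: opA u - s ^+ 8 *: opA (opA u) + ct *: u.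
Proof.
pose Z : {linear V -> V} := (opB \o opBs) \- ( *:%R (th * s ^+ 4) \o opA) \+
  (( *:%R (s ^+ 8) \o (opA \o opA)) \- *:%R ct).
have ZE v : Z v = opB (opBs v) - (th * s ^+ 4) *: opA v +
  (s ^+ 8 *: opA (opA v) - ct *: v) by [].
suff : Z u = 0.
  rewrite ZE => /eqP; rewrite addr_eq0 subr_eq => /eqP->.
  by rewrite opprB addrC addrA addrAC.
apply: (zero_of_low _ (oner_neq0 C)) => [v|n]; last first.
  rewrite ZE op_BBs_low; apply: (ip_inj (ip := ip)) => w.
  by rewrite !(ipDl, ipNl, ipZl, ip0l); ring.
rewrite !ZE scale1r (linD opE) !(linB opE) !(linZ opE) op_EB op_EBs.
rewrite (op_EA (opA v)) op_EA (linD opA) (linZ opA) op_KBs op_KA (linZ opB) (linZ opA).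
rewrite !op_ABs.
by apply: (ip_inj (ip := ip)) => w; rewrite !(ipDl, ipNl, ipZl); field; nz.
Qed.

Lemma nrmS n k : (k < N n)%N ->
  nrm n k.+1 * rt s (N n - k) = nrm n k * rt s k.+1.
Proof.
move=> kN; apply/eqP; rewrite -(@eqrXn2 _ 2) // ?mulr_ge0 ?rt_ge0 //;
  try exact: ltW (nrm_gt0 _ _).
by rewrite !exprMn !expr2 !nrm_sqr !rt_sqr -(subzn (ltnW kN)) subzn ?(ltnW kN) // wtS.
Qed.

Lemma construction_model : spin_model s th ct opA opB opBs opE opF opK opKi.
Proof.
split; [split| | | | | | | | |].
- exact: op_KKi.
- exact: op_KiK.
- exact: op_KE.
- exact: op_FK.
- exact: op_EF.
- exact: op_KA.
- exact: op_EA.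
- exact: op_FA.
- exact: op_KB.
- exact: op_EB.
- exact: op_FB.
- exact: op_KBs.
- exact: op_EBs.
- exact: op_FBs.
- exact: op_AB.
- exact: op_ABs.
- exact: op_BsB.
- exact: op_BBs.
- exact: opA_adj.
- exact: opB_adj.
- exact: opE_adj.
- exact: opK_adj.
- exact: opKi_adj.
- move=> n k kN; rewrite svE (linZ opK) opKE !scalerA; congr (_ *: _); rewrite mulrC; congr (_ * _).
  by rewrite sqD // sqN /qk -sqD //; congr (_ ^ _ / _); lia.
- move=> n k; rewrite leq_eqVlt => /orP[/eqP kN|kN].
    rewrite [bvec b n k.+1]bvec_out ?scaler0; last first.
      by apply/negP => /andP[_]; rewrite lez_nat kN ltnn.
    rewrite svE (linZ opE) uvlinE ?kN // -kN subrr br0 scale0r scaler0 //.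
  rewrite !svE (linZ opE) uvlinE ?(ltnW kN) // !scalerA subzn ?(ltnW kN) //.
  rewrite -PoszD addn1; congr (_ *: _).
  rewrite -rt_sqr; apply: (mulfI (nrm_neq0 n k)); apply: (mulIf (nrm_neq0 n k.+1)).
  have e := nrmS kN.
  transitivity (nrm n k.+1 * rt s (N n - k) * rt s (N n - k)).
    by field; exact: nrm_neq0.
  rewrite e; field; exact: nrm_neq0.
- move=> n; rewrite svE (linZ opF) uvlinE // br0 scale0r scaler0 //.
- move=> n k kN; rewrite !svE (linZ opF) uvlinE // !scalerA -addn1 PoszD addrK addn1.
  congr (_ *: _); rewrite -PoszD addn1 -rt_sqr.
  apply: (mulfI (nrm_neq0 n k.+1)); apply: (mulIf (nrm_neq0 n k)).
  have e := nrmS kN.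
  transitivity (nrm n k * rt s k.+1 * rt s k.+1).
    by field; exact: nrm_neq0.
  rewrite -e; field; exact: nrm_neq0.
Qed.

Lemma construction_alp n : alp opA n = spec d n.
Proof.
rewrite /alp svE (linZ opA) A_uv0 !(ipZl, ipDl, ipZr) !ip_uv // !eqxx.
rewrite gtn_eqF //= !mul0r !mulr0 add0r mul1r diagA0.
rewrite fmorphV /= conj_nrm -nrm_sqr.
by field; exact: nrm_neq0.
Qed.

End Construction.

(** * Classification *)

Section Classification.
Variables (R : realType) (q : R) (c : \bar R) (m : nat).
Hypotheses (q_gt0 : 0 < q) (q_lt1 : q < 1) (c_ge0 : (0 <= c)%E).
Local Notation C := R[i].
Local Notation s := (sq q).
Local Notation th := (theta c).
Local Notation ct := (sphere_const c).
Local Notation bs := (spin_basis R m).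
Local Notation V := (bspace bs).
Local Notation ip := (bform bs).
Local Notation sv := (bvec bs).
Local Notation rep := (starRep (crossAlg q c) (spin_ip R m)).
Local Notation gens := (rep_gen (P := cross_pres q c)).
Local Notation spec_m := (spec s th m).
Local Notation disc := (ct + th ^+ 2 / 4).

Let s_gt0 : 0 < s. Proof. exact: sq_gt0. Qed.
Let s_lt1 : s < 1. Proof. exact: sq_lt1. Qed.

Lemma conj_theta : th^* = th.
Proof. by rewrite /theta; case: ifP; rewrite ?conjC0 ?conjC1. Qed.

Lemma sphere_const_ge0 : 0 <= ct.
Proof.
move: c_ge0; rewrite /sphere_const; case: c => [r r0||//]; last by rewrite ler01.
by rewrite lecR -lee_fin.
Qed.

(** Either theta = 0 and ct = 1, or theta = 1 and the summand 1 / 4 keeps the sum positive even for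
    c = 0. *)
Lemma disc_gt0 : 0 < disc.
Proof.
have ct0 := sphere_const_ge0; have q4 : 0 < 4^-1 :> C by rewrite invr_gt0 ltr0n.
move: ct0; rewrite /theta; case: eqP => [->|_] ct0.
  by rewrite /sphere_const expr0n /= mul0r addr0 ltr01.
by rewrite expr1n mul1r ltr_wpDl.
Qed.

(** This sequence separates the equivalence classes: [equiv_of_alp] shows that it is a complete
    invariant, and [gen_alp_equiv] that its first term is an invariant. *)
Definition gen_alp (pi : rep) n : C := alp (b := bs) (gens pi (inl gA)) n.

Lemma gen_alp_spec (pi : rep) : has_property_star pi ->
  exists2 d, d ^+ 2 = disc & forall n, gen_alp pi n = spec_m d n.
Proof.
move/(model_of_rep q_gt0 q_lt1 c_ge0) => M.
have [d d2 H] := alp_spec s_gt0 s_lt1 conj_theta sphere_const_ge0 disc_gt0 M.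
by exists d => // n; have [] := H n.
Qed.

Lemma equiv_of_alp (pi1 pi2 : rep) :
  has_property_star pi1 -> has_property_star pi2 ->
  (forall n, gen_alp pi1 n = gen_alp pi2 n) -> unitarily_equivalent pi1 pi2.
Proof.
move=> /(model_of_rep q_gt0 q_lt1 c_ge0) M1 /(model_of_rep q_gt0 q_lt1 c_ge0) M2.
move=> a12.
have [d d2 H] := alp_spec s_gt0 s_lt1 conj_theta sphere_const_ge0 disc_gt0 M1.
have b1 n : bet (b := bs) (gens pi1 (inl gB)) n != 0 by have [] := H n.
have U1 := phaseU_bij s_gt0 s_lt1 M1 M2 a12 b1.
have U2 := phaseU_iso s_gt0 s_lt1 M1 M2 a12 b1.
have U3 := phaseU_cross_op s_gt0 s_lt1 M1 M2 a12 b1.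
have U4 g u : phaseU (b := bs) (gens pi1 (inl gB)) (gens pi2 (inl gB)) (gens pi1 g u) =
    gens pi2 g (phaseU (b := bs) (gens pi1 (inl gB)) (gens pi2 (inl gB)) u).
  by have := U3 g u; case: g => [[]|[]].
exact: (@unitarily_equivalent_gens C (cross_pres q c) V ip pi1 pi2 _ U1 U2 U4).
Qed.

Lemma rep_of_disc d : d ^+ 2 = disc ->
  exists2 pi : rep, has_property_star pi & forall n, gen_alp pi n = spec_m d n.
Proof.
move=> d2.
have M := construction_model s_gt0 s_lt1 conj_theta sphere_const_ge0 disc_gt0 d2 bs.
have [pi pistar piE] := rep_of_model q_gt0 q_lt1 c_ge0 M.
exists pi => // n; rewrite /gen_alp /alp piE.
have := construction_alp s_gt0 s_lt1 conj_theta sphere_const_ge0 disc_gt0 d2 bs n.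
by rewrite /alp.
Qed.

(** A unitary intertwiner sends e_0 to a lowest weight vector of the same weight, hence to a
    multiple of e_0 by a scalar of modulus one, which cancels in the diagonal entry of A. *)
Lemma gen_alp_equiv (pi1 pi2 : rep) :
  has_property_star pi1 -> has_property_star pi2 ->
  unitarily_equivalent pi1 pi2 -> gen_alp pi1 0 = gen_alp pi2 0.
Proof.
move=> /(model_of_rep q_gt0 q_lt1 c_ge0) M1 /(model_of_rep q_gt0 q_lt1 c_ge0) M2.
move=> [U [_ Uiso Uint]].
have UintG g u : U (gens pi1 g u) = gens pi2 g (U u) by exact: Uint.
set e : V := sv 0 0%N.
have Ue : U e = ip (U e) e *: e.
  apply: (lowest_weight_sv s_gt0 s_lt1 M2).
    rewrite -[LHS]UintG; rewrite (K_low M1).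
    exact: linearZ.
  by rewrite -[LHS]UintG (mF0 M1) linear0.
set z := ip (U e) e in Ue.
have zz : z * z^* = 1.
  have := Uiso e e; rewrite Ue ipZl ipZr.
  by rewrite [spin_ip _ _ _ _](bform_vec bs) // !eqxx mulr1.
rewrite /gen_alp /alp -/e -[LHS]Uiso UintG Ue.
rewrite (linZ (gens pi2 (inl gA))) ipZl ipZr mulrA zz mul1r.
by [].
Qed.

(** The difference is proportional to d (1 - qx0^2): the first factor is nonzero by [disc_gt0], the
    second because l0 > 0. *)
Lemma spec_opp d : (0 < m)%N -> d ^+ 2 = disc -> spec_m d 0 <> spec_m (- d) 0.
Proof.
move=> m0 d2; have x1 := qx_sqr_neq1 s_gt0 s_lt1 m 0.
have x0 : qx0 s m != 0 by exact: qx0_neq0.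
have y1 := qx0_sqr_neq1 s_gt0 s_lt1 m0.
have y0 : qx s m 0 != 0 by rewrite gt_eqF ?qx_gt0.
have d0 : d != 0.
  by apply: contraTneq disc_gt0 => d0; rewrite -d2 d0 expr0n ltxx.
move=> /eqP; rewrite -subr_eq0.
have -> : spec_m d 0 - spec_m (- d) 0 =
    2 * d * (1 - qx0 s m ^+ 2) * qx s m 0 / (qx0 s m * (1 - qx s m 0 ^+ 2)).
  by rewrite /spec; field; rewrite x0 x1.
have n2 : (2 : C) != 0 by rewrite pnatr_eq0.
apply/negP/mulf_neq0; last by apply/invr_neq0/mulf_neq0.
by apply/mulf_neq0 => //; apply/mulf_neq0; first exact: mulf_neq0.
Qed.

Lemma spec_opp0 d n : m = 0%N -> spec_m (- d) n = spec_m d n.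
Proof.
move=> m0; have x0 : qx0 s m = 1 by rewrite /qx0 /dimN m0 expr0z expr1n.
by rewrite /spec x0 !divr1 !mulr1; ring.
Qed.

Lemma irreducible_rep (pi : rep) : has_property_star pi -> irreducible pi.
Proof.
move=> /(model_of_rep q_gt0 q_lt1 c_ge0) M [W1 [W2 [[i1 i2] n1 n2 o12 s12]]].
have [d d2 H] := alp_spec s_gt0 s_lt1 conj_theta sphere_const_ge0 disc_gt0 M.
have b1 n : bet (b := bs) (gens pi (inl gB)) n != 0 by have [] := H n.
have st (W : V -> Prop) : invariant_subspace pi W ->
    stable (b := bs) (gens pi (inl gB)) (gens pi (inr gE)) (gens pi (inr gF))
           (gens pi (inr gK)) W.
  by move=> [W0 WD Wpi]; split=> // u Wu; split; exact: Wpi.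
exact: (no_orthogonal_splitting s_gt0 s_lt1 M b1 (st _ i1) (st _ i2) n1 n2 o12 s12).
Qed.

End Classification.

Theorem mainTheorem1 (R : realType) (q : R) (c : \bar R)
    (hq0 : 0 < q) (hq1 : q < 1) (hc : (0 <= c)%E) :
  [/\ forall m : nat, (0 < m)%N ->
        exists pi1 pi2 : starRep (crossAlg q c) (spin_ip R m),
          [/\ has_property_star pi1, has_property_star pi2,
              ~ unitarily_equivalent pi1 pi2 &
              forall pi : starRep (crossAlg q c) (spin_ip R m),
                has_property_star pi ->
                unitarily_equivalent pi pi1 \/ unitarily_equivalent pi pi2],
      exists2 pi0 : starRep (crossAlg q c) (spin_ip R 0),
        has_property_star pi0 &
        forall pi : starRep (crossAlg q c) (spin_ip R 0),
          has_property_star pi -> unitarily_equivalent pi pi0 &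
      forall (m : nat) (pi : starRep (crossAlg q c) (spin_ip R m)),
        has_property_star pi -> irreducible pi].
Proof.
pose D := sphere_const c + theta c ^+ 2 / 4; pose d := sqrtC D.
have dE (e : R[i]) : e ^+ 2 = D -> e = d \/ e = - d.
  by rewrite -[D]sqrtCK => /eqP; rewrite eqf_sqr => /orP[] /eqP; [left|right].
have d2 : d ^+ 2 = D by exact: sqrtCK.
have d2N : (- d) ^+ 2 = D by rewrite sqrrN.
split.
- move=> m m0.
  have [pi1 s1 a1] := rep_of_disc m hq0 hq1 hc d2.
  have [pi2 s2 a2] := rep_of_disc m hq0 hq1 hc d2N.
  exists pi1, pi2; split=> //.
    move=> /(gen_alp_equiv hq0 hq1 hc s1 s2); rewrite a1 a2.
    exact: (spec_opp hq0 hq1 hc m0 d2).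
  move=> pi sp; have [e /dE[->|->] ae] := gen_alp_spec hq0 hq1 hc sp.
    by left; apply: (equiv_of_alp hq0 hq1 hc sp s1) => n; rewrite ae a1.
  by right; apply: (equiv_of_alp hq0 hq1 hc sp s2) => n; rewrite ae a2.
- have [pi0 s0 a0] := rep_of_disc 0 hq0 hq1 hc d2.
  exists pi0 => // pi sp; have [e /dE ed ae] := gen_alp_spec hq0 hq1 hc sp.
  apply: (equiv_of_alp hq0 hq1 hc sp s0) => n; rewrite ae a0.
  by case: ed => ->; rewrite ?spec_opp0.
- by move=> m pi; exact: irreducible_rep.
Qed.
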